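(* Let $r$ be a classical dynamical $r$-matrix with spectral parameter. The map $\rho:T^*\mathfrak h^*\times\mathfrak g^*\to T\mathfrak h^*\times L\mathfrak g$ given by $$(q,p,\xi)\mapsto(q,\,-i^*\xi,\,p+r_-^{\#}(q)\xi),\qquad q\in\mathfrak h^*,\ p\in\mathfrak h,\ \xi\in\mathfrak g^*,$$ is an $H$-equivariant Poisson map, where $H$ acts on $T^*\mathfrak h^*\times\mathfrak g^*$ and on $T\mathfrak h^*\times L\mathfrak g$ by the coadjoint and adjoint actions, respectively, on the second factors, $i:\mathfrak h\to\mathfrak g$ is the inclusion and $i^*:\mathfrak g^*\to\mathfrak h^*$ its dual. In other words, $\rho$ is an $H$-equivariant realization of $T^*\mathfrak h^*\times\mathfrak g^*$ in the dynamical Lie algebroid $T^*\mathfrak h^*\times L\mathfrak g^*$ defined by the operator $R$ associated with $r$.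
   Context: $\mathfrak g$ is a (finite-dimensional) complex Lie algebra, with Lie group $G$, and a nondegenerate ad-invariant symmetric bilinear form $(\cdot,\cdot)$; $\mathfrak h\subset\mathfrak g$ is an abelian Lie subalgebra on which the form is nondegenerate, and $H\subset G$ is the connected Lie subgroup with Lie algebra $\mathfrak h$. Conventions: $\langle ad_X^*\xi,Y\rangle=\langle\xi,[X,Y]\rangle$, $\langle Ad_x^*\xi,Y\rangle=\langle\xi,Ad_xY\rangle$; the coadjoint action of $x\in H$ is $\xi\mapsto Ad^*_{x^{-1}}\xi$. A classical dynamical $r$-matrix with spectral parameter is a meromorphic map $r:\mathfrak h^*\times\mathbb C\to\mathfrak g\otimes\mathfrak g$ with a simple pole at $z=0$ such that (away from poles): (i) $[h\otimes1+1\otimes h,r(q,z)]=0$ for $h\in\mathfrak h$; (ii) $r^{12}(q,z)+r^{21}(q,-z)=0$; (iii) $\mathrm{Res}_{z=0}r(q,z)=\Omega$, where $\Omega\in(S^2\mathfrak g)^{\mathfrak g}$ is the Casimir element of $(\cdot,\cdot)$; (iv) the classical dynamical Yang-Baxter equation, with $z_{i,j}=z_i-z_j$, $$\mathrm{Alt}(d_{\mathfrak h}r)+[r^{12}(q,z_{1,2}),r^{13}(q,z_{1,3})]+[r^{12}(q,z_{1,2}),r^{23}(q,z_{2,3})]+[r^{13}(q,z_{1,3}),r^{23}(q,z_{2,3})]=0,$$ where $\mathrm{Alt}(d_{\mathfrak h}r)=\sum_ih_i^{(1)}\frac{\partial r^{23}}{\partial q_i}(q,z_{2,3})+\sum_ih_i^{(2)}\frac{\partial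 r^{31}}{\partial q_i}(q,z_{3,1})+\sum_ih_i^{(3)}\frac{\partial r^{12}}{\partial q_i}(q,z_{1,2})$, $(h_i)$ is a basis of $\mathfrak h$ and $(q_i)$ the corresponding coordinates on $\mathfrak h^*$; (v) in the Laurent expansion $r(q,z)=\frac{\Omega}{z}+\sum_{k\ge0}t_k(q)z^k$ about $z=0$ the radius of convergence $c(r)$ is independent of $q$. Throughout, the base $\mathfrak h^*$ means the open set of $q\in\mathfrak h^*$ that are not poles of $r$. Notation: $L\mathfrak g$ (resp. $L\mathfrak g^*$) is the space of Laurent series $\sum_{n\ge-T}X_nz^n$ ($T$ finite) with coefficients in $\mathfrak g$ (resp. $\mathfrak g^*$) convergent in some $\{0<|z|<c\}$, with pointwise bracket on $L\mathfrak g$ and pairing $\langle\xi,X\rangle=\mathrm{Res}_{z=0}\langle\xi(z),X(z)\rangle$. $I:L\mathfrak g^*\to L\mathfrak g$ is the isomorphism $((I\xi)(z),Y)=\langle\xi(z),Y\rangle$. $j:\mathfrak h\to L\mathfrak g$ is the inclusion as constant series, $j^*:L\mathfrak g^*\to\mathfrak h^*$ its dual. $r_-^{\#}(q):\mathfrak g^*\to L\mathfrak g$ is defined by $\langle(r_-^{\#}(q)\xi)(z),\eta\rangle=\langle r(q,z),\eta\otimes\xi\rangle$. The operator $R:\mathfrak h^*\to\mathcal L(L\mathfrak g^*,L\mathfrak g)$ is $$(R_q\xi)(z)=\tfrac12(I\xi)(z)+\sum_{k\ge0}\frac1{k!}\Big\langle\frac{\partial^kr}{\partial z^k}(q,-z),\xi_{-(k+1)}\otimes1\Big\rangle,$$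 where $\langle s,\eta\otimes1\rangle$ is contraction of the first factor. Lie algebroid. $T^*\mathfrak h^*\times L\mathfrak g^*$ (bundle over $\mathfrak h^*$ with fibre $\mathfrak h\oplus L\mathfrak g^*$) is a Lie algebroid with anchor $a_*(q,p,\xi)=(q,j^*\xi)$ and with bracket determined, via the Leibniz rule, by $[\omega,\theta]=0$ for $\omega,\theta\in\Omega^1(\mathfrak h^* )$, $[h,\xi]=ad_h^*\xi$, $[\xi,\eta]=d\langle R\xi,\eta\rangle-ad^*_{R\xi}\eta+ad^*_{R\eta}\xi$ for constant sections $h\in\mathfrak h$, $\xi,\eta\in L\mathfrak g^*$. Poisson structures. For a Lie algebroid $A\to M$ with anchor $a$, the Lie-Poisson structure on the dual bundle is determined by $\{f,g\}=0$, $\{l_X,f\}=a(X)f$, $\{l_X,l_Y\}=l_{[X,Y]}$ for functions $f,g$ on $M$ and sections $X,Y$ of $A$, where $l_X(\mu)=\langle\mu,X\rangle$. $T\mathfrak h^*\times L\mathfrak g$ carries the Lie-Poisson structure dual to $T^*\mathfrak h^*\times L\mathfrak g^*$ (for functions with fibre derivatives in the restricted dual $\mathfrak h\oplus L\mathfrak g^*$). $T^*\mathfrak h^*\times\mathfrak g^*$ carries the product of the canonical structure and the (plus) Lie-Poisson structure, i.e. the Lie-Poisson structure dual to the product Lie algebroid $T\mathfrak h^*\times\mathfrak g$ (anchor = first projection; bracket $[(X,\xi),(Y,\eta)]=([X,Y],[\xi,\eta]+L_X\eta-L_Y\xi)$); in particular $\{p_i,q_k\}=\delta_{ik}$ in dual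 coordinates and $\{l_X,l_Y\}=l_{[X,Y]}$ on $\mathfrak g^*$. A realization of a Poisson manifold in $T^*\mathfrak h^*\times L\mathfrak g^*$ is a Poisson map to $T\mathfrak h^*\times L\mathfrak g$. *)

(* Defs.v *)
From HB Require Import structures.
From mathcomp Require Import all_boot all_order all_algebra.
From mathcomp Require Import complex.
From mathcomp Require Import all_classical all_reals all_analysis.

Set Implicit Arguments.
Unset Strict Implicit.
Unset Printing Implicit Defensive.

Import Order.TTheory GRing.Theory Num.Theory.
Import numFieldNormedType.Exports.

Local Open Scope classical_set_scope.
Local Open Scope ring_scope.

(* The detour through numClosedFieldType makes the normed-space structures on
   C and on matrices over C available. Since C is only partially ordered,
   [0 < e] with [e : C] says that [e] is a positive real number. *)
Definition Cplx (R : realType) : numClosedFieldType := R[i].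

Section Holomorphy.
Variable R : realType.
Local Notation C := (Cplx R).

(* Holomorphic near p, in Weierstrass' sense: f is the sum, on a polydisc
   centred at p, of a power series in N variables (summed here over the cubes
   of multi-indices with all entries < d; the Cauchy bound on the coefficients
   makes the convergence absolute). *)
Definition holo_at (N : nat) (f : 'rV[C]_N -> C) (p : 'rV[C]_N) : Prop :=
  exists (a : {ffun 'I_N -> nat} -> C) (e M : C),
    [/\ 0 < e,
        forall al, `|a al| * \prod_i e ^+ al i <= M &
        forall v : 'rV[C]_N, (forall i, `|v 0 i| < e) ->
          (fun d : nat => \sum_(al : {ffun 'I_N -> 'I_d})
             a [ffun i => nat_of_ord (al i)] * \prod_i v 0 i ^+ al i)
          @ \oo --> f (p + v)].

Definition holo_mx_at (N k l : nat) (f : 'rV[C]_N -> 'M[C]_(k, l))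
    (p : 'rV[C]_N) : Prop :=
  forall i j, holo_at (fun x => f x i j) p.

Definition uncurry_z (m k l : nat) (r : 'rV[C]_m -> C -> 'M[C]_(k, l))
    (x : 'rV[C]_(m + 1)) : 'M[C]_(k, l) :=
  r (lsubmx x) (rsubmx x 0 0).

Definition point_z (m : nat) (q : 'rV[C]_m) (z : C) : 'rV[C]_(m + 1) :=
  row_mx q z%:M.

Definition regular_at (m k l : nat) (r : 'rV[C]_m -> C -> 'M[C]_(k, l))
    (q : 'rV[C]_m) (z : C) : Prop :=
  holo_mx_at (uncurry_z r) (point_z q z).

(* A meromorphic map is a total function which is locally a quotient N / D of
   holomorphic ones; its values on the zeros of D are irrelevant. *)
Definition meromorphic (m k l : nat) (r : 'rV[C]_m -> C -> 'M[C]_(k, l)) :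
    Prop :=
  forall x0 : 'rV[C]_(m + 1),
  exists (N : 'rV[C]_(m + 1) -> 'M[C]_(k, l)) (D : 'rV[C]_(m + 1) -> C),
    [/\ holo_mx_at N x0, holo_at D x0,
        ~ (\forall x \near x0, D x = 0) &
        \forall x \near x0, D x != 0 -> uncurry_z r x = (D x)^-1 *: N x].

(* The set of q that are not poles of r, for an r with a simple pole at z = 0:
   near (q, 0), r is holomorphic off z = 0 and z r extends holomorphically. *)
Definition base (m k l : nat) (r : 'rV[C]_m -> C -> 'M[C]_(k, l)) :
    set 'rV[C]_m :=
  [set q | exists f : 'rV[C]_(m + 1) -> 'M[C]_(k, l),
     holo_mx_at f (point_z q 0) /\
     \forall x \near point_z q 0, rsubmx x 0 0 != 0 ->
       regular_at r (lsubmx x) (rsubmx x 0 0) /\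
       f x = rsubmx x 0 0 *: uncurry_z r x].

Definition cvg_radius (k l : nat) (t : nat -> 'M[C]_(k, l)) : \bar R :=
  ereal_sup [set (complex.Re (`|z| : R[i]))%:E | z in
    [set z : C | cvgn (series (fun j => z ^+ j *: t j))]].

End Holomorphy.

Section LieAlgebra.
Variable R : realType.
Local Notation C := (Cplx R).

(* Row vectors are coordinates of elements of g, g^*, h, h^* in a basis or its
   dual basis, so that the pairing of a space with its dual is [dotp]. *)
Definition dotp (n : nat) (u v : 'rV[C]_n) : C := (u *m v^T) 0 0.

Record lie_algebra (n : nat) := LieAlgebra {
  lbr : 'rV[C]_n -> 'rV[C]_n -> 'rV[C]_n;
  lbr_linl : forall Y, linear (lbr^~ Y);
  lbr_linr : forall X, linear (lbr X);
  lbr_alt : forall X, lbr X X = 0;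
  lbr_jacobi : forall X Y Z,
    lbr X (lbr Y Z) + lbr Y (lbr Z X) + lbr Z (lbr X Y) = 0 }.

(* (X, Y) = X *m form *m Y^T *)
Record quadratic_lie_algebra (n : nat) := QuadraticLieAlgebra {
  qlie :> lie_algebra n;
  form : 'M[C]_n;
  form_sym : form^T = form;
  form_nondeg : form \in unitmx;
  form_inv : forall X Y Z : 'rV[C]_n,
    dotp (lbr qlie X Y *m form) Z + dotp (Y *m form) (lbr qlie X Z) = 0 }.

(* The rows of [incl] are the basis (h_i) of h; [u *m incl] is the inclusion
   i : h -> g, and [xi *m incl^T] its dual i^* : g^* -> h^*. *)
Record abelian_subalgebra (n : nat) (g : quadratic_lie_algebra n) (m : nat) :=
  AbelianSubalgebra {
  incl :> 'M[C]_(m, n);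
  incl_free : row_free incl;
  incl_abelian : forall u v : 'rV[C]_m, lbr g (u *m incl) (v *m incl) = 0;
  incl_nondeg : incl *m form g *m incl^T \in unitmx }.

(* Y *m ad_mx g X = [X, Y] *)
Definition ad_mx (n : nat) (g : lie_algebra n) (X : 'rV[C]_n) : 'M[C]_n :=
  lin1_mx (lbr g X).

(* <coad X xi, Y> = <xi, [X, Y]> *)
Definition coad (n : nat) (g : lie_algebra n) (X xi : 'rV[C]_n) : 'rV[C]_n :=
  xi *m (ad_mx g X)^T.

(* An element s of g (x) g is the matrix with s = \sum_ab s a b e_a (x) e_b, so
   that <s, eta (x) xi> = eta *m s *m xi^T. The Casimir element is the inverse
   of the Gram matrix. *)
Definition casimir (n : nat) (g : quadratic_lie_algebra n) : 'M[C]_n :=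
  invmx (form g).

(* the isomorphism g^* -> g given by the form *)
Definition sharp (n : nat) (g : quadratic_lie_algebra n) (xi : 'rV[C]_n) :
  'rV[C]_n := xi *m invmx (form g).

Section LieGroup.
Variables (n : nat) (G : groupType).
Variables (par : 'rV[C]_n -> G) (coord : G -> 'rV[C]_n).

Definition in_chart (rad : C) (x : G) : Prop :=
  `|coord x| < rad /\ par (coord x) = x.

Definition Ad_chart (x : G) (Y : 'rV[C]_n) : 'rV[C]_n :=
  'D_Y (fun v => coord (x * par v * x^-1)%g) 0.
End LieGroup.

(* A complex Lie group with Lie algebra g, presented (Bourbaki, Lie III.1.9,
   Prop. 18) by its abstract group and a chart at the identity, with inverse
   the parametrization [lg_par] of a neighbourhood of the identity by a ball of
   g, in which (x, y) |-> x y^-1 is holomorphic near (1, 1) and every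
   conjugation is holomorphic near 1. The last field identifies the bracket of
   g with the differential at the identity of x |-> Ad_x. *)
Record lie_group (n : nat) (g : lie_algebra n) := LieGroup {
  lg_group :> groupType;
  lg_par : 'rV[C]_n -> lg_group;
  lg_coord : lg_group -> 'rV[C]_n;
  lg_rad : C;
  lg_rad_gt0 : 0 < lg_rad;
  lg_par0 : lg_par 0 = 1%g;
  lg_parK : forall v, `|v| < lg_rad -> lg_coord (lg_par v) = v;
  lg_div_chart : \forall w \near (0 : 'rV[C]_(n + n)),
    in_chart lg_par lg_coord lg_rad
      (lg_par (lsubmx w) * (lg_par (rsubmx w))^-1)%g;
  lg_div_holo : holo_mx_at (fun w : 'rV[C]_(n + n) =>
    lg_coord (lg_par (lsubmx w) * (lg_par (rsubmx w))^-1)%g) 0;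
  lg_conj_chart : forall x, \forall v \near (0 : 'rV[C]_n),
    in_chart lg_par lg_coord lg_rad (x * lg_par v * x^-1)%g;
  lg_conj_holo : forall x,
    holo_mx_at (fun v => lg_coord (x * lg_par v * x^-1)%g) 0;
  lg_ad : forall Y : 'rV[C]_n,
    is_diff (0 : 'rV[C]_n) (fun v => Ad_chart lg_par lg_coord (lg_par v) Y)
      (fun X => lbr g X Y) }.

Definition Ad (n : nat) (g : lie_algebra n) (G : lie_group g) (x : G) :
  'rV[C]_n -> 'rV[C]_n := Ad_chart (@lg_par _ _ G) (@lg_coord _ _ G) x.

(* <coAd x xi, Y> = <xi, Ad x Y> *)
Definition coAd (n : nat) (g : lie_algebra n) (G : lie_group g) (x : G)
  (xi : 'rV[C]_n) : 'rV[C]_n := xi *m (lin1_mx (Ad x))^T.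

(* c(s) = exp (s X) *)
Definition one_parameter_subgroup (n : nat) (g : lie_algebra n)
    (G : lie_group g) (X : 'rV[C]_n) (c : C -> G) : Prop :=
  [/\ forall s u, c (s + u) = (c s * c u)%g,
      \forall s \near (0 : C),
        in_chart (@lg_par _ _ G) (@lg_coord _ _ G) (lg_rad G) (c s) &
      is_derive (0 : C) 1 (fun s => lg_coord (c s)) X].

(* The connected Lie subgroup H of G with Lie algebra h is the subgroup
   generated by exp(h). *)
Inductive connected_subgroup (n : nat) (g : quadratic_lie_algebra n) (m : nat)
    (h : abelian_subalgebra g m) (G : lie_group g) : G -> Prop :=
| connected_subgroup_exp (u : 'rV[C]_m) (c : C -> G) (s : C) :
    one_parameter_subgroup (u *m h) c -> connected_subgroup h (c s)
| connected_subgroup1 : connected_subgroup h (1%g : G)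
| connected_subgroupV (x : G) :
    connected_subgroup h x -> connected_subgroup h (x^-1)%g
| connected_subgroupM (x y : G) :
    connected_subgroup h x -> connected_subgroup h y ->
    connected_subgroup h (x * y)%g.

End LieAlgebra.

Section RMatrix.
Variable R : realType.
Local Notation C := (Cplx R).
Variables (m n : nat) (g : quadratic_lie_algebra R n).
Variable (h : abelian_subalgebra g m).

(* the bracket [e_i, e_j]_k of basis vectors *)
Definition struct_const (i j k : 'I_n) : C :=
  lbr g (delta_mx 0 i) (delta_mx 0 j) 0 k.

(* Elements of g (x) g (x) g are given by their coordinates on
   e_a (x) e_b (x) e_c. The following are [s^12, t^13], [s^12, t^23] and
   [s^13, t^23]. *)
Definition br12_13 (s t : 'M[C]_n) (a b c : 'I_n) : C :=
  \sum_i \sum_j s i b * t j c * struct_const i j a.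
Definition br12_23 (s t : 'M[C]_n) (a b c : 'I_n) : C :=
  \sum_i \sum_j s a i * t j c * struct_const i j b.
Definition br13_23 (s t : 'M[C]_n) (a b c : 'I_n) : C :=
  \sum_i \sum_j s a i * t b j * struct_const i j c.

Definition dq (W : normedModType C) (f : 'rV[C]_m -> W) (i : 'I_m)
  (q : 'rV[C]_m) : W := 'D_(delta_mx 0 i) f q.

Definition Alt_dh (r : 'rV[C]_m -> C -> 'M[C]_n) (q : 'rV[C]_m)
    (z1 z2 z3 : C) (a b c : 'I_n) : C :=
  \sum_i h i a * dq (r^~ (z2 - z3)) i q b c +
  \sum_i h i b * dq (r^~ (z3 - z1)) i q c a +
  \sum_i h i c * dq (r^~ (z1 - z2)) i q a b.

(* A classical dynamical r-matrix r with spectral parameter, together with its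
   Laurent coefficients t q k at z = 0. On q in the base, the order of the pole
   along z = 0 is at most 1, so non-emptiness of the base says that r has (at
   most) a simple pole along the hyperplane z = 0. *)
Record dynamical_rmatrix (r : 'rV[C]_m -> C -> 'M[C]_n)
    (t : 'rV[C]_m -> nat -> 'M[C]_n) : Prop := {
  drm_mero : meromorphic r;
  drm_pole : base r !=set0;
  drm_zero_weight : forall (q : 'rV[C]_m) (z : C) (u : 'rV[C]_m),
    regular_at r q z ->
    (ad_mx g (u *m h))^T *m r q z + r q z *m ad_mx g (u *m h) = 0;
  drm_unitarity : forall (q : 'rV[C]_m) (z : C),
    regular_at r q z -> regular_at r q (- z) ->
    r q z + (r q (- z))^T = 0;
  drm_residue : forall q, base r q ->
    z *: r q z @[z --> (0 : C)^'] --> casimir g;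
  drm_cdybe : forall (q : 'rV[C]_m) (z1 z2 z3 : C),
    regular_at r q (z1 - z2) -> regular_at r q (z1 - z3) ->
    regular_at r q (z2 - z3) -> regular_at r q (z3 - z1) ->
    forall a b c : 'I_n,
      Alt_dh r q z1 z2 z3 a b c
      + br12_13 (r q (z1 - z2)) (r q (z1 - z3)) a b c
      + br12_23 (r q (z1 - z2)) (r q (z2 - z3)) a b c
      + br13_23 (r q (z1 - z3)) (r q (z2 - z3)) a b c = 0;
  drm_laurent : forall q, base r q ->
    \forall z \near (0 : C)^',
      series (fun k => z ^+ k *: t q k) @ \oo --> r q z - z^-1 *: casimir g;
  drm_radius : exists c : \bar R, forall q, base r q -> cvg_radius (t q) = c }.

End RMatrix.

Section Loops.
Variable R : realType.
Local Notation C := (Cplx R).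
Variable n : nat.

(* X k is the coefficient of z^k. Elements of L g and L g^* are the X such that
   [is_loop X]; since they have finite principal parts, all the sums over int
   or nat below are finite ([\sum_(i \in A)] is the sum over the support). *)
Definition loop := int -> 'rV[C]_n.

Definition is_loop (X : loop) : Prop :=
  (exists T : int, forall k, k < T -> X k = 0) /\
  (exists2 c : C, 0 < c & forall z : C, `|z| < c ->
     cvgn (series (fun k : nat => z ^+ k *: X k%:Z))).

(* <xi, X> = Res_{z = 0} <xi(z), X(z)> *)
Definition loop_pair (xi X : loop) : C :=
  \sum_(k \in [set: int]) dotp (xi (- k - 1)) (X k).

(* coefficients of op (X(z)) (Y(z)), for a bilinear op *)
Definition loop_op (op : 'rV[C]_n -> 'rV[C]_n -> 'rV[C]_n) (X Y : loop) :
  loop := fun k => \sum_(i \in [set: int]) op (X i) (Y (k - i)).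

Definition const_loop (X : 'rV[C]_n) : loop := fun k => if k == 0 then X else 0.

(* s'(z) and s(-z) for a Laurent series s *)
Definition laurent_deriv (s : int -> 'M[C]_n) : int -> 'M[C]_n :=
  fun k => (k + 1)%:~R *: s (k + 1).
Definition laurent_opp (s : int -> 'M[C]_n) : int -> 'M[C]_n :=
  fun k => ((-1) ^ k) *: s k.

(* Holomorphic map from a neighbourhood of 0 in C^N to L g: locally it takes
   its values in the series with a common domain of convergence and a common
   bound on the order of the pole at z = 0, and it is jointly holomorphic in
   its argument and z. *)
Definition loop_plot (N : nat) (X : 'rV[C]_N -> loop) : Prop :=
  exists (T : int) (e : C) (f : 'rV[C]_(N + 1) -> 'rV[C]_n),
    [/\ 0 < e, holo_mx_at f 0 &
        forall (s : 'rV[C]_N) (z : C), `|s| < e -> `|z| < e ->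
          (forall k, k < T -> X s k = 0) /\
          series (fun k : nat => z ^+ k *: X s (T + k%:Z)) @ \oo
            --> f (row_mx s z%:M)].

End Loops.

(* A Lie algebroid structure on a trivial vector bundle with fibre V over an
   open set of C^m: the anchor, and the value at q of the bracket of two
   constant sections; the bracket of arbitrary sections is determined by the
   Leibniz rule. *)
Record trivial_algebroid (R : realType) (m : nat) (V : Type) :=
  TrivialAlgebroid {
  anchor : 'rV[Cplx R]_m -> V -> 'rV[Cplx R]_m;
  const_br : 'rV[Cplx R]_m -> V -> V -> V }.

(* The dual Lie-Poisson bracket {F, G} at (q, mu), where F and G have
   differentials dF and dG there: first components are the partial
   differentials in q, second ones the fibre derivatives. With v = dF.2, F
   agrees to first order at (q, mu) with f + l_v, where f is a function of q
   with differential dF.1 and l_v the linear function of the constant section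
   v; likewise for G = f' + l_w. So
   {F, G} = {l_v, f'} - {l_w, f} + {l_v, l_w}
          = a(v) f' - a(w) f + l_[v, w]. *)
Definition lie_poisson (R : realType) (m : nat) (V M : Type)
    (A : trivial_algebroid R m V) (pr : M -> V -> Cplx R)
    (x : 'rV[Cplx R]_m * M) (dF dG : 'rV[Cplx R]_m * V) : Cplx R :=
  dotp (anchor A x.1 dF.2) dG.1 - dotp (anchor A x.1 dG.2) dF.1
  + pr x.2 (const_br A x.1 dF.2 dG.2).

Section Realization.
Variable R : realType.
Local Notation C := (Cplx R).
Variables (m n : nat) (g : quadratic_lie_algebra R n).
Variable (h : abelian_subalgebra g m).

(* points (q, (p, xi)) of T^*h^* x g^*, and (q, (lam, X)) of Th^* x Lg *)
Definition source : normedModType C :=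
  ('rV[C]_m * ('rV[C]_m * 'rV[C]_n))%type.
Definition target : Type := ('rV[C]_m * ('rV[C]_m * loop R n))%type.

(* Th^* x g; vector fields with constant coefficients commute *)
Definition source_algebroid : trivial_algebroid R m ('rV[C]_m * 'rV[C]_n) := {|
  anchor := fun _ v => v.1;
  const_br := fun _ v w => (0, lbr g v.2 w.2) |}.

Definition source_pair (mu : 'rV[C]_m * 'rV[C]_n) (v : 'rV[C]_m * 'rV[C]_n) :
  C := dotp mu.1 v.1 + dotp mu.2 v.2.

Definition source_diff (F : source -> C) (x : source) :
    'rV[C]_m * ('rV[C]_m * 'rV[C]_n) :=
  (\row_i 'D_((delta_mx 0 i, (0, 0)) : source) F x,
   (\row_i 'D_((0, (delta_mx 0 i, 0)) : source) F x,
    \row_i 'D_((0, (0, delta_mx 0 i)) : source) F x)).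

Definition source_bracket (F G : source -> C) (x : source) : C :=
  lie_poisson source_algebroid source_pair x (source_diff F x)
    (source_diff G x).

Section DynamicalAlgebroid.
(* t q k : Laurent coefficients of the r-matrix, as in [dynamical_rmatrix] *)
Variable t : 'rV[C]_m -> nat -> 'M[C]_n.

Definition rlaurent (q : 'rV[C]_m) (k : int) : 'M[C]_n :=
  match k with
  | Posz k => t q k
  | Negz 0 => casimir g
  | Negz _ => 0
  end.

Definition r_minus_sharp (q : 'rV[C]_m) (xi : 'rV[C]_n) : loop R n :=
  fun k => xi *m (rlaurent q k)^T.

(* The j-th term is <(d/dz)^j r(q, -z), xi_{-(j+1)} (x) 1> / j!, where the
   derivative is evaluated at -z. *)
Definition Rop (q : 'rV[C]_m) (xi : loop R n) : loop R n := fun k =>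
  2^-1 *: sharp g (xi k) +
  \sum_(j \in [set: nat]) (j`!%:R)^-1 *:
    (xi (- (j.+1)%:Z) *m laurent_opp (iter j (@laurent_deriv R n) (rlaurent q)) k).

(* the dual of the inclusion of h as constant series *)
Definition jstar (xi : loop R n) : 'rV[C]_m := xi (-1) *m h^T.

Definition loop_coad (X xi : loop R n) : loop R n := loop_op (coad g) X xi.

(* T^*h^* x Lg^*, with fibre h + Lg^*: the bracket of (v.1, v.2) and (w.1, w.2)
   is the sum of [v.1, w.2] = ad^*_{v.1} w.2, [v.2, w.1] = - ad^*_{w.1} v.2 and
   [v.2, w.2] = d<R v.2, w.2> - ad^*_{R v.2} w.2 + ad^*_{R w.2} v.2. *)
Definition dyn_algebroid : trivial_algebroid R m ('rV[C]_m * loop R n) := {|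
  anchor := fun _ v => jstar v.2;
  const_br := fun q v w =>
    (\row_i dq (fun q' => loop_pair w.2 (Rop q' v.2)) i q,
     fun k => loop_coad (const_loop (v.1 *m h)) w.2 k
              - loop_coad (const_loop (w.1 *m h)) v.2 k
              - loop_coad (Rop q v.2) w.2 k
              + loop_coad (Rop q w.2) v.2 k) |}.

Definition target_pair (mu v : 'rV[C]_m * loop R n) : C :=
  dotp mu.1 v.1 + loop_pair v.2 mu.2.

Definition target_bracket (x : target) (dF dG : 'rV[C]_m * ('rV[C]_m * loop R n)) :
  C := lie_poisson dyn_algebroid target_pair x dF dG.

Definition rho (x : source) : target :=
  (x.1, (- (x.2.2 *m h^T),
         fun k => const_loop (x.2.1 *m h) k + r_minus_sharp x.1 x.2.2 k)).

End DynamicalAlgebroid.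

Definition in_target (U : set 'rV[C]_m) (y : target) : Prop :=
  U y.1 /\ is_loop y.2.2.

Definition target_plot (N : nat) (phi : 'rV[C]_N -> target) : Prop :=
  [/\ holo_mx_at (fun s => (phi s).1) 0,
      holo_mx_at (fun s => (phi s).2.1) 0 &
      loop_plot (fun s => (phi s).2.2)].

(* The differential at y of F is d, with fibre derivative in the restricted
   dual h + L g^* of the fibre: along every holomorphic finite-dimensional
   family through y, F is differentiable with the same differential as the
   linear function d. *)
Definition target_diff (F : target -> C) (y : target)
    (d : 'rV[C]_m * ('rV[C]_m * loop R n)) : Prop :=
  is_loop d.2.2 /\
  forall (N : nat) (phi : 'rV[C]_N -> target), target_plot phi -> phi 0 = y ->
    differentiable (F \o phi : 'rV[C]_N -> C) (0 : 'rV[C]_N) /\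
    forall v, 'D_v (F \o phi : 'rV[C]_N -> C) (0 : 'rV[C]_N) =
      'D_v (fun s => dotp (phi s).1 d.1 + target_pair (phi s).2 d.2 : C)
        (0 : 'rV[C]_N).

(* U is the base. The functions F and G need only be defined near f x. *)
Definition poisson_map (U : set 'rV[C]_m) (t : 'rV[C]_m -> nat -> 'M[C]_n)
    (f : source -> target) : Prop :=
  forall x : source, U x.1 ->
    in_target U (f x) /\
    forall F G dF dG, target_diff F (f x) dF -> target_diff G (f x) dG ->
      [/\ differentiable (F \o f) x, differentiable (G \o f) x &
          source_bracket (F \o f) (G \o f) x =
          target_bracket t (f x) dF dG].

Variable G : lie_group g.

Definition source_act (x : G) (y : source) : source :=
  (y.1, (y.2.1, coAd (x^-1)%g y.2.2)).

Definition target_act (x : G) (y : target) : target :=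
  (y.1, (y.2.1, fun k => Ad x (y.2.2 k))).

Definition equivariant (U : set 'rV[C]_m) (f : source -> target) : Prop :=
  forall x : G, connected_subgroup h x -> forall y : source, U y.1 ->
    f (source_act x y) = target_act x (f y).

End Realization.

(* Main.v *)
From HB Require Import structures.
Require Import Defs.
From mathcomp Require Import all_boot all_order all_algebra.
From mathcomp Require Import complex finmap.
From mathcomp Require Import all_classical all_reals all_analysis.
From mathcomp Require Import zify ring lra.
Set Implicit Arguments.
Unset Strict Implicit.
Unset Printing Implicit Defensive.

Import Order.TTheory GRing.Theory Num.Theory.
Import numFieldNormedType.Exports.

Local Open Scope classical_set_scope.
Local Open Scope ring_scope.

(** Away from the analysis of the first parts, the theorem is an identity between
    Laurent coefficients. Write rc_k(q) for the coefficient of z^k in z r(q, z)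
    ([rcoef]), so that rc_0 is the Casimir element and rc_(k+1) = t_k.

    Coefficients. Near a point of the base, z r(q, z) is the sum of one power
    series in (q, z) ([base_local]); hence the rc_k are holomorphic in q, and
    their derivatives are the Laurent coefficients of z dr/dq ([rcoef_local],
    [rcoef_derive]). Asymptotic expansions at a punctured point can be added,
    multiplied and compared ([asympM], [asymp_uniq]), so zero weight, unitarity
    and the dynamical Yang-Baxter equation turn into identities between the rc_k.
    The Yang-Baxter equation is read at (z_1, z_2, z_3) = (x s, s, 0): a power of
    s is extracted first ([cdybe_coef]); the result is a Laurent polynomial in x
    once an apparent pole at x = 1 has been removed by invariance of the Casimir
    element, and extracting a power of x ([laurent_coef_x]) leaves the family
    of identities [main_identity], indexed by a pair (a, b) of natural numbers.

    Poisson property. In coordinates, rho is itself a holomorphic family of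
    points of the target ([rho_plot]), so the differential of F o rho is that of
    the pull-back of the linear function (a, (u, al)) given by the differential
    of F ([rho_diff_derive]). The loop components of rho have at most a simple
    pole, so only finitely many coefficients al_0, al_(-1), al_(-2), ... matter,
    and both Poisson brackets are finite expressions ([rho_source_diff],
    [bracket_full]). To compare them, sort the terms. Those in u and v agree
    because h is abelian and r has zero weight ([const_pair_const],
    [const_pair_rsharp]). Those in the momentum p cancel by zero weight and
    unitarity ([Rop_skew_pair_const]). Those which are bilinear in al and be are
    the subject of [bracket_core]: the part in al_(-a-1) and be_(-b-1) is exactly
    [main_identity] at (a, b), and the part in al_0 or be_0 is invariance of the
    Casimir element, which gives 1/2 I a different sign on the two halves of
    L g^* ([Rop_neg], [Rop_pos]).

    Equivariance. Since H is generated by exp(h), the basis of h and the rc_k(q)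
    have only to be fixed by Ad along one-parameter subgroups tangent to h. There
    Ad is a one-parameter group of matrices with derivative ad at 0
    ([Ad_mx_derive]), whose infinitesimal action on these tensors vanishes because
    h is abelian and r has zero weight; a telescoping sum then shows that they
    are fixed ([flow_fixed], [mx_flow_fixed]). *)

(** * Unordered sums of complex families *)

Section UnorderedSums.
Variable R : realType.
Local Notation C := (Cplx R).

(** The bound is kept explicit: estimates have to hold uniformly in the point at
    which a series is evaluated. *)
Definition asum (I : choiceType) (c : I -> C) (B : C) : Prop :=
  forall S : {fset I}, \sum_(i <- S) `|c i| <= B.

(** Convergence along the finite subsets, so that regrouping and exchanging the
    order of summation involve no enumeration of the indices. *)
Definition has_sum (I : choiceType) (c : I -> C) (s : C) : Prop :=
  forall e : C, 0 < e -> exists S0 : {fset I}, forall S : {fset I},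
    (S0 `<=` S)%fset -> `|\sum_(i <- S) c i - s| <= e.

Lemma ler_sum_fset (I : choiceType) (w : I -> C) (S T : {fset I}) :
  (forall i, 0 <= w i) -> (S `<=` T)%fset ->
  \sum_(i <- S) w i <= \sum_(i <- T) w i.
Proof.
move=> w0 /fsubsetP ST.
rewrite [leRHS](big_fsetID _ (mem S)) /=.
rewrite (_ : [fset x in T | x \in S]%fset = S); last first.
  by apply/fsetP => i; rewrite !inE; case: (boolP (i \in S)) => [/ST ->|]; rewrite ?andbF.
by rewrite lerDl sumr_ge0.
Qed.

Lemma asum_ge0 (I : choiceType) (c : I -> C) B : asum c B -> 0 <= B.
Proof. by move=> /(_ fset0); rewrite big_seq_fset0. Qed.

Lemma asum_term (I : choiceType) (c : I -> C) B i : asum c B -> `|c i| <= B.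
Proof. by move=> /(_ [fset i]%fset); rewrite big_seq_fset1. Qed.

Lemma le_asum (I : choiceType) (c d : I -> C) B :
  (forall i, `|c i| <= `|d i|) -> asum d B -> asum c B.
Proof. by move=> cd dB S; apply: le_trans (dB S); apply: ler_sum. Qed.

Lemma eps2 (e : C) : 0 < e -> 0 < e / 2 /\ e / 2 + e / 2 = e.
Proof. by move=> e0; rewrite divr_gt0 // -splitr. Qed.

(** The sum is the supremum of the finite partial sums; it is taken in R, as C is
    only partially ordered. *)
Lemma has_sum_ge0_ex (I : choiceType) (w : I -> C) B :
  (forall i, 0 <= w i) -> asum w B -> exists s, has_sum w s.
Proof.
move=> w0 wB.
pose u i : R := complex.Re (w i : R[i]).
have wu i : w i = (u i)%:C%C.
  have := w0 i; rewrite /u; case: (w i) => a b; rewrite lecE /= => /andP[/eqP -> _].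
  by [].
have sE (S : {fset I}) : \sum_(i <- S) w i = (\sum_(i <- S) u i)%:C%C.
  by rewrite rmorph_sum; apply: eq_bigr => i _; exact: wu.
have Bu (S : {fset I}) : \sum_(i <- S) u i <= complex.Re (B : R[i]).
  have := wB S; under eq_bigr do rewrite ger0_norm //.
  by rewrite sE lecE /= => /andP[].
pose E := [set \sum_(i <- S) u i | S in [set: {fset I}]].
have hE : has_sup E.
  split; first by exists (\sum_(i <- (fset0 : {fset I})) u i), fset0.
  by exists (complex.Re (B : R[i])) => _ [S _ <-]; exact: Bu.
exists ((sup E)%:C%C) => e e0.
have [e' [e'0 ->]] : exists e' : R, 0 < e' /\ e = (e'%:C)%C.
  case: e e0 => a b; rewrite ltcE /= => /andP[/eqP -> a0]; by exists a.
have [_ [S0 _ <-] lS0] := sup_adherent e'0 hE.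
exists S0 => S S0S; rewrite sE distrC -rmorphB /=.
have up : \sum_(i <- S) u i <= sup E.
  by apply: sup_upper_bound => //; exists S.
have lo : \sum_(i <- S0) u i <= \sum_(i <- S) u i.
  by rewrite -lecR -!sE; exact: ler_sum_fset.
rewrite ger0_norm ?lecR ?subr_ge0 //.
by rewrite lerBlDr -lerBlDl (le_trans (ltW lS0)).
Qed.

Lemma has_sumD (I : choiceType) (c d : I -> C) s t :
  has_sum c s -> has_sum d t -> has_sum (fun i => c i + d i) (s + t).
Proof.
move=> cs dt e /eps2[e2 <-].
have [S1 h1] := cs _ e2; have [S2 h2] := dt _ e2.
exists (S1 `|` S2)%fset => S; rewrite fsubUset => /andP[/h1 ? /h2 ?].
rewrite big_split /= opprD addrACA (le_trans (ler_normD _ _)) //.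
exact: lerD.
Qed.

Lemma has_sumZ (I : choiceType) (c : I -> C) s a :
  has_sum c s -> has_sum (fun i => a * c i) (a * s).
Proof.
move=> cs e e0.
have a0 : 0 < `|a| + 1 by rewrite ltr_wpDl.
have [S0 h0] := cs (e / (`|a| + 1)) (divr_gt0 e0 a0).
exists S0 => S /h0 h; rewrite -mulr_sumr -mulrBr normrM.
apply: (@le_trans _ _ ((`|a| + 1) * (e / (`|a| + 1)))).
  by apply: ler_pM => //; rewrite lerDl.
by rewrite mulrC divfK // gt_eqF.
Qed.

Lemma has_sumB (I : choiceType) (c d : I -> C) s t :
  has_sum c s -> has_sum d t -> has_sum (fun i => c i - d i) (s - t).
Proof.
move=> cs /(has_sumZ (-1)); rewrite mulN1r => dt.
have := has_sumD cs dt; congr has_sum.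
by apply/funext => i; rewrite mulN1r.
Qed.

(** The real part f of the family is the difference of the non-negative families
    |f| + f and |f|, and likewise for the imaginary part. *)
Lemma has_sum_ex (I : choiceType) (c : I -> C) B :
  asum c B -> exists s, has_sum c s.
Proof.
move=> cB.
have part (f : C -> C) : (forall x, `|f x| <= `|x|) -> (forall x, f x \is Num.real) ->
    exists s, has_sum (fun i => f (c i)) s.
  move=> fle freal.
  have fB : asum (fun i => f (c i)) B by apply: le_asum cB.
  have [s1 h1] : exists s, has_sum (fun i => `|f (c i)| + f (c i)) s.
    apply: (@has_sum_ge0_ex _ _ (B + B)) => [i|S].
      by rewrite -lerBlDr sub0r -normrN; apply: real_ler_norm; rewrite realN.
    apply: le_trans (lerD (fB S) (fB S)); rewrite -big_split /=.
    by apply: ler_sum => i _; rewrite (le_trans (ler_normD _ _)) // normr_id.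
  have [s2 h2] : exists s, has_sum (fun i => `|f (c i)|) s.
    apply: (@has_sum_ge0_ex _ _ B) => // S.
    by under eq_bigr do rewrite normr_id; exact: fB.
  exists (s1 - s2); have := has_sumB h1 h2; congr has_sum.
  by apply/funext => i; rewrite addrC addKr.
have [|s1 h1] := part (fun x => 'Re x) _ (@Creal_Re _).
  by move=> x; rewrite -ler_sqr ?nnegrE // (normC2_Re_Im x) [leLHS]real_normK ?Creal_Re // lerDl real_exprn_even_ge0 ?Creal_Im.
have [|s2 h2] := part (fun x => 'Im x) _ (@Creal_Im _).
  by move=> x; rewrite -ler_sqr ?nnegrE // (normC2_Re_Im x) [leLHS]real_normK ?Creal_Im // lerDr real_exprn_even_ge0 ?Creal_Re.
exists (s1 + 'i * s2); have := has_sumD h1 (has_sumZ 'i h2); congr has_sum.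
by apply/funext => i; rewrite -Crect.
Qed.

Lemma has_sum_le (I : choiceType) (c : I -> C) s B :
  has_sum c s -> asum c B -> `|s| <= B.
Proof.
move=> cs cB; apply/ler_addgt0Pr => e e0; have [S0 h] := cs _ e0.
have {}h := h S0 (fsubset_refl _).
rewrite -[s](subKr (\sum_(i <- S0) c i)) (le_trans (ler_normB _ _)) // lerD //.
by rewrite (le_trans (ler_norm_sum _ _ _)).
Qed.

Lemma eq_has_sum (I : choiceType) (c d : I -> C) s :
  c =1 d -> has_sum c s -> has_sum d s.
Proof. by move=> /funext ->. Qed.

Lemma has_sum_unique (I : choiceType) (c : I -> C) s t :
  has_sum c s -> has_sum c t -> s = t.
Proof.
move=> cs ct; apply/eqP; rewrite -subr_eq0 -normr_eq0 eq_le normr_ge0 andbT.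
apply: (@has_sum_le I (fun i => c i - c i)); first exact: has_sumB.
by move=> S; rewrite big1 // => i _; rewrite subrr normr0.
Qed.

Lemma has_sum_fin (I : choiceType) (c : I -> C) (S : {fset I}) :
  (forall i, i \notin S -> c i = 0) -> has_sum c (\sum_(i <- S) c i).
Proof.
move=> c0 e e0; exists S => T ST.
rewrite -(big_fset_incl _ ST) ?subrr ?normr0 ?ltW // => i _; exact: c0.
Qed.

Lemma has_sum_big (I : choiceType) J (r : seq J) (c : J -> I -> C) (s : J -> C) :
  (forall j, has_sum (c j) (s j)) ->
  has_sum (fun i => \sum_(j <- r) c j i) (\sum_(j <- r) s j).
Proof.
move=> cs; elim: r => [|j r IH].
  rewrite big_nil; have := @has_sum_fin I (fun=> 0) fset0 (fun _ _ => erefl).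
  by rewrite big_seq_fset0; apply: eq_has_sum => i; rewrite big_nil.
rewrite big_cons; apply: eq_has_sum (has_sumD (cs j) IH) => i.
by rewrite big_cons.
Qed.

(** All but finitely many terms are jointly negligible, which is what makes
    regrouping legitimate. *)
Lemma asum_tail (I : choiceType) (c : I -> C) B e : asum c B -> 0 < e ->
  exists S0 : {fset I}, asum (fun i => if i \in S0 then 0 else c i) e.
Proof.
move=> cB /eps2[e2 <-].
have [|s cs] := @has_sum_ge0_ex I (fun i => `|c i|) B (fun i => normr_ge0 _).
  by move=> S; under eq_bigr do rewrite normr_id; exact: cB.
have [S0 h0] := cs _ e2; exists S0 => S.
have E : \sum_(i <- S) `|if i \in S0 then 0 else c i| =
    \sum_(i <- (S0 `|` S)%fset) `|c i| - \sum_(i <- S0) `|c i|.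
  apply/eqP; rewrite eq_sym subr_eq; apply/eqP.
  rewrite [LHS](big_fsetID _ (mem S0)) /= addrC; congr (_ + _).
    rewrite [RHS](big_fsetID _ (mem S0)) /= [X in _ = X + _]big1_seq ?add0r.
      rewrite (_ : [fset x in (S0 `|` S)%fset | x \notin S0]%fset =
        [fset x in S | x \notin S0]%fset); last first.
        by apply/fsetP => i; rewrite !inE; case: (i \in S0); rewrite ?andbF ?andbT ?orbT /=.
      by apply: eq_big_seq => i; rewrite !inE /= => /andP[_ /negbTE ->].
    by move=> i; rewrite !inE /= => /andP[_ ->]; rewrite normr0.
  by congr (\sum_(i <- enum_fset _) _); apply/fsetP => i; rewrite !inE; case: (i \in S0); rewrite ?andbF.
rewrite -[leLHS]ger0_norm ?sumr_ge0 // E -[X in X - _](subrK s) -addrA.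
rewrite -[X in _ + X]opprB (le_trans (ler_normB _ _)) // lerD ?h0 ?fsubset_refl //.
exact: fsubsetUl.
Qed.

(** Summation by fibres: finitely many fibres that contain the large terms miss
    at most a negligible tail. *)
Lemma has_sum_fibre (I J : choiceType) (pi : I -> J) (c : I -> C) (d : J -> C) s B :
  asum c B -> has_sum c s ->
  (forall j, has_sum (fun i => if pi i == j then c i else 0) (d j)) ->
  has_sum d s.
Proof.
move=> cB cs cd e e0.
have [S0 tS0] := asum_tail cB e0.
exists [fset pi i | i in S0]%fset => K piK.
have hK := has_sum_big (enum_fset K) cd.
rewrite distrC; apply: has_sum_le (has_sumB cs hK) _.
apply: le_asum tS0 => i.
have -> : \sum_(j <- K) (if pi i == j then c i else 0) = if pi i \in K then c i else 0.
  case: ifPn => iK.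
    rewrite (big_fsetD1 (pi i)) //= eqxx big1_seq ?addr0 // => j.
    by rewrite !inE eq_sym => /andP[_ /andP[/negbTE -> _]].
  by rewrite big1_seq // => j /andP[_ jK]; case: eqP => // E; rewrite E jK in iK.
case: ifPn => [_|iK]; first by rewrite subrr normr0.
rewrite subr0; case: ifPn => // iS0; case/negP: iK; apply: (fsubsetP piK).
by apply/imfsetP; exists i.
Qed.

(** Each fibre sum is multiplied by a phase that makes it non-negative; the sum of
    the results is again a sum of the original family, up to factors of modulus
    at most 1. *)
Lemma asum_fibre (I J : choiceType) (pi : I -> J) (c : I -> C) (d : J -> C) B :
  asum c B ->
  (forall j, has_sum (fun i => if pi i == j then c i else 0) (d j)) ->
  asum d B.
Proof.
move=> cB cd K.
pose u j : C := if d j == 0 then 0 else `|d j| / d j.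
have u1 j : `|u j| <= 1.
  rewrite /u; case: eqP => [|/eqP dj]; first by rewrite normr0 ler01.
  by rewrite normrM normr_id normfV divff // normr_eq0.
have ud j : u j * d j = `|d j|.
  by rewrite /u; case: eqP => [->|/eqP dj]; rewrite ?mul0r ?normr0 // divfK.
have h := has_sum_big (enum_fset K) (fun j => has_sumZ (u j) (cd j)).
rewrite -[leLHS]ger0_norm ?sumr_ge0 //.
under eq_bigr do rewrite -ud.
apply: has_sum_le h _; apply: le_asum cB => i.
case: (boolP (pi i \in K)) => iK.
  rewrite (big_fsetD1 (pi i)) //= eqxx big1_seq ?addr0.
    by rewrite normrM ler_piMl.
  move=> j; rewrite !inE eq_sym => /andP[_ /andP[/negbTE -> _]].
  by rewrite mulr0.
rewrite big1_seq ?normr0 // => j /andP[_ jK].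
by case: eqP => [E|]; rewrite ?mulr0 //; rewrite E jK in iK.
Qed.

Lemma has_sum_inj (I J : choiceType) (f : I -> J) (c : J -> C) s B :
  injective f -> (forall j, (forall i, f i != j) -> c j = 0) ->
  asum (fun i => c (f i)) B ->
  has_sum (fun i => c (f i)) s -> has_sum c s.
Proof.
move=> finj c0 cB cs; apply: (has_sum_fibre (pi := f) cB cs) => j.
have [[i fi]|nj] := pselect (exists i, f i = j).
  have -> : c j = \sum_(k <- [fset i]%fset) (if f k == j then c (f k) else 0).
    by rewrite big_seq_fset1 fi eqxx.
  apply: has_sum_fin => k; rewrite inE => ki; case: eqP => // fk.
  by rewrite -fi in fk; rewrite (finj _ _ fk) eqxx in ki.
rewrite c0; last by move=> i; apply/eqP => fi; apply: nj; exists i.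
have := @has_sum_fin I (fun i => if f i == j then c (f i) else 0) fset0.
rewrite big_seq_fset0; apply => i _; case: eqP => // fi.
by case: nj; exists i.
Qed.

Lemma asum_inj (I J : choiceType) (f : I -> J) (c : J -> C) B :
  injective f -> asum c B -> asum (fun i => c (f i)) B.
Proof.
move=> finj cB S; have := cB [fset f i | i in S]%fset.
by rewrite big_imfset //= => ? ? _ _; exact: finj.
Qed.

Lemma asum_pair (I J : choiceType) (c : I * J -> C) (b : I -> C) B :
  (forall i, asum (fun j => c (i, j)) (b i)) ->
  (forall S : {fset I}, \sum_(i <- S) b i <= B) -> asum c B.
Proof.
move=> cb bB S.
pose S1 := [fset p.1 | p in S]%fset; pose S2 := [fset p.2 | p in S]%fset.
apply: (@le_trans _ _ (\sum_(i <- S1) \sum_(j <- S2) `|c (i, j)|)); last first.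
  by apply: le_trans (bB S1); apply: ler_sum => i _; exact: cb.
have -> : \sum_(i <- S1) \sum_(j <- S2) `|c (i, j)| =
    \sum_(p <- [fset ((i, j) : I * J) | i in S1, j in S2]%fset) `|c p|.
  by rewrite big_imfset2 //= => -[? ?] [? ?] _ _ /= [-> ->].
apply: ler_sum_fset => //; apply/fsubsetP => -[i j] ij.
apply/imfset2P; exists i; first by apply/imfsetP; exists (i, j).
by exists j => //; apply/imfsetP; exists (i, j).
Qed.

Lemma has_sum_pair (I J : choiceType) (c : I * J -> C) (d : I -> C) s B :
  asum c B -> has_sum c s -> (forall i, has_sum (fun j => c (i, j)) (d i)) ->
  has_sum d s.
Proof.
move=> cB cs cd; apply: (has_sum_fibre (pi := fst) cB cs) => i.
have pinj : injective (fun j : J => (i, j)) by move=> ? ? [].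
apply: (has_sum_inj pinj (B := B)) => [[k j] /= kj||].
- by case: eqP => // ki; have := kj j; rewrite ki eqxx.
- by apply: le_asum (asum_inj pinj cB) => j /=; rewrite eqxx.
- by apply: eq_has_sum (cd i) => j /=; rewrite eqxx.
Qed.

Lemma asum_mul (I J : choiceType) (a : I -> C) (b : J -> C) A B :
  asum a A -> asum b B -> asum (fun p : I * J => a p.1 * b p.2) (A * B).
Proof.
move=> aA bB; have B0 := asum_ge0 bB.
apply: (@asum_pair _ _ _ (fun i => `|a i| * B)) => [i S|S] /=.
  under eq_bigr do rewrite normrM.
  by rewrite -mulr_sumr ler_wpM2l.
by rewrite -mulr_suml ler_wpM2r.
Qed.

Lemma has_sum_mul (I J : choiceType) (a : I -> C) (b : J -> C) A B s t :
  asum a A -> asum b B -> has_sum a s -> has_sum b t ->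
  has_sum (fun p : I * J => a p.1 * b p.2) (s * t).
Proof.
move=> aA bB sa sb; have ab := asum_mul aA bB.
have [u hu] := has_sum_ex ab.
suff -> : s * t = u by [].
apply: has_sum_unique (has_sum_pair ab hu _).
  by rewrite mulrC; apply: eq_has_sum (has_sumZ t sa) => i; exact: mulrC.
by move=> i /=; rewrite -[X in has_sum _ X]mulrC mulrC; exact: has_sumZ.
Qed.

(** For monomials chi that have been identified along [pi]. The regrouped
    coefficients [d] are found before [chi]: they serve at all points of a
    polydisc at once. *)
Lemma has_sum_group (I J : choiceType) (pi : I -> J) (c : I -> C) (E : J -> C) B :
  (forall j, 0 < E j) -> asum (fun i => c i * E (pi i)) B ->
  exists d : J -> C, [/\ asum (fun j => d j * E j) B,
    forall j, has_sum (fun i => if pi i == j then c i else 0) (d j) &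
    forall (chi : J -> C), (forall j, `|chi j| <= E j) ->
      forall s, has_sum (fun i => c i * chi (pi i)) s ->
                has_sum (fun j => d j * chi j) s].
Proof.
move=> E0 cB.
have hd j : exists s, has_sum (fun i => if pi i == j then c i else 0) s.
  have [|s hs] := @has_sum_ex _ (fun i => if pi i == j then c i * E (pi i) else 0) B.
    by apply: le_asum cB => i; case: ifP => // _; rewrite normr0.
  exists ((E j)^-1 * s); apply: eq_has_sum (has_sumZ _ hs) => i.
  by case: eqP => [->|_]; rewrite ?mulr0 // mulrC mulfK // gt_eqF.
have [d dP] := choice hd.
have fib (chi : J -> C) j :
    has_sum (fun i => if pi i == j then c i * chi (pi i) else 0) (d j * chi j).
  rewrite mulrC; apply: eq_has_sum (has_sumZ (chi j) (dP j)) => i.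
  by case: eqP => [->|_]; rewrite ?mulr0 // mulrC.
exists d; split => // [|chi chiE s hs].
  exact: asum_fibre cB (fib E).
apply: has_sum_fibre hs (fib chi).
apply: le_asum cB => i; rewrite !normrM ler_wpM2l //.
by rewrite [leRHS]ger0_norm // ltW.
Qed.

Lemma has_sum_series (c : nat -> C) s :
  has_sum c s -> series c @ \oo --> s.
Proof.
move=> cs; apply/cvgrPdist_le => e e0.
have [S0 h] := cs _ e0.
exists (\max_(i <- S0) i.+1)%N => // k /= Sk.
rewrite distrC; have := h [fset i in iota 0 k]%fset.
have -> : \sum_(i <- [fset i in iota 0 k]%fset) c i = series c k.
  rewrite /series /= /index_iota subn0; apply: perm_big.
  by apply: uniq_perm; rewrite ?iota_uniq ?fset_uniq // => i; rewrite !inE.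
apply; apply/fsubsetP => i iS0; rewrite !inE mem_iota add0n /=.
by apply: leq_trans Sk; rewrite (big_fsetD1 i) //= leq_maxl.
Qed.
End UnorderedSums.

(** * Power series *)

Section PowerSeries.
Variable R : realType.
Local Notation C := (Cplx R).
Local Notation T N := {ffun 'I_N -> nat}.

Definition mon (N : nat) (v : 'I_N -> C) (al : T N) : C := \prod_i v i ^+ al i.

Lemma mon_norm (N : nat) (v : 'I_N -> C) al : `|mon v al| = mon (fun i => `|v i|) al.
Proof. by rewrite normr_prod; apply: eq_bigr => i _; rewrite normrX. Qed.

Lemma le_mon (N : nat) (v w : 'I_N -> C) al : (forall i, `|v i| <= w i) -> `|mon v al| <= mon w al.
Proof.
move=> vw; rewrite mon_norm; apply: ler_prod => i _.
by rewrite exprn_ge0 //= lerXn2r ?nnegrE // (le_trans _ (vw i)).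
Qed.

Lemma mon_gt0 (N : nat) (e : C) (al : T N) : 0 < e -> 0 < mon (fun=> e) al.
Proof. by move=> e0; apply: prodr_gt0 => i _; rewrite exprn_gt0. Qed.

Lemma mon_cst_norm (N : nat) (e : C) (al : T N) : 0 < e -> `|mon (fun=> e) al| = mon (fun=> e) al.
Proof. by move=> e0; rewrite ger0_norm // ltW // mon_gt0. Qed.

Lemma monM (N : nat) (v w : 'I_N -> C) al : mon (fun i => v i * w i) al = mon v al * mon w al.
Proof. by rewrite -big_split; apply: eq_bigr => i _; rewrite exprMn. Qed.

Definition unit_idx (N : nat) (i : 'I_N) : T N := [ffun j => (j == i) : nat].
Definition zero_idx (N : nat) : T N := [ffun=> 0%N].
Definition deg (N : nat) (al : T N) : nat := (\sum_i al i)%N.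

Lemma mon_cst (N : nat) (c : C) (al : T N) : mon (fun=> c) al = c ^+ deg al.
Proof. by rewrite /mon prodrXr. Qed.

Lemma mon_zero (N : nat) (v : 'I_N -> C) : mon v (zero_idx N) = 1.
Proof. by rewrite /mon big1 // => i _; rewrite ffunE. Qed.

Lemma mon_unit (N : nat) (v : 'I_N -> C) i : mon v (unit_idx i) = v i.
Proof.
rewrite /mon (bigD1 i) //= ffunE eqxx expr1 big1 ?mulr1 //.
by move=> j /negbTE ji; rewrite ffunE ji.
Qed.

Definition cubev (N d : nat) (f : {ffun 'I_N -> 'I_d}) : T N := [ffun i => nat_of_ord (f i)].

Lemma cubev_inj (N d : nat) : injective (@cubev N d).
Proof.
move=> f g /ffunP fg; apply/ffunP => i; apply/val_inj.
by have := fg i; rewrite !ffunE.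
Qed.

Definition cube (N d : nat) : {fset T N} := [fset cubev f | f in {: {ffun 'I_N -> 'I_d}}]%fset.

Lemma sum_cube (N d : nat) (V : nmodType) (c : T N -> V) :
  \sum_(al <- cube N d) c al = \sum_(f : {ffun 'I_N -> 'I_d}) c (cubev f).
Proof.
rewrite big_imfset /=; last by move=> ? ? _ _; exact: cubev_inj.
by rewrite big_enum.
Qed.

Lemma in_cube (N d : nat) (al : T N) : (al \in cube N d) = [forall i, al i < d]%N.
Proof.
apply/idP/forallP => [/imfsetP[f _ ->] i|ald]; first by rewrite ffunE.
apply/imfsetP; exists [ffun i => Ordinal (ald i)] => //.
by apply/ffunP => i; rewrite !ffunE.
Qed.

(** Cubes are cofinal among the finite sets of multi-indices, so summation over
    cubes, as in [holo_at], computes unordered sums. *)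
Lemma sub_cube (N : nat) (S : {fset T N}) :
  exists d0, forall d, (d0 <= d)%N -> (S `<=` cube N d)%fset.
Proof.
exists (\max_(al <- S) \max_i (al i).+1)%N => d Sd.
apply/fsubsetP => al alS; rewrite in_cube; apply/forallP => i.
apply: leq_trans Sd; rewrite (big_fsetD1 al) //=.
by apply: leq_trans (leq_maxl _ _); exact: (leq_bigmax i).
Qed.

Lemma has_sum_cube (N : nat) (c : T N -> C) s : has_sum c s ->
  (fun d => \sum_(f : {ffun 'I_N -> 'I_d}) c (cubev f)) @ \oo --> s.
Proof.
move=> cs; apply/cvgrPdist_le => e e0; have [S0 h] := cs _ e0.
have [d0 hd] := sub_cube S0.
by exists d0 => // d /= dd; rewrite distrC -sum_cube; apply: h; exact: hd.
Qed.

Lemma half_geom (d : nat) : \sum_(k < d) 2^-1 ^+ k <= 2 :> C.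
Proof.
have : (1 - 2^-1 : C) * \sum_(k < d) 2^-1 ^+ k <= 1.
  by rewrite -opprB mulNr -subrX1 opprB gerBl exprn_ge0 ?invr_ge0.
rewrite {1}(_ : 1 - 2^-1 = 2^-1 :> C); first by rewrite ler_pdivrMl ?mulr1.
by rewrite {1}(splitr 1) mul1r addrK.
Qed.

Lemma asum_geom (N : nat) : asum (fun al : T N => mon (fun=> 2^-1) al) (2 ^+ N).
Proof.
move=> S; have [d0 /(_ d0 (leqnn _)) hd] := sub_cube S.
apply: le_trans (ler_sum_fset _ hd) _ => //.
rewrite sum_cube; under eq_bigr do rewrite ger0_norm ?ltW ?mon_gt0 ?invr_gt0 //.
rewrite /mon; under eq_bigr do under eq_bigr do rewrite ffunE.
rewrite -(bigA_distr_bigA (fun (i : 'I_N) (k : 'I_d0) => 2^-1 ^+ k : C)) /=.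
rewrite prodr_const card_ord.
have s0 : 0 <= \sum_(k < d0) 2^-1 ^+ k :> C.
  by apply: sumr_ge0 => k _; rewrite exprn_ge0 ?invr_ge0.
by rewrite lerXn2r ?nnegrE // half_geom.
Qed.

(** The effective form of [holo_at]: on a closed polydisc, and with a bound for the
    sum of the norms of the terms there. *)
Definition pws (N : nat) (a : T N -> C) (F : 'rV[C]_N -> C) (p : 'rV[C]_N) (e B : C) :=
  [/\ 0 < e, asum (fun al => a al * mon (fun=> e) al) B &
    forall v : 'rV[C]_N, (forall i, `|v 0 i| <= e) ->
      has_sum (fun al => a al * mon (v 0) al) (F (p + v))].

Lemma pws_asum (N : nat) (a : T N -> C) F p e B (w : 'I_N -> C) : pws a F p e B ->
  (forall i, `|w i| <= e) -> asum (fun al => a al * mon w al) B.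
Proof.
move=> [e0 aB _] we; apply: le_asum aB => al.
by rewrite !normrM ler_wpM2l // [leRHS]mon_cst_norm // le_mon.
Qed.

(** On the polydisc of half the radius the Cauchy bounds are dominated by a
    geometric series. *)
Lemma holo_pws (N : nat) (F : 'rV[C]_N -> C) p :
  holo_at F p -> exists a e B, pws a F p e B.
Proof.
move=> [a [e [M [e0 aM cF]]]].
have e2 : 0 < e / 2 by rewrite divr_gt0.
have aB : asum (fun al => a al * mon (fun=> e / 2) al) (M * 2 ^+ N).
  have M0 : 0 <= M.
    by apply: le_trans (aM [ffun=> 0%N]); rewrite mulr_ge0 // ltW // mon_gt0.
  have mgeom : asum (fun al : T N => M * mon (fun=> 2^-1) al) (M * 2 ^+ N).
    move=> S; under eq_bigr do rewrite normrM ger0_norm //.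
    by rewrite -mulr_sumr ler_wpM2l // asum_geom.
  apply: le_asum mgeom => al.
  rewrite (monM (fun=> e) (fun=> 2^-1)) mulrA !normrM ler_wpM2r //.
  by rewrite [leRHS]ger0_norm // [X in _ * X]mon_cst_norm //; exact: aM.
exists a, (e / 2), (M * 2 ^+ N); split => // v ve.
have [s hs] : exists s, has_sum (fun al => a al * mon (v 0) al) s.
  apply: (@has_sum_ex _ _ _ (M * 2 ^+ N)); apply: le_asum aB => al.
  by rewrite !normrM ler_wpM2l // [leRHS]mon_cst_norm // le_mon.
suff -> : F (p + v) = s by [].
have cs := has_sum_cube hs.
have cf : (fun d => \sum_(f : {ffun 'I_N -> 'I_d})
    a (cubev f) * mon (v 0) (cubev f)) @ \oo --> F (p + v).
  have := cF v; under [X in X @ _ --> _]funext do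
    under eq_bigr do under eq_bigr do rewrite -[nat_of_ord _](ffunE (fun i => nat_of_ord (_ i))).
  apply => i; apply: le_lt_trans (ve i) _.
  by rewrite ltr_pdivrMr // ltr_pMr // ltr1n.
exact: (norm_cvg_unique cf cs).
Qed.

Lemma pws_holo (N : nat) (a : T N -> C) (F : 'rV[C]_N -> C) p e B :
  pws a F p e B -> holo_at F p.
Proof.
move=> [e0 aB aF]; exists a, e, B; split => // [al|v ve].
  have := asum_term al aB; rewrite normrM [X in _ * X]mon_cst_norm //.
have := has_sum_cube (aF v (fun i => ltW (ve i))).
apply: cvg_trans; apply: near_eq_cvg; apply: nearW => d.
apply: eq_bigr => f _; congr (_ * _); apply: eq_bigr => i _; by rewrite ffunE.
Qed.
End PowerSeries.

(** * Closure properties of holomorphic functions *)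

Section HoloClosure.
Variable R : realType.
Local Notation C := (Cplx R).
Local Notation T N := {ffun 'I_N -> nat}.

Lemma pos_min (e1 e2 : C) : 0 < e1 -> 0 < e2 -> exists e : C, [/\ 0 < e, e <= e1 & e <= e2].
Proof.
move=> e10 e20; have [h|h] := real_leP (gtr0_real e10) (gtr0_real e20).
  by exists e1.
by exists e2; rewrite ltW.
Qed.

Lemma pws_shrink (N : nat) (a : T N -> C) F p e B e' :
  pws a F p e B -> 0 < e' -> e' <= e -> pws a F p e' B.
Proof.
move=> aF e'0 e'e; split => //.
  by apply: pws_asum aF _ => _; rewrite gtr0_norm.
by move=> v ve; case: aF => _ _; apply => i; exact: le_trans e'e.
Qed.

(** Every closure property below is an instance: the value of the new function is
    visibly a sum of multiples of monomials over some index set, and only has to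
    be collected by exponents. *)
Lemma pws_group (N : nat) (I : choiceType) (pi : I -> T N) (c : I -> C)
    (F : 'rV[C]_N -> C) p e B :
  0 < e -> asum (fun i => c i * mon (fun=> e) (pi i)) B ->
  (forall v : 'rV[C]_N, (forall i, `|v 0 i| <= e) ->
     has_sum (fun i => c i * mon (v 0) (pi i)) (F (p + v))) ->
  exists a, pws a F p e B /\
    forall al, has_sum (fun i => if pi i == al then c i else 0) (a al).
Proof.
move=> e0 cB cF.
have [a [aB afib aF]] := has_sum_group (fun al => mon_gt0 al e0) cB.
exists a; split=> //; split => // v ve.
by apply: aF (cF v ve) => al; exact: le_mon.
Qed.

Lemma has_sum_unit (c : unit -> C) : has_sum c (c tt).
Proof.
have := @has_sum_fin R unit c [fset tt]%fset.
by rewrite big_seq_fset1; apply => -[]; rewrite inE.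
Qed.

Lemma asum_unit (c : unit -> C) : asum c `|c tt|.
Proof.
move=> S; have -> : `|c tt| = \sum_(i <- [fset tt]%fset) `|c i| by rewrite big_seq_fset1.
by apply: ler_sum_fset => //; apply/fsubsetP => -[] _; rewrite inE.
Qed.

Lemma holo_cst (N : nat) (k : C) (p : 'rV[C]_N) : holo_at (fun=> k) p.
Proof.
have [||v _|a [h _]] := @pws_group N unit (fun=> zero_idx N) (fun=> k) (fun=> k) p 1 `|k|.
- exact: ltr01.
- by have := asum_unit (fun=> k); congr asum; apply/funext => i; rewrite mon_zero mulr1.
- by have := has_sum_unit (fun=> k); apply: eq_has_sum => i; rewrite mon_zero mulr1.
- exact: pws_holo h.
Qed.

Lemma holoD (N : nat) (F G : 'rV[C]_N -> C) p :
  holo_at F p -> holo_at G p -> holo_at (fun x => F x + G x) p.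
Proof.
move=> /holo_pws[a [e1 [B1 h1]]] /holo_pws[b [e2 [B2 h2]]].
have [e [e0 ee1 ee2]] : exists e : C, [/\ 0 < e, e <= e1 & e <= e2].
  by case: h1 h2 => e10 _ _ [e20 _ _]; exact: pos_min.
have [_ aB aF] := pws_shrink h1 e0 ee1; have [_ bB bF] := pws_shrink h2 e0 ee2.
apply: (@pws_holo _ _ (fun al => a al + b al) _ _ e (B1 + B2)); split => // [S|v ve].
  apply: le_trans (lerD (aB S) (bB S)); rewrite -big_split; apply: ler_sum => i _.
  by rewrite mulrDl; exact: ler_normD.
by apply: eq_has_sum (has_sumD (aF v ve) (bF v ve)) => al; rewrite mulrDl.
Qed.

Lemma mon_add (N : nat) (v : 'I_N -> C) (al be : T N) :
  mon v [ffun i => (al i + be i)%N] = mon v al * mon v be.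
Proof. by rewrite -big_split; apply: eq_bigr => i _; rewrite ffunE exprD. Qed.

Lemma holoM (N : nat) (F G : 'rV[C]_N -> C) p :
  holo_at F p -> holo_at G p -> holo_at (fun x => F x * G x) p.
Proof.
move=> /holo_pws[a [e1 [B1 h1]]] /holo_pws[b [e2 [B2 h2]]].
have [e [e0 ee1 ee2]] : exists e : C, [/\ 0 < e, e <= e1 & e <= e2].
  by case: h1 h2 => e10 _ _ [e20 _ _]; exact: pos_min.
have {h1} h1 := pws_shrink h1 e0 ee1; have {h2} h2 := pws_shrink h2 e0 ee2.
have [|v ve|d [h _]] := @pws_group N _ (fun p : T N * T N => [ffun i => (p.1 i + p.2 i)%N])
  (fun p => a p.1 * b p.2) (fun x => F x * G x) p e (B1 * B2) e0.
- case: h1 h2 => _ aB _ [_ bB _]; apply: le_asum (asum_mul aB bB) => -[al be] /=.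
  by rewrite mon_add mulrACA.
- have aB := pws_asum h1 ve; have bB := pws_asum h2 ve.
  case: h1 h2 => _ _ aF [_ _ bF].
  apply: eq_has_sum (has_sum_mul aB bB (aF v ve) (bF v ve)) => -[al be] /=.
  by rewrite mon_add mulrACA.
- exact: pws_holo h.
Qed.

(** A substitution of variables for variables, possibly with repetitions, maps
    monomials to monomials. *)
Lemma holo_sel (N N' : nat) (sg : 'I_N -> 'I_N') (F : 'rV[C]_N -> C) (p : 'rV[C]_N') :
  holo_at F (\row_i p 0 (sg i)) -> holo_at (fun x => F (\row_i x 0 (sg i))) p.
Proof.
move=> /holo_pws[a [e [B h]]]; have [e0 aB aF] := h.
pose pi (al : T N) : T N' := [ffun j => \sum_(i | sg i == j) al i]%N.
have mpi (v : 'I_N' -> C) al : mon v (pi al) = mon (fun i => v (sg i)) al.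
  rewrite /mon [RHS](partition_big sg xpredT) //=; apply: eq_bigr => j _.
  by rewrite ffunE -prodrXr; apply: eq_bigr => i /eqP ->.
have [|v ve|d [hd _]] := @pws_group N' _ pi a (fun x => F (\row_i x 0 (sg i))) p e B e0.
- by apply: le_asum aB => al; rewrite mpi.
- have -> : \row_i (p + v) 0 (sg i) = \row_i p 0 (sg i) + \row_i v 0 (sg i).
    by apply/rowP => i; rewrite !mxE.
  apply: eq_has_sum (aF (\row_i v 0 (sg i)) _) => [al|i]; last by rewrite mxE.
  by rewrite mpi; congr (_ * _); apply: eq_bigr => i _; rewrite mxE.
- exact: pws_holo hd.
Qed.

Lemma holo_coord (N : nat) (i : 'I_N) (p : 'rV[C]_N) : holo_at (fun x => x 0 i) p.
Proof.
have h : holo_at (fun x : 'rV[C]_N => p 0 i + (x 0 i - p 0 i)) p.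
  apply: holoD; first exact: holo_cst.
  have [|v ve|d [h _]] := @pws_group N unit (fun=> unit_idx i) (fun=> 1)
    (fun x => x 0 i - p 0 i) p 1 1 ltr01.
  - move=> S; apply: le_trans (asum_unit _ S) _; by rewrite mul1r mon_unit normr1.
  - have -> : (p + v) 0 i - p 0 i = 1 * mon (v 0) (unit_idx i).
      by rewrite mul1r mxE addrC addKr mon_unit.
    exact: has_sum_unit.
  - exact: pws_holo h.
by congr holo_at: h; apply/funext => x; rewrite addrC subrK.
Qed.

Lemma holo_sum (N : nat) J (r : seq J) (F : J -> 'rV[C]_N -> C) p :
  (forall j, holo_at (F j) p) -> holo_at (fun x => \sum_(j <- r) F j x) p.
Proof.
move=> hF; elim: r => [|j r IH].
  by congr holo_at: (holo_cst 0 p); apply/funext => x; rewrite big_nil.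
by congr holo_at: (holoD (hF j) IH); apply/funext => x; rewrite big_cons.
Qed.

(** The coefficient of y^be in (x + y)^al. *)
Definition bin_coef (N : nat) (x : 'I_N -> C) (al be : T N) : C :=
  \prod_i ('C(al i, be i)%:R * x i ^+ (al i - be i)).

Lemma bin_coef_cube (N d : nat) (x y : 'I_N -> C) (al : T N) : (forall i, al i < d)%N ->
  \sum_(be <- cube N d) bin_coef x al be * mon y be = mon (fun i => x i + y i) al.
Proof.
move=> ald; rewrite sum_cube.
transitivity (\sum_(f : {ffun 'I_N -> 'I_d})
    \prod_i ('C(al i, f i)%:R * x i ^+ (al i - f i) * y i ^+ f i)).
  by apply: eq_bigr => f _; rewrite -big_split; apply: eq_bigr => i _; rewrite ffunE.
rewrite -(bigA_distr_bigA (fun i (k : 'I_d) => 'C(al i, k)%:R * x i ^+ (al i - k) * y i ^+ k)).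
apply: eq_bigr => i _; rewrite exprDn.
rewrite (big_ord_widen d (fun k => (x i ^+ (al i - k) * y i ^+ k) *+ 'C(al i, k))) //.
rewrite [RHS]big_mkcond; apply: eq_bigr => k _; case: ltnP => [_|ki].
  by rewrite -[RHS]mulr_natl mulrA.
by rewrite bin_small // !mul0r.
Qed.

Lemma bin_coef_out (N d : nat) (x : 'I_N -> C) (al be : T N) :
  (forall i, al i < d)%N -> be \notin cube N d -> bin_coef x al be = 0.
Proof.
move=> ald; rewrite in_cube negb_forall => /existsP[j]; rewrite -leqNgt => dbe.
by rewrite /bin_coef (bigD1 j) //= bin_small ?mul0r // (leq_trans (ald j)).
Qed.

Lemma ffun_bound (N : nat) (al : T N) : exists d, forall i, (al i < d)%N.
Proof. by exists (\max_i al i).+1 => i; rewrite ltnS leq_bigmax. Qed.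

Lemma has_sum_bin (N : nat) (x y : 'I_N -> C) (al : T N) :
  has_sum (fun be => bin_coef x al be * mon y be) (mon (fun i => x i + y i) al).
Proof.
have [d ald] := ffun_bound al; rewrite -(bin_coef_cube _ _ ald).
by apply: has_sum_fin => be /(bin_coef_out x ald) ->; rewrite mul0r.
Qed.

Lemma asum_bin (N : nat) (x y : 'I_N -> C) (al : T N) :
  asum (fun be => bin_coef x al be * mon y be) (mon (fun i => `|x i| + `|y i|) al).
Proof.
move=> S; have [d ald] := ffun_bound al; have [d0 hd0] := sub_cube S.
rewrite -(@bin_coef_cube _ (maxn d d0)) => [|i]; last by rewrite leq_max ald.
apply: le_trans (ler_sum_fset _ (hd0 _ (leq_maxr d d0))) _ => //.
apply: ler_sum => be _; rewrite normrM mon_norm.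
suff -> : `|bin_coef x al be| = bin_coef (fun i => `|x i|) al be by [].
rewrite /bin_coef normr_prod; apply: eq_bigr => i _.
by rewrite normrM normrX normr_nat.
Qed.

(** Re-centring at w by the binomial theorem. The double series converges
    absolutely on half the polydisc, because |w_i| + |v_i| <= e there. *)
Lemma holo_open (N : nat) (F : 'rV[C]_N -> C) p : holo_at F p ->
  exists e : C, 0 < e /\ forall w : 'rV[C]_N, (forall i, `|w 0 i| <= e) -> holo_at F (p + w).
Proof.
move=> /holo_pws[a [e [B h]]]; have [e0 aB aF] := h.
have [e20 e2e] := eps2 e0; exists (e / 2); split => // w we.
have key (v : 'I_N -> C) : (forall i, `|v i| <= e / 2) ->
    asum (fun p : T N * T N => a p.1 * bin_coef (w 0) p.1 p.2 * mon v p.2) B.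
  move=> ve; apply: (@asum_pair _ _ _ _ (fun al => `|a al| * mon (fun=> e) al)) => [al S|S] /=.
    under eq_bigr do rewrite -mulrA normrM.
    rewrite -mulr_sumr ler_wpM2l // (le_trans (asum_bin _ _ _ S)) //.
    rewrite -[leLHS]ger0_norm; last by apply: prodr_ge0 => i _; rewrite exprn_ge0 // addr_ge0.
    by apply: le_mon => i; rewrite ger0_norm ?addr_ge0 // -e2e lerD.
  apply: le_trans (aB S); apply: ler_sum => al _.
  by rewrite normrM mon_cst_norm.
have [|v ve|d [hd _]] := @pws_group N _ (fun p : T N * T N => p.2)
  (fun p => a p.1 * bin_coef (w 0) p.1 p.2) F (p + w) (e / 2) B e20.
- by apply: key => _; rewrite gtr0_norm.
- have [s hs] := has_sum_ex (key (v 0) ve).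
  suff -> : F (p + w + v) = s by [].
  rewrite -addrA.
  have wv i : `|(w + v) 0 i| <= e by rewrite mxE -e2e (le_trans (ler_normD _ _)) // lerD.
  apply: has_sum_unique (aF _ wv) _.
  apply: has_sum_pair (key (v 0) ve) hs _ => al /=.
  have := has_sumZ (a al) (has_sum_bin (w 0) (v 0) al).
  rewrite (_ : mon _ _ = mon ((w + v) 0) al); last by apply: eq_bigr => i _; rewrite mxE.
  by apply: eq_has_sum => be; rewrite mulrA.
- exact: pws_holo hd.
Qed.
End HoloClosure.

(** * Differentiability of power series *)

Section Calculus.
Variable R : realType.
Local Notation C := (Cplx R).
Local Notation T N := {ffun 'I_N -> nat}.

Lemma entry_le_norm (k l : nat) (M : 'M[C]_(k, l)) i j : `|M i j| <= `|M|.
Proof.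
rewrite [leRHS]/Num.Def.normr /=.
have := lexx (mx_norm M); rewrite {1 2}mx_normE num_le => /bigmax_leP[_ /(_ (i, j) isT)].
by rewrite -num_le -mx_normE.
Qed.

Lemma mx_norm_le (k l : nat) (M : 'M[C]_(k, l)) (e : C) :
  0 <= e -> (forall i j, `|M i j| <= e) -> `|M| <= e.
Proof.
move=> e0 Me; rewrite [leLHS]/Num.Def.normr /=.
by have [->//|/mx_norm_neq0[[i j] /= ->]] := eqVneq (mx_norm M) 0; exact: Me.
Qed.

Lemma row_norm_lt (N : nat) (v : 'rV[C]_N) (e : C) : `|v| < e -> forall i, `|v 0 i| <= e.
Proof. by move=> ve i; apply: ltW; apply: le_lt_trans ve; exact: entry_le_norm. Qed.

Lemma cvg_mx_entry (k l : nat) (U : Type) (F : set_system U) {FF : Filter F}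
    (M : U -> 'M[C]_(k, l)) (L : 'M[C]_(k, l)) :
  (forall i j, (fun x => M x i j) @ F --> L i j) -> M @ F --> L.
Proof.
move=> cM; apply/cvgrPdist_le => e e0.
have : \forall x \near F, forall p : 'I_k * 'I_l, `|L p.1 p.2 - M x p.1 p.2| <= e.
  apply: filter_forall => p; have /cvgrPdist_le := cM p.1 p.2; exact.
apply: filterS => x hx; apply: mx_norm_le (ltW e0) _ => i j.
by rewrite !mxE; exact: (hx (i, j)).
Qed.

Lemma entry_cvg (k l : nat) (U : Type) (F : set_system U) {FF : Filter F}
    (M : U -> 'M[C]_(k, l)) (L : 'M[C]_(k, l)) i j :
  M @ F --> L -> (fun x => M x i j) @ F --> L i j.
Proof.
move=> /cvgrPdist_le cM; apply/cvgrPdist_le => e e0.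
apply: filterS (cM _ e0) => x; apply: le_trans.
by have := entry_le_norm (L - M x) i j; rewrite !mxE.
Qed.

Lemma derive_cvg (V W : normedModType C) (f : V -> W) a v l :
  ((fun h => h^-1 *: ((f \o shift a) (h *: v) - f a)) @ 0^' --> l) ->
  is_derive a v f l.
Proof.
move=> h; split; first by apply/cvg_ex; exists l.
exact: cvg_lim h.
Qed.

Lemma is_derive_mx (k l : nat) (V : normedModType C) (f : V -> 'M[C]_(k, l)) a v
    (d : 'M[C]_(k, l)) :
  (forall i j, is_derive a v (fun x => f x i j) (d i j)) -> is_derive a v f d.
Proof.
move=> hf; apply: derive_cvg; apply: cvg_mx_entry => i j.
have [h1 h2] := hf i j; have := h1; rewrite /derivable.
have -> : d i j = lim ((fun h : C => h^-1 *: (((fun x => f x i j) \o shift a) (h *: v) - f a i j)) @ 0^').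
  by rewrite -h2.
by apply: cvg_trans; apply: near_eq_cvg; apply: nearW => h; rewrite !mxE.
Qed.

(** A quadratic remainder is what the terms of degree at least 2 of a power series
    provide. *)
Lemma is_diff_quad (V W : normedModType C) (f : V -> W) (p : V) (L : {linear V -> W}) (e M : C) :
  0 < e -> 0 <= M -> continuous L ->
  (forall h, `|h| <= e -> `|f (p + h) - f p - L h| <= M * `|h| ^+ 2) ->
  is_diff p f L.
Proof.
move=> e0 M0 cL hM.
have E : f \o shift p = cst (f p) + L +o_ 0 id.
  apply/eqaddoP => eps eps0; near=> h.
  have -> : (f \o shift p - (cst (f p) + L)) h = f (p + h) - f p - L h.
    by rewrite /= opprD addrA [p + h]addrC.
  apply: le_trans (hM h _) _; first by near: h; apply: nbhs0_le.
  apply: (@le_trans _ _ ((M + 1) * `|h| ^+ 2)).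
    by rewrite ler_wpM2r ?exprn_ge0 // lerDl.
  rewrite expr2 mulrA ler_wpM2r // -ler_pdivlMl ?ltr_wpDl //.
  near: h; apply: nbhs0_le; rewrite mulr_gt0 // invr_gt0 ltr_wpDl //.
have dL := diff_unique cL E.
by split => //; apply/diff_locallyP; rewrite dL.
Unshelve. all: by end_near. Qed.

Definition linform (N : nat) (a : 'I_N -> C) (v : 'rV[C]_N) : C^o := \sum_i v 0 i * a i.

Lemma linform_linear (N : nat) (a : 'I_N -> C) : linear (linform a).
Proof.
move=> k u v; rewrite /linform scaler_sumr -big_split; apply: eq_bigr => i _.
by rewrite !mxE mulrDl -mulrA.
Qed.

HB.instance Definition _ (N : nat) (a : 'I_N -> C) :=
  GRing.isLinear.Build C 'rV[C]_N C^o *:%R (linform a) (linform_linear a).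

Lemma linform_cont (N : nat) (a : 'I_N -> C) : continuous (linform a).
Proof.
rewrite /linform; apply: continuous_big => [|i _ x]; first exact: add_continuous.
have := @cvgM C _ _ _ (fun v : 'rV[C]_N => v 0 i) (fun=> a i) _ _ (@coord_continuous C 1 N 0 i x) (cvg_cst _).
exact.
Qed.

Lemma deg_lt2 (N : nat) (al : T N) : (deg al < 2)%N ->
  al = zero_idx N \/ exists i, al = unit_idx i.
Proof.
move=> d2; have [/existsP[i ai]|/existsPn a0] := boolP [exists i, 0 < al i]%N.
  right; exists i; apply/ffunP => j; rewrite ffunE.
  have s1 : (al i + \sum_(k | k != i) al k < 2)%N by move: d2; rewrite /deg (bigD1 i).
  case: eqP => [->|/eqP ji] /=.
    by apply/eqP; rewrite eqn_leq ai -ltnS (leq_ltn_trans (leq_addr _ _) s1).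
  apply/eqP; rewrite -leqn0 -ltnS -(ltn_add2l 1) (leq_ltn_trans _ s1) //.
  by rewrite leq_add // (bigD1 j) //= leq_addr.
left; apply/ffunP => i; rewrite ffunE; apply/eqP; rewrite -leqn0 leqNgt; exact: a0.
Qed.

Lemma has_sum_delta (I : choiceType) (b : I) (x : C) :
  has_sum (fun i => if i == b then x else 0) x.
Proof.
have := @has_sum_fin R I (fun i => if i == b then x else 0) [fset b]%fset.
rewrite big_seq_fset1 eqxx; apply => i; rewrite inE => /negbTE ->; by [].
Qed.

Lemma pws_center (N : nat) (a : T N -> C) F p e B : pws a F p e B -> F p = a (zero_idx N).
Proof.
move=> [e0 _ aF]; have h0 i : `|(0 : 'rV[C]_N) 0 i| <= e by rewrite mxE normr0 ltW.
have := aF 0 h0; rewrite addr0 => h; apply: has_sum_unique h _.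
apply: eq_has_sum (has_sum_delta (zero_idx N) (a (zero_idx N))) => al.
case: eqP => [->|/eqP al0]; first by rewrite mon_zero mulr1.
have [j aj] : exists j, (0 < al j)%N.
  apply/existsP; apply: contraNT al0 => /existsPn h; apply/eqP/ffunP => i.
  by rewrite ffunE; apply/eqP; rewrite -leqn0 leqNgt; exact: h.
by rewrite /mon (bigD1 j) //= mxE expr0n eqn0Ngt aj mul0r mulr0.
Qed.

(** After removal of the terms of degree 0 and 1, each term of the series at v is
    at most (|v| / e)^2 times the bound for it on the whole polydisc. *)
Lemma pws_is_diff (N : nat) (a : T N -> C) F p e B : pws a F p e B ->
  is_diff p F (linform (fun i => a (unit_idx i))).
Proof.
move=> h; have [e0 aB aF] := h.
apply: (@is_diff_quad _ _ F p _ e (B / e ^+ 2) e0); last move=> v ve.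
- by rewrite divr_ge0 ?(asum_ge0 aB) // exprn_ge0 // ltW.
- exact: linform_cont.
have vi i : `|v 0 i| <= e by apply: le_trans ve; exact: entry_le_norm.
(* The remainder as the sum of the series without its terms of degree 0 and 1. *)
have h1 : has_sum (fun al => a al * mon (v 0) al - (if al == zero_idx N then a (zero_idx N) else 0)
    - \sum_i (if al == unit_idx i then v 0 i * a (unit_idx i) else 0))
    (F (p + v) - F p - linform (fun i => a (unit_idx i)) v).
  apply: has_sumB; first by rewrite (pws_center h); apply: has_sumB (aF v vi) _; exact: has_sum_delta.
  by apply: has_sum_big => i; exact: has_sum_delta.
have -> : B / e ^+ 2 * `|v| ^+ 2 = (`|v| / e) ^+ 2 * B by rewrite expr_div_n mulrAC [RHS]mulrAC [B * _]mulrC.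
apply: has_sum_le h1 _ => S.
apply: le_trans (_ : _ <= \sum_(al <- S) (`|v| / e) ^+ 2 * `|a al * mon (fun=> e) al|) _; last first.
  by rewrite -mulr_sumr ler_wpM2l ?aB // exprn_ge0 // divr_ge0 // ltW.
apply: ler_sum => al _.
have r0 : 0 <= (`|v| / e) ^+ 2 * `|a al * mon (fun=> e) al|.
  by rewrite mulr_ge0 ?exprn_ge0 // divr_ge0 // ltW.
have [d2|d2] := ltnP (deg al) 2.
  suff -> : a al * mon (v 0) al - (if al == zero_idx N then a (zero_idx N) else 0)
    - \sum_i (if al == unit_idx i then v 0 i * a (unit_idx i) else 0) = 0 by rewrite normr0.
  have zu i : (zero_idx N == unit_idx i) = false.
    by apply/eqP => /ffunP/(_ i); rewrite !ffunE eqxx.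
  have [->|[i ->]] := deg_lt2 d2.
    by rewrite eqxx mon_zero mulr1 subrr big1 ?subr0 // => i _; rewrite zu.
  rewrite eq_sym zu subr0 mon_unit (bigD1 i) //= eqxx big1 ?addr0 => [|j /negbTE ji].
    by rewrite mulrC subrr.
  case: eqP => // /ffunP/(_ j); rewrite !ffunE ji eqxx //.
have -> : (al == zero_idx N) = false.
  by apply/eqP => E; move: d2; rewrite E /deg big1 // => i _; rewrite ffunE.
rewrite subr0 big1 ?subr0 => [|i _]; last first.
  case: eqP => // E; move: d2; rewrite E /deg (bigD1 i) //= ffunE eqxx big1 //.
  by move=> j /negbTE ji; rewrite ffunE ji.
rewrite !normrM [leRHS]mulrCA ler_wpM2l // mon_cst_norm //.
apply: (@le_trans _ _ (mon (fun=> `|v|) al)); first by apply: le_mon => i; exact: entry_le_norm.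
rewrite !mon_cst -(subnK d2) !exprD expr_div_n.
rewrite [leRHS]mulrA [leRHS]mulrAC divfK ?expf_neq0 ?gt_eqF //.
by rewrite [leRHS]mulrC ler_wpM2r ?exprn_ge0 // lerXn2r ?nnegrE // ltW.
Qed.

Lemma holo_differentiable (N : nat) (F : 'rV[C]_N -> C) p : holo_at F p -> differentiable F p.
Proof. by move=> /holo_pws[a [e [B /pws_is_diff[]]]]. Qed.

Lemma pws_derive (N : nat) (a : T N -> C) F p e B i : pws a F p e B ->
  is_derive p (delta_mx 0 i) F (a (unit_idx i)).
Proof.
move=> /pws_is_diff[dF dE]; split; first exact: diff_derivable.
rewrite deriveE // dE /linform (bigD1 i) //= mxE !eqxx mul1r big1 ?addr0 //.
by move=> j /negbTE ji; rewrite mxE ji andbF mul0r.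
Qed.
End Calculus.

(** * Asymptotic expansions at a punctured point *)

Section Asymptotics.
Variable R : realType.
Local Notation C := (Cplx R).

Lemma near0P (P : C -> Prop) : (\forall s \near (0 : C)^', P s) <->
  exists e : C, 0 < e /\ forall s, `|s| < e -> s != 0 -> P s.
Proof.
split=> [[e /= e0 h]|[e [e0 h]]].
  exists e; split => // s se s0; apply: h => //.
  by rewrite /ball_ /= sub0r normrN.
exists e => //= s; rewrite /ball_ /= sub0r normrN => se s0; exact: h.
Qed.

(** Asymptotic rather than convergent expansions, because they are multiplied and
    compared with little effort; at s = 0 itself the functions to be expanded
    have no meaningful value. *)
Definition asymp (phi : C -> C) (c : nat -> C) : Prop :=
  forall K, exists M : C, 0 <= M /\ \forall s \near (0 : C)^',
    `|phi s - \sum_(k < K) c k * s ^+ k| <= M * `|s| ^+ K.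

Lemma asymp_eq (phi psi : C -> C) c : (\forall s \near (0 : C)^', phi s = psi s) ->
  asymp phi c -> asymp psi c.
Proof.
move=> pp hc K; have [M [M0 hM]] := hc K; exists M; split=> //.
by apply: filterS2 pp hM => s ->.
Qed.

Lemma eq_asymp (phi : C -> C) c d : c =1 d -> asymp phi c -> asymp phi d.
Proof. by move=> /funext ->. Qed.

Lemma asymp0 : asymp (fun=> 0) (fun=> 0).
Proof.
move=> K; exists 0; split=> //; apply: nearW => s.
by rewrite big1 ?subrr ?normr0 ?mul0r // => i _; rewrite mul0r.
Qed.

Lemma asympD phi psi c d : asymp phi c -> asymp psi d ->
  asymp (fun s => phi s + psi s) (fun k => c k + d k).
Proof.
move=> hc hd K; have [M [M0 hM]] := hc K; have [M' [M'0 hM']] := hd K.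
exists (M + M'); split; first exact: addr_ge0.
apply: filterS2 hM hM' => s h1 h2.
under eq_bigr do rewrite mulrDl.
rewrite big_split opprD addrACA mulrDl (le_trans (ler_normD _ _)) //.
exact: lerD.
Qed.

Lemma asympZ a phi c : asymp phi c -> asymp (fun s => a * phi s) (fun k => a * c k).
Proof.
move=> hc K; have [M [M0 hM]] := hc K; exists (`|a| * M); split; first exact: mulr_ge0.
apply: filterS hM => s h1; under eq_bigr do rewrite -mulrA.
by rewrite -mulr_sumr -mulrBr normrM -mulrA ler_wpM2l.
Qed.

Lemma asymp_sum J (r : seq J) (phi : J -> C -> C) c :
  (forall j, asymp (phi j) (c j)) ->
  asymp (fun s => \sum_(j <- r) phi j s) (fun k => \sum_(j <- r) c j k).
Proof.
move=> h; elim: r => [|j r IH].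
  by have := asymp0; congr asymp; apply/funext => x; rewrite big_nil.
have := asympD (h j) IH; congr asymp; by apply/funext => x; rewrite big_cons.
Qed.

(** Let p and q be the truncations at order K. Then phi psi - p q is O(s^K), and
    the part of degree at least K of p q is s^K times a polynomial. *)
Lemma asympM phi psi c d : asymp phi c -> asymp psi d ->
  asymp (fun s => phi s * psi s) (fun n => \sum_(k < n.+1) c k * d (n - k)%N).
Proof.
move=> hc hd K.
have [M [M0 hM]] := hc K; have [M' [M'0 hM']] := hd K; have [N [N0 hN]] := hd 0%N.
pose p := \poly_(k < K) c k; pose q := \poly_(k < K) d k.
pose A : C := \sum_(k < K) `|c k|.
pose B : C := \sum_(k < K + K) `|(p * q)`_(K + k)|.
exists (M * N + A * M' + B).
have A0 : 0 <= A by exact: sumr_ge0.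
have B0 : 0 <= B by exact: sumr_ge0.
split; first by rewrite !addr_ge0 // mulr_ge0.
have h1 : \forall s \near (0 : C)^', `|s| <= 1.
  by apply/near0P; exists 1; split=> // s /ltW.
near=> s.
have s1 : `|s| <= 1 by near: s.
have pl n (e : nat -> C) : `|\sum_(k < n) e k * s ^+ k| <= \sum_(k < n) `|e k|.
  apply: le_trans (ler_norm_sum _ _ _) _; apply: ler_sum => k _.
  by rewrite normrM normrX ler_piMr // exprn_ile1.
have pE : \sum_(k < K) c k * s ^+ k = p.[s] by rewrite horner_poly.
have qE : \sum_(k < K) d k * s ^+ k = q.[s] by rewrite horner_poly.
have pqE : p.[s] * q.[s] - \sum_(n < K) (\sum_(k < n.+1) c k * d (n - k)%N) * s ^+ n =
    s ^+ K * \sum_(k < K + K) (p * q)`_(K + k) * s ^+ k.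
  have sz : (size (p * q)%R <= K + (K + K))%N.
    apply: leq_trans (size_polyMleq _ _) _.
    have := size_poly K c; have := size_poly K d; rewrite -/p -/q; lia.
  rewrite -hornerM (horner_coef_wide _ sz) big_split_ord /=.
  rewrite [X in X + _ - _](_ : _ = \sum_(n < K) (\sum_(k < n.+1) c k * d (n - k)%N) * s ^+ n).
    rewrite addrC addKr mulr_sumr; apply: eq_bigr => k _.
    by rewrite exprD mulrCA.
  apply: eq_bigr => n _; congr (_ * _); rewrite coefM; apply: eq_bigr => k _.
  have kK : (k < K)%N by apply: leq_ltn_trans (ltn_ord n); rewrite -ltnS.
  have nkK : (n - k < K)%N by apply: leq_ltn_trans (ltn_ord n); rewrite leq_subr.
  by rewrite !coef_poly kK nkK.
rewrite -[X in `|X|](_ : (phi s - p.[s]) * psi s + p.[s] * (psi s - q.[s]) +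
    (p.[s] * q.[s] - \sum_(n < K) (\sum_(k < n.+1) c k * d (n - k)%N) * s ^+ n) = _); last first.
  by rewrite mulrBl mulrBr addrA; ring.
rewrite pqE [leRHS]mulrDl [X in _ <= X + _]mulrDl; apply: le_trans (ler_normD _ _) _; apply: lerD; last first.
  rewrite normrM normrX mulrC ler_wpM2r ?exprn_ge0 //.
  exact: (pl _ (fun k => (p * q)`_(K + k))).
apply: le_trans (ler_normD _ _) _; apply: lerD; rewrite normrM.
  rewrite mulrAC ler_pM //; first by rewrite -pE; near: s.
  have : `|psi s - \sum_(k < 0) d k * s ^+ k| <= N * `|s| ^+ 0 by near: s.
  by rewrite big_ord0 subr0 expr0 mulr1.
rewrite -mulrA ler_pM //; first by rewrite -pE.
by rewrite -qE; near: s.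
Unshelve. all: by end_near. Qed.

(** The first nonzero coefficient would dominate the remainder along small
    positive s. *)
Lemma asymp_uniq0 c : asymp (fun=> 0) c -> forall k, c k = 0.
Proof.
move=> hc k; elim/ltn_ind: k => k IH.
have [M [M0 /near0P[e [e0 hM]]]] := hc k.+1.
apply/eqP; rewrite -normr_eq0 eq_le normr_ge0 andbT; apply/ler_addgt0Pr => d d0.
have [x [x0 xe xd]] : exists x : C, [/\ 0 < x, x < e & M * x <= d].
  have [x [x0 xe xd]] := @pos_min R (e / 2) (d / (M + 1)) (divr_gt0 e0 (ltr0Sn _ _))
    (divr_gt0 d0 (ltr_wpDl M0 ltr01)).
  exists x; split => //.
    by apply: le_lt_trans xe _; rewrite ltr_pdivrMr // ltr_pMr // ltr1n.
  move: xd; rewrite ler_pdivlMr ?ltr_wpDl // => xd; apply: le_trans xd.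
  by rewrite mulrC ler_pM2l // lerDl.
have xn : `|x| = x by rewrite gtr0_norm.
have := hM x; rewrite xn => /(_ xe); rewrite gt_eqF // => /(_ isT).
rewrite big_ord_recr /= big1 ?add0r ?sub0r => [|i _]; last by rewrite IH // mul0r.
rewrite normrN normrM normrX xn exprS mulrA ler_pM2r ?exprn_gt0 //.
by move=> h; rewrite (le_trans h).
Qed.

Lemma asymp_uniq phi c d : asymp phi c -> asymp phi d -> c =1 d.
Proof.
move=> hc hd k; apply/eqP; rewrite -subr_eq0 -mulN1r; apply/eqP.
apply: (@asymp_uniq0 (fun k => c k + -1 * d k)).
have := asympD hc (asympZ (-1) hd); apply: asymp_eq.
by apply: nearW => s; rewrite mulN1r subrr.
Qed.

Lemma asymp_shift phi c : asymp phi c ->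
  asymp (fun s => s * phi s) (fun k => if k is k'.+1 then c k' else 0).
Proof.
move=> hc [|K].
  have [M [M0 hM]] := hc 0%N; exists M; split=> //.
  have h1 : \forall s \near (0 : C)^', `|s| <= 1.
    by apply/near0P; exists 1; split=> // s /ltW.
  apply: filterS2 hM h1 => s; rewrite !big_ord0 !subr0 !expr0 !mulr1 normrM => h s1.
  by rewrite (le_trans _ h) // ler_piMl.
have [M [M0 hM]] := hc K; exists M; split=> //.
apply: filterS hM => s h; rewrite big_ord_recl /= mul0r add0r.
under eq_bigr do rewrite /bump /= exprS mulrCA.
rewrite -mulr_sumr -mulrBr normrM exprS mulrCA ler_wpM2l //.
Qed.

Lemma near0_scale (l : C) (P : C -> Prop) : l != 0 ->
  (\forall s \near (0 : C)^', P s) -> \forall s \near (0 : C)^', P (l * s).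
Proof.
move=> l0 /near0P[e [e0 h]]; apply/near0P; exists (e / `|l|); split.
  by rewrite divr_gt0 ?normr_gt0.
move=> s; rewrite ltr_pdivlMr ?normr_gt0 // => se s0; apply: h.
  by rewrite normrM mulrC.
by rewrite mulf_neq0.
Qed.

Lemma asymp_scale (l : C) phi c : l != 0 -> asymp phi c ->
  asymp (fun s => phi (l * s)) (fun k => l ^+ k * c k).
Proof.
move=> l0 hc K; have [M [M0 hM]] := hc K; exists (M * `|l| ^+ K); split.
  by rewrite mulr_ge0 ?exprn_ge0.
apply: filterS (near0_scale l0 hM) => s; rewrite normrM exprMn mulrA.
congr (`|_ - _| <= _); apply: eq_bigr => k _.
by rewrite exprMn mulrA [c k * _]mulrC.
Qed.

(** Convergence at a single z > 0 bounds c_k z^k; the tail is then geometric for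
    |s| < z / 2. *)
Lemma asymp_series phi c :
  (\forall s \near (0 : C)^', series (fun k => s ^+ k * c k) @ \oo --> phi s) ->
  asymp phi c.
Proof.
move=> /near0P[e [e0 he]] K.
have e2 : 0 < e / 2 by rewrite divr_gt0.
pose z := e / 2; have zn : `|z| = z by rewrite gtr0_norm.
(* The terms of a convergent series are bounded. *)
have [M [M0 hM]] : exists M : C, 0 <= M /\ forall k, `|c k| * z ^+ k <= M.
  have /cvgrPdist_le/(_ 1 ltr01)[N _ hN] : series (fun k => z ^+ k * c k) @ \oo --> phi z.
    by apply: he; rewrite ?gt_eqF // zn /z ltr_pdivrMr // ltr_pMr // ltr1n.
  exists (2 + \sum_(k < N) `|c k| * z ^+ k).
  have s0 : 0 <= \sum_(k < N) `|c k| * z ^+ k.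
    by apply: sumr_ge0 => k _; rewrite mulr_ge0 // exprn_ge0 // ltW.
  split=> [|k]; first by rewrite addr_ge0.
  have [kN|Nk] := ltnP k N.
    rewrite (bigD1 (Ordinal kN)) //= addrCA lerDl addr_ge0 //.
    by apply: sumr_ge0 => j _; rewrite mulr_ge0 // exprn_ge0 // ltW.
  apply: (@le_trans _ _ 2); last by rewrite lerDl.
  have -> : `|c k| * z ^+ k = `|(phi z - series (fun k => z ^+ k * c k) k) -
      (phi z - series (fun k => z ^+ k * c k) k.+1)|.
    rewrite opprB addrC addrA subrK /series /= big_nat_recr //= addrC addKr.
    by rewrite normrM normrX zn mulrC.
  rewrite (le_trans (ler_normB _ _)) // -[2]/(1 + 1) lerD // hN //=.
  by rewrite (leq_trans Nk).
exists (2 * M / z ^+ K); split.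
  by rewrite divr_ge0 ?exprn_ge0 ?mulr_ge0 // ltW.
apply/near0P; exists (z / 2); split=> [|s sz s0]; first by rewrite divr_gt0.
have cs : series (fun k => s ^+ k * c k) @ \oo --> phi s.
  apply: he => //; apply: lt_trans sz _; apply: (@lt_trans _ _ z).
    by rewrite ltr_pdivrMr // ltr_pMr // ltr1n.
  by rewrite /z ltr_pdivrMr // ltr_pMr // ltr1n.
apply/ler_addgt0Pr => d d0; have /cvgrPdist_le/(_ d d0)[N _ hN] := cs.
have := hN (N + K)%N (leq_addr _ _).
have -> : \sum_(k < K) c k * s ^+ k = series (fun k => s ^+ k * c k) K.
  by rewrite /series /= big_mkord; apply: eq_bigr => k _; rewrite mulrC.
set S := series _; move=> hd.
rewrite -[X in `|X|](subrKA (S (N + K)%N)) addrC (le_trans (ler_normD _ _)) // lerD //.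
rewrite /S /series /= addnC (big_cat_nat (leq0n K) (leq_addr N K)) //= addrAC subrr add0r.
rewrite -{1}[K]add0n big_addn addKn big_mkord.
have -> : 2 * M / z ^+ K * `|s| ^+ K = M * (`|s| / z) ^+ K * 2.
  by rewrite [(_ / z) ^+ K]expr_div_n [RHS]mulrC -!mulrA [_^-1 * _]mulrC.
have r2 : `|s| / z <= 2^-1 by rewrite ler_pdivrMr // mulrC ltW.
have r0 : 0 <= `|s| / z by rewrite divr_ge0 // ltW.
apply: le_trans (ler_norm_sum _ _ _) _.
apply: (@le_trans _ _ (\sum_(i < N) M * (`|s| / z) ^+ K * 2^-1 ^+ i)).
  apply: ler_sum => i _; rewrite normrM normrX.
  have -> : `|s| ^+ (i + K) * `|c (i + K)%N| = (`|c (i + K)%N| * z ^+ (i + K)) * (`|s| / z) ^+ (i + K).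
    by rewrite [(_ / z) ^+ _]expr_div_n mulrC -mulrA [z ^+ _ * _]mulrC divfK ?expf_neq0 ?gt_eqF.
  rewrite [(_ / z) ^+ (i + K)]exprD [_ ^+ i * _ ^+ K]mulrC mulrA.
  apply: ler_pM; rewrite ?mulr_ge0 ?exprn_ge0 //; first exact: ltW.
    by rewrite ler_wpM2r ?exprn_ge0.
  by rewrite lerXn2r ?nnegrE ?invr_ge0.
by rewrite -mulr_sumr ler_wpM2l ?mulr_ge0 ?exprn_ge0 // half_geom.
Qed.
End Asymptotics.

(** * Power series in (q, z) and their slices *)

Section Slices.
Variable R : realType.
Local Notation C := (Cplx R).
Local Notation T N := {ffun 'I_N -> nat}.

Lemma has_sum_bij (I J : choiceType) (f : I -> J) (g : J -> I) (c : J -> C) s B :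
  cancel f g -> cancel g f -> asum c B -> has_sum c s -> has_sum (fun i => c (f i)) s.
Proof.
move=> fK gK cB cs; apply: (has_sum_fibre (pi := g) cB cs) => i.
apply: eq_has_sum (has_sum_delta (f i) (c (f i))) => j.
by rewrite -(can_eq gK) fK; case: eqP => [<-|//]; rewrite gK.
Qed.

Definition join_idx (m : nat) (p : T m * nat) : T (m + 1) :=
  [ffun x => match fintype.split x with inl i => p.1 i | inr _ => p.2 end].
Definition split_idx (m : nat) (al : T (m + 1)) : T m * nat :=
  ([ffun i => al (lshift 1 i)], al (rshift m ord0)).

Lemma join_idxK (m : nat) : cancel (@join_idx m) (@split_idx m).
Proof.
move=> [be k]; congr pair; last by rewrite ffunE (unsplitK (inr ord0)).
by apply/ffunP => i; rewrite !ffunE (unsplitK (inl i)).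
Qed.

Lemma split_idxK (m : nat) : cancel (@split_idx m) (@join_idx m).
Proof.
move=> al; apply/ffunP => x; rewrite ffunE -{2}(splitK x).
by case: (fintype.split x) => i /=; rewrite ?ffunE // (ord1 i).
Qed.

Lemma mon_join (m : nat) (w : 'I_(m + 1) -> C) p :
  mon w (join_idx p) = mon (fun i => w (lshift 1 i)) p.1 * w (rshift m ord0) ^+ p.2.
Proof.
rewrite /mon big_split_ord /= big_ord1 ffunE (unsplitK (inr ord0)); congr (_ * _).
by apply: eq_bigr => i _; rewrite ffunE (unsplitK (inl i)).
Qed.

(** The last variable is separated from the others so that the double series can be
    summed in either order. *)
Definition dpws (m : nat) (b : T m * nat -> C) (F : 'rV[C]_(m + 1) -> C) (q : 'rV[C]_m) (e B : C) :=
  [/\ 0 < e, asum (fun p => b p * (mon (fun=> e) p.1 * e ^+ p.2)) B &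
    forall (v : 'rV[C]_m) (z : C), (forall i, `|v 0 i| <= e) -> `|z| <= e ->
      has_sum (fun p => b p * (mon (v 0) p.1 * z ^+ p.2)) (F (point_z (q + v) z))].

Lemma pws_dpws (m : nat) (a : T (m + 1) -> C) F (q : 'rV[C]_m) e B :
  pws a F (point_z q 0) e B -> dpws (fun p => a (join_idx p)) F q e B.
Proof.
move=> h; have [e0 aB aF] := h; split=> // [|v z ve ze].
  have := asum_inj (can_inj (@join_idxK m)) aB.
  by apply: le_asum => p; rewrite mon_join.
have we i : `|(row_mx v z%:M : 'rV[C]_(m + 1)) 0 i| <= e.
  by rewrite mxE; case: splitP => j _ //; rewrite (ord1 j) mxE eqxx.
have -> : point_z (q + v) z = point_z q 0 + row_mx v z%:M.
  by rewrite /point_z add_row_mx -raddfD add0r.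
have := has_sum_bij (@join_idxK m) (@split_idxK m) (pws_asum h we) (aF _ we).
apply: eq_has_sum => p; rewrite mon_join; congr (_ * (_ * _)); last first.
  by rewrite row_mxEr mxE eqxx.
by apply: eq_bigr => i _; rewrite row_mxEl.
Qed.

Section Dpws.
Variables (m : nat) (b : T m * nat -> C) (F : 'rV[C]_(m + 1) -> C) (q : 'rV[C]_m) (e B : C).
Hypothesis bF : dpws b F q e B.

Lemma dpws_asum (v : 'rV[C]_m) (z : C) : (forall i, `|v 0 i| <= e) -> `|z| <= e ->
  asum (fun p => b p * (mon (v 0) p.1 * z ^+ p.2)) B.
Proof.
move=> ve ze; have [e0 bB _] := bF; apply: le_asum bB => p.
rewrite normrM [leRHS]normrM ler_wpM2l // normrM [leRHS]normrM ler_pM // ?mon_cst_norm ?le_mon //.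
by rewrite !normrX (gtr0_norm e0) lerXn2r ?nnegrE // ltW.
Qed.

(** Summing over the exponents of v first. *)
Lemma dpws_z (v : 'rV[C]_m) : (forall i, `|v 0 i| <= e) ->
  exists d : nat -> C,
    (forall k, has_sum (fun be => b (be, k) * mon (v 0) be) (d k)) /\
    (forall z, `|z| <= e -> has_sum (fun k => d k * z ^+ k) (F (point_z (q + v) z))).
Proof.
move=> ve; have [e0 bB hF] := bF.
have ee : `|e| <= e by rewrite gtr0_norm.
have cB : asum (fun p => b p * mon (v 0) p.1 * e ^+ p.2) B.
  by apply: le_asum (dpws_asum ve ee) => p; rewrite mulrA.
have [d [dB dfib dF]] := has_sum_group (fun k => exprn_gt0 k e0) cB.
exists d; split=> [k|z ze].
  have cB' : asum (fun p => if p.2 == k then b p * mon (v 0) p.1 else 0) (B / e ^+ k).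
    move=> S; rewrite ler_pdivlMr ?exprn_gt0 // mulr_suml; apply: le_trans (cB S).
    apply: ler_sum => p _; case: eqP => [->|_]; last by rewrite normr0 mul0r.
    by rewrite [leRHS]normrM [X in _ <= _ * X]gtr0_norm ?exprn_gt0.
  apply: (has_sum_fibre (pi := fst) cB' (dfib k)) => be.
  apply: eq_has_sum (has_sum_delta (be, k) (b (be, k) * mon (v 0) be)) => -[be' k'] /=.
  by rewrite xpair_eqE; case: (be' =P be) => [->|_] //; case: (k' =P k) => [->|_].
apply: dF => [k|].
  by rewrite normrX lerXn2r ?nnegrE // ltW.
by apply: eq_has_sum (hF v z ve ze) => p; rewrite mulrA.
Qed.

(** Summing over the exponent of z first. *)
Lemma dpws_q (z : C) : `|z| <= e ->
  exists a : T m -> C, pws a (fun q' => F (point_z q' z)) q e B /\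
    (forall be, has_sum (fun k => b (be, k) * z ^+ k) (a be)).
Proof.
move=> ze; have [e0 bB hF] := bF.
have ve i : `|(const_mx e : 'rV[C]_m) 0 i| <= e by rewrite mxE gtr0_norm.
have cB : asum (fun p => b p * z ^+ p.2 * mon (fun=> e) p.1) B.
  apply: le_asum (dpws_asum ve ze) => p; rewrite mulrAC -mulrA.
  by rewrite (_ : mon (const_mx e 0) p.1 = mon (fun=> e) p.1) //; apply: eq_bigr => i _; rewrite mxE.
have [v ve'|a [ha afib]] := @pws_group R m _ fst (fun p => b p * z ^+ p.2)
   (fun q' => F (point_z q' z)) q e B e0 cB.
  by apply: eq_has_sum (hF v z ve' ze) => p; rewrite [in RHS]mulrAC mulrA.
exists a; split=> // be.
have cB' : asum (fun p => if p.1 == be then b p * z ^+ p.2 else 0) (B / mon (fun=> e) be).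
  move=> S; rewrite ler_pdivlMr ?mon_gt0 // mulr_suml; apply: le_trans (cB S).
  apply: ler_sum => p _; case: eqP => [->|_]; last by rewrite normr0 mul0r.
  by rewrite [leRHS]normrM mon_cst_norm.
apply: (has_sum_fibre (pi := snd) cB' (afib be)) => k.
apply: eq_has_sum (has_sum_delta (be, k) (b (be, k) * z ^+ k)) => -[be' k'] /=.
by rewrite xpair_eqE andbC; case: (k' =P k) => [->|_] //=; case: (be' =P be) => [->|_].
Qed.

Lemma dpws_coef (k : nat) (G : 'rV[C]_m -> C) :
  (forall v : 'rV[C]_m, (forall i, `|v 0 i| <= e) ->
     has_sum (fun be => b (be, k) * mon (v 0) be) (G (q + v))) ->
  pws (fun be => b (be, k)) G q e (B / e ^+ k).
Proof.
move=> hG; have [e0 bB _] := bF; split=> // S.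
rewrite ler_pdivlMr ?exprn_gt0 // mulr_suml.
have kinj : injective (fun be : T m => (be, k)) by move=> ? ? [].
have := asum_inj kinj bB S; apply: le_trans.
apply: ler_sum => be _ /=.
by rewrite mulrA [leRHS]normrM [X in _ <= _ * X]gtr0_norm ?exprn_gt0.
Qed.
End Dpws.

Lemma pos_min_fin (I : finType) (e : I -> C) : (forall i, 0 < e i) ->
  exists e0 : C, 0 < e0 /\ forall i, e0 <= e i.
Proof.
move=> he; suff [e0 [e00 h]] : exists e0 : C, 0 < e0 /\ forall i, i \in enum I -> e0 <= e i.
  by exists e0; split=> // i; apply: h; rewrite mem_enum.
elim: (enum I) => [|i s [e0 [e00 IH]]]; first by exists 1.
have [e1 [e10 e1e e1i]] := pos_min e00 (he i); exists e1; split=> // j.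
by rewrite inE => /orP[/eqP->//|/IH]; apply: le_trans.
Qed.

Lemma asymp_has_sum (phi : C -> C) (c : nat -> C) (e : C) : 0 < e ->
  (forall z, `|z| <= e -> has_sum (fun k => c k * z ^+ k) (phi z)) -> asymp phi c.
Proof.
move=> e0 h; apply: asymp_series; apply/near0P; exists e; split=> // s /ltW se s0.
apply: has_sum_series; apply: eq_has_sum (h s se) => k; exact: mulrC.
Qed.

Lemma asymp_cst (x : C) : asymp (fun=> x) (fun k => if k is 0%N then x else 0).
Proof.
apply: (@asymp_has_sum _ _ 1 ltr01) => z _.
apply: eq_has_sum (has_sum_delta 0%N x) => -[|k]; first by rewrite expr0 mulr1.
by rewrite mul0r.
Qed.
End Slices.

(** * Neighbourhoods in the base *)

Section BasePoints.
Variable R : realType.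
Local Notation C := (Cplx R).
Local Notation T N := {ffun 'I_N -> nat}.

Lemma point_z_norm (m : nat) (v : 'rV[C]_m) (z e : C) : 0 <= e ->
  (forall i, `|v 0 i| <= e) -> `|z| <= e -> `|(row_mx v z%:M : 'rV[C]_(m + 1))| <= e.
Proof.
move=> e0 ve ze; apply: mx_norm_le => // i j; rewrite mxE ord1.
by case: splitP => k _ //; rewrite (ord1 k) mxE eqxx.
Qed.

Lemma point_zD (m : nat) (q v : 'rV[C]_m) (z : C) :
  point_z (q + v) z = point_z q 0 + row_mx v z%:M.
Proof. by rewrite /point_z add_row_mx -raddfD add0r. Qed.

Lemma near_norm (V : normedModType C) (p : V) (P : V -> Prop) :
  (\forall x \near p, P x) -> exists d : C, 0 < d /\ forall v, `|v| < d -> P (p + v).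
Proof.
move=> /nbhs_normP[d /= d0 h]; exists d; split=> // v vd; apply: h.
by rewrite /= opprD addNKr normrN.
Qed.

Lemma norm_near (V : normedModType C) (p : V) (P : V -> Prop) (d : C) :
  0 < d -> (forall v, `|v| < d -> P (p + v)) -> \forall x \near p, P x.
Proof.
move=> d0 h; apply/nbhs_normP; exists d => // x /=; rewrite distrC => xd.
by rewrite -[x](subrK p) addrC; exact: h.
Qed.

(** The neighbourhood on which all later local arguments take place: z r(q, z) is
    given there by power series in (q, z) with a common radius, and the base is
    open. *)
Lemma base_local (m n : nat) (r : 'rV[C]_m -> C -> 'M[C]_n) (q0 : 'rV[C]_m) : base r q0 ->
  exists (e B : C) (f : 'rV[C]_(m + 1) -> 'M[C]_n) (b : 'I_n -> 'I_n -> T m * nat -> C),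
  [/\ 0 < e, holo_mx_at f (point_z q0 0),
      forall i j, dpws (b i j) (fun x => f x i j) q0 e B,
      forall (v : 'rV[C]_m) z, (forall i, `|v 0 i| <= e) -> `|z| <= e -> z != 0 ->
        regular_at r (q0 + v) z /\ f (point_z (q0 + v) z) = z *: r (q0 + v) z &
      forall v : 'rV[C]_m, (forall i, `|v 0 i| <= e) -> base r (q0 + v)].
Proof.
move=> [f [hf /near_norm[d [d0 hd]]]].
have hP (p : 'I_n * 'I_n) : exists aeB : (T (m + 1) -> C) * (C * C),
    pws aeB.1 (fun x => f x p.1 p.2) (point_z q0 0) aeB.2.1 aeB.2.2.
  by have [a [e [B h]]] := holo_pws (hf p.1 p.2); exists (a, (e, B)).
have [aeB haeB] := choice hP.
have hO (p : 'I_n * 'I_n) : exists e : C, 0 < e /\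
    forall w : 'rV[C]_(m + 1), (forall i, `|w 0 i| <= e) ->
      holo_at (fun x => f x p.1 p.2) (point_z q0 0 + w).
  exact: (holo_open (hf p.1 p.2)).
have [eo heo] := choice hO.
have [e1 [e10 he1]] := @pos_min_fin R _ (fun p => (aeB p).2.1) (fun p => let: And3 x _ _ := haeB p in x).
have [e2 [e20 he2]] := @pos_min_fin R _ eo (fun p => (heo p).1).
have [e3 [e30 e31 e32]] := pos_min e10 e20.
(* v, w and z all of size at most e keep the point (q0 + v + w, z) in the ball
   of radius d, as 2 e < d. *)
have [e [e_gt0 ee3 eed]] := pos_min e30 (divr_gt0 d0 (ltr0Sn _ 3)).
have e_ge0 := ltW e_gt0.
have ed : e < d by apply: le_lt_trans eed _; rewrite ltr_pdivrMr // ltr_pMr // ltr1n.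
have e2d : e + e < d.
  apply: le_lt_trans (lerD eed eed) _; rewrite -mulrDl ltr_pdivrMr // -mulr2n -[d *+ 2]mulr_natr.
  by rewrite ltr_pM2l // ltr_nat.
pose B : C := \sum_p `|(aeB p).2.2|.
exists e, B, f, (fun i j p => (aeB (i, j)).1 (join_idx p)).
have key (v w : 'rV[C]_m) z : (forall i, `|v 0 i| <= e) -> (forall i, `|w 0 i| <= e) -> `|z| <= e ->
    z != 0 -> regular_at r (q0 + v + w) z /\ f (point_z (q0 + v + w) z) = z *: r (q0 + v + w) z.
  move=> ve we ze z0.
  have hn : `|(row_mx (v + w) z%:M : 'rV[C]_(m + 1))| < d.
    apply: le_lt_trans (_ : _ <= e + e) e2d; apply: point_z_norm; first exact: addr_ge0.
      by move=> i; rewrite mxE (le_trans (ler_normD _ _)) // lerD.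
    by rewrite (le_trans ze) // lerDl.
  have := hd _ hn; rewrite -point_zD addrA /point_z row_mxKl row_mxKr mxE eqxx mulr1n.
  by move=> /(_ z0)[? ->]; rewrite /uncurry_z row_mxKl row_mxKr mxE eqxx.
split; [exact: e_gt0|exact: hf| | |].
- move=> i j; apply: pws_dpws.
  have [_ hB _] := pws_shrink (haeB (i, j)) e_gt0 (le_trans ee3 (le_trans e31 (he1 (i, j)))).
  have [_ _ hF] := pws_shrink (haeB (i, j)) e_gt0 (le_trans ee3 (le_trans e31 (he1 (i, j)))).
  split; [exact: e_gt0| |exact: hF] => S; apply: le_trans (hB S) _.
  apply: le_trans (real_ler_norm _) _.
    by rewrite realE (asum_ge0 hB).
  by rewrite /B (bigD1 (i, j)) //= lerDl sumr_ge0.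
- move=> v z ve ze z0; have := key v 0 z ve _ ze z0; rewrite addr0; apply.
  by move=> i; rewrite mxE normr0.
- move=> v ve; exists f; split.
    move=> i j; rewrite point_zD; apply: (heo (i, j)).2 => k.
    apply: le_trans (entry_le_norm _ _ _) _.
    apply: le_trans (_ : _ <= e) _; first by apply: point_z_norm; rewrite ?normr0.
    exact: le_trans ee3 (le_trans e32 (he2 (i, j))).
  apply: (norm_near e_gt0) => w /row_norm_lt we z0.
  have zE : rsubmx (point_z (q0 + v) 0 + w) 0 0 = rsubmx w 0 0.
    by rewrite /point_z raddfD /= row_mxKr !mxE mul0rn add0r.
  have vE : lsubmx (point_z (q0 + v) 0 + w) = q0 + v + lsubmx w.
    by rewrite /point_z raddfD /= row_mxKl.
  have wl : forall i, `|lsubmx w 0 i| <= e by move=> i; rewrite mxE.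
  have wr : `|rsubmx w 0 0| <= e by rewrite mxE.
  rewrite zE in z0.
  have [h1 h2] := key v (lsubmx w) _ ve wl wr z0.
  rewrite /uncurry_z zE vE; split=> //; rewrite -h2; congr f.
  rewrite -[LHS]hsubmxK vE /point_z; congr row_mx.
  by apply/matrixP => i j; rewrite !ord1 zE [RHS]mxE eqxx mulr1n.
Qed.
End BasePoints.

(** * The axioms of an r-matrix in terms of Laurent coefficients *)

Section Coefficients.
Variable R : realType.
Local Notation C := (Cplx R).
Local Notation T N := {ffun 'I_N -> nat}.
Variables (m n : nat) (g : quadratic_lie_algebra R n) (h : abelian_subalgebra g m).
Variables (r : 'rV[C]_m -> C -> 'M[C]_n) (t : 'rV[C]_m -> nat -> 'M[C]_n).
Hypothesis drm : dynamical_rmatrix h r t.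

(** The coefficient of z^k in z r(q, z). The shift by one degree treats the Casimir
    element and the t_k alike. *)
Definition rcoef (q : 'rV[C]_m) (k : nat) : 'M[C]_n :=
  if k is k'.+1 then t q k' else casimir g.

Lemma regular_near (q : 'rV[C]_m) : base r q -> \forall z \near (0 : C)^', regular_at r q z.
Proof.
move=> /base_local[e [B [f [b [e0 _ _ hr _]]]]].
apply/near0P; exists e; split=> // z /ltW ze z0.
have [] := hr 0 z _ ze z0; first by move=> i; rewrite mxE normr0 ltW.
by rewrite addr0.
Qed.

Lemma rcoef_asymp (q : 'rV[C]_m) i j : base r q ->
  asymp (fun z => z * r q z i j) (fun k => rcoef q k i j).
Proof.
move=> /(drm_laurent drm) hq.
have h1 : asymp (fun z => (r q z - z^-1 *: casimir g) i j) (fun k => t q k i j).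
  apply: asymp_series; apply: filterS hq => z hz.
  have H := @entry_cvg R n n nat \oo _ _ _ i j hz.
  suff E : series (fun k => z ^+ k * t q k i j) = (fun N => series (fun k => z ^+ k *: t q k) N i j).
    by rewrite E; exact: H.
  apply/funext => N; rewrite /series /= summxE; apply: eq_bigr => k _; by rewrite mxE.
have := asympD (asympZ (casimir g i j) (asymp_cst (1 : C))) (asymp_shift h1).
move/eq_asymp => h2; have {}h2 : asymp (fun s => casimir g i j * 1 + s * (r q s - s^-1 *: casimir g) i j)
    (fun k => rcoef q k i j).
  by apply: h2 => -[|k]; rewrite /= ?mulr1 ?addr0 ?mulr0 ?add0r.
apply: asymp_eq h2; apply/near0P; exists 1; split=> // s _ s0.
by rewrite !mxE mulrBr mulrA mulfV // mul1r mulr1 addrC subrK.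
Qed.

(** The t_k are only known to expand r at each q separately; uniqueness of
    expansions identifies them with the coefficients of the joint power series,
    which depend holomorphically on q. *)
Lemma rcoef_local (q0 : 'rV[C]_m) : base r q0 ->
  exists (e B : C) (f : 'rV[C]_(m + 1) -> 'M[C]_n) (b : 'I_n -> 'I_n -> T m * nat -> C),
  [/\ 0 < e /\ holo_mx_at f (point_z q0 0),
      forall i j, dpws (b i j) (fun x => f x i j) q0 e B,
      forall (v : 'rV[C]_m) z, (forall i, `|v 0 i| <= e) -> `|z| <= e -> z != 0 ->
        f (point_z (q0 + v) z) = z *: r (q0 + v) z,
      forall v : 'rV[C]_m, (forall i, `|v 0 i| <= e) -> base r (q0 + v) &
      forall v : 'rV[C]_m, (forall i, `|v 0 i| <= e) -> forall i j,
        (forall k, has_sum (fun be => b i j (be, k) * mon (v 0) be) (rcoef (q0 + v) k i j)) /\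
        (forall z, `|z| <= e ->
           has_sum (fun k => rcoef (q0 + v) k i j * z ^+ k) (f (point_z (q0 + v) z) i j))].
Proof.
move=> /base_local[e [B [f [b [e0 hf hb hr hbase]]]]].
exists e, B, f, b; split; [by []|by []|by move=> v z ve ze z0; case: (hr v z ve ze z0)|by []|].
move=> v ve i j; have [d [hd1 hd2]] := dpws_z (hb i j) ve.
suff E : forall k, rcoef (q0 + v) k i j = d k.
  split=> [k|z ze]; first by rewrite E.
  by apply: eq_has_sum (hd2 z ze) => k; rewrite E.
apply: asymp_uniq (rcoef_asymp i j (hbase v ve)) _.
apply: asymp_eq (asymp_has_sum e0 hd2); apply/near0P; exists e; split=> // z /ltW ze z0.
by have [_ ->] := hr v z ve ze z0; rewrite mxE.
Qed.

Definition drcoef (l : 'I_m) (q : 'rV[C]_m) (k : nat) (i j : 'I_n) : C :=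
  'D_(delta_mx 0 l) (fun q' => rcoef q' k i j) q.

(** The derivative in q is the coefficient of degree 1 in q of the joint power
    series, so it commutes with taking the coefficient of z^k. *)
Lemma rcoef_derive (q : 'rV[C]_m) : base r q ->
  (forall l k i j, is_derive q (delta_mx 0 l) (fun q' => rcoef q' k i j) (drcoef l q k i j)) /\
  (forall l i j, asymp (fun z => z * dq (r^~ z) l q i j) (fun k => drcoef l q k i j)).
Proof.
move=> /rcoef_local[e [B [f [b [[e0 _] hb hr _ hc]]]]].
have h1 l k i j : is_derive q (delta_mx 0 l) (fun q' => rcoef q' k i j) (b i j (unit_idx l, k)).
  have hp : pws (fun be => b i j (be, k)) (fun q' => rcoef q' k i j) q e (B / e ^+ k).
    by apply: (dpws_coef (hb i j)) => v ve; exact: (hc v ve i j).1.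
  exact: pws_derive hp.
have h1E l k i j : drcoef l q k i j = b i j (unit_idx l, k) by rewrite /drcoef derive_val.
split=> [l k i j|l i j]; first by rewrite h1E.
have E : forall z, `|z| < e -> z != 0 -> forall i' j',
  exists2 x, has_sum (fun k => b i' j' (unit_idx l, k) * z ^+ k) x &
    is_derive q (delta_mx 0 l) (fun q' => r q' z i' j') (z^-1 * x).
  move=> z /ltW ze z0 i' j'; have [a [ha hax]] := dpws_q (hb i' j') ze.
  exists (a (unit_idx l)); first exact: hax.
  have h2 := pws_derive l ha.
  have h3 : is_derive q (delta_mx 0 l) (fun q' => z^-1 * f (point_z q' z) i' j') (z^-1 * a (unit_idx l)).
    exact: is_deriveZ.
  apply: near_eq_is_derive h3.
  apply: (norm_near e0) => v /row_norm_lt ve; rewrite hr // mxE mulrA mulVf ?mul1r //.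
apply: asymp_series; apply/near0P; exists e; split=> // z ze z0.
have [x hx _] := E z ze z0 i j.
suff -> : z * dq (r^~ z) l q i j = x.
  have H := has_sum_series hx; apply: (cvg_trans _ H); apply: near_eq_cvg; apply: nearW => N.
  by rewrite /series /=; apply: eq_bigr => k _; rewrite h1E mulrC.
have hd : is_derive q (delta_mx 0 l) (r^~ z) (\matrix_(i', j') (z^-1 * sval (cid2 (E z ze z0 i' j')))).
  apply: is_derive_mx => i' j'; rewrite mxE; exact: (svalP (cid2 (E z ze z0 i' j'))).2.
rewrite /dq derive_val mxE mulrA mulfV // mul1r; case: cid2 => y /= hy _.
exact: has_sum_unique hy hx.
Qed.

Lemma rcoef_zero_weight (q : 'rV[C]_m) (u : 'rV[C]_m) k : base r q ->
  (ad_mx g (u *m h))^T *m rcoef q k + rcoef q k *m ad_mx g (u *m h) = 0.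
Proof.
move=> bq; have HZ z := @drm_zero_weight _ _ _ _ _ _ _ drm q z u.
move: (ad_mx g (u *m h)) HZ => A HZ; apply/matrixP => i j; rewrite !mxE.
have H : asymp (fun z => \sum_l A l i * (z * r q z l j) + \sum_l A l j * (z * r q z i l))
    (fun k => \sum_l A l i * rcoef q k l j + \sum_l A l j * rcoef q k i l).
  by apply: asympD; apply: asymp_sum => l; apply: asympZ; exact: rcoef_asymp.
have H0 : asymp (fun=> 0) (fun k => \sum_l A l i * rcoef q k l j + \sum_l A l j * rcoef q k i l).
  apply: asymp_eq H; apply: filterS (regular_near bq) => z hz.
  have /matrixP/(_ i j) := HZ z hz; rewrite !mxE => {}hz.
  under eq_bigr do rewrite mulrCA; under [X in _ + X]eq_bigr do rewrite mulrCA.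
  rewrite -!mulr_sumr -mulrDr -[RHS](mulr0 z) -[X in _ = _ * X]hz; congr (_ * (_ + _)).
    by apply: eq_bigr => l _; rewrite mxE.
  by apply: eq_bigr => l _; rewrite mulrC.
rewrite -[RHS](asymp_uniq0 H0 k); congr (_ + _); apply: eq_bigr => l _; first by rewrite mxE.
by rewrite mulrC.
Qed.

Lemma rcoef_unitarity (q : 'rV[C]_m) k : base r q ->
  (rcoef q k)^T = (-1) ^+ k *: rcoef q k.
Proof.
move=> bq; apply/matrixP => i j; rewrite !mxE.
have N1 : (-1 : C) != 0 by rewrite oppr_eq0 oner_eq0.
apply: (@asymp_uniq _ _ (fun k => rcoef q k j i) (fun k => (-1) ^+ k * rcoef q k i j)
   (rcoef_asymp j i bq)).
apply: asymp_eq (asymp_scale N1 (rcoef_asymp i j bq)).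
apply: filterS2 (regular_near bq) (near0_scale N1 (regular_near bq)) => z h1 h2.
rewrite mulN1r in h2.
have /matrixP/(_ j i) := drm_unitarity drm h1 h2; rewrite !mxE mulN1r => /eqP.
by rewrite addr_eq0 => /eqP ->; rewrite mulNr mulrN.
Qed.

Section Bilinear.
Variables (S1 S2 : C -> 'M[C]_n) (s1 s2 : nat -> 'M[C]_n).
Hypothesis h1 : forall i j, asymp (fun s => s * S1 s i j) (fun k => s1 k i j).
Hypothesis h2 : forall i j, asymp (fun s => s * S2 s i j) (fun k => s2 k i j).

(** The common form of the three commutators of the Yang-Baxter equation; the index
    maps select the tensor factors. *)
Lemma asymp_bil (i1 j1 i2 j2 : 'I_n -> 'I_n -> 'I_n) (c : 'I_n -> 'I_n -> C) :
  asymp (fun s => s ^+ 2 * \sum_i \sum_j S1 s (i1 i j) (j1 i j) * S2 s (i2 i j) (j2 i j) * c i j)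
    (fun N => \sum_(k < N.+1) \sum_i \sum_j
      s1 k (i1 i j) (j1 i j) * s2 (N - k)%N (i2 i j) (j2 i j) * c i j).
Proof.
have H : asymp (fun s => \sum_i \sum_j c i j * ((s * S1 s (i1 i j) (j1 i j)) * (s * S2 s (i2 i j) (j2 i j))))
   (fun N => \sum_i \sum_j c i j * \sum_(k < N.+1) s1 k (i1 i j) (j1 i j) * s2 (N - k)%N (i2 i j) (j2 i j)).
  by apply: asymp_sum => i; apply: asymp_sum => j; exact: (asympZ _ (asympM (h1 _ _) (h2 _ _))).
have {}H := eq_asymp _ (asymp_eq _ H); apply: H.
  move=> N; rewrite [RHS]exchange_big; apply: eq_bigr => i _.
  rewrite [RHS]exchange_big; apply: eq_bigr => j _.
  by rewrite mulr_sumr; apply: eq_bigr => k _; rewrite mulrC.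
apply: nearW => s; rewrite mulr_sumr; apply: eq_bigr => i _.
rewrite mulr_sumr; apply: eq_bigr => j _; ring.
Qed.
End Bilinear.

Lemma rcoef_scale (q : 'rV[C]_m) (l : C) i j : base r q -> l != 0 ->
  asymp (fun s => s * r q (l * s) i j) (fun k => ((l^-1 * l ^+ k) *: rcoef q k) i j).
Proof.
move=> bq l0; have := asympZ l^-1 (asymp_scale l0 (rcoef_asymp i j bq)).
move=> H; apply: eq_asymp (asymp_eq _ H) => [k|]; first by rewrite mxE mulrA.
by apply: nearW => s; rewrite !mulrA mulVf // mul1r.
Qed.

Lemma drcoef_scale (q : 'rV[C]_m) (l : C) p i j : base r q -> l != 0 ->
  asymp (fun s => s ^+ 2 * dq (r^~ (l * s)) p q i j)
    (fun k => if k is k'.+1 then l^-1 * l ^+ k' * drcoef p q k' i j else 0).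
Proof.
move=> bq l0; have [_ hd] := rcoef_derive bq.
have H := asymp_shift (asympZ l^-1 (asymp_scale l0 (hd p i j))).
apply: eq_asymp (asymp_eq _ H) => [[|k] //=|]; first by rewrite mulrA.
by apply: nearW => s; rewrite -[l * s * _]mulrA mulKf // mulrA -expr2.
Qed.

(** The coefficient of s^(N+1) in s^2 times the Yang-Baxter equation at
    (z_1, z_2, z_3) = (x s, s, 0). The differences z_1 - z_3 and z_1 - z_2 are
    then x s and (x - 1) s, whence the conditions on x. *)
Lemma cdybe_coef (q : 'rV[C]_m) (x : C) (N : nat) a b c : base r q -> x != 0 -> x != 1 ->
  \sum_i h i a * drcoef i q N b c
  + \sum_i h i b * ((- x)^-1 * (- x) ^+ N * drcoef i q N c a)
  + \sum_i h i c * ((x - 1)^-1 * (x - 1) ^+ N * drcoef i q N a b)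
  + \sum_(k < N.+2) (br12_13 g (((x - 1)^-1 * (x - 1) ^+ k) *: rcoef q k)
        ((x^-1 * x ^+ (N.+1 - k)) *: rcoef q (N.+1 - k)) a b c)
  + \sum_(k < N.+2) (br12_23 g (((x - 1)^-1 * (x - 1) ^+ k) *: rcoef q k) (rcoef q (N.+1 - k)) a b c)
  + \sum_(k < N.+2) (br13_23 g ((x^-1 * x ^+ k) *: rcoef q k) (rcoef q (N.+1 - k)) a b c) = 0.
Proof.
move=> bq x0 x1.
have y0 : x - 1 != 0 by rewrite subr_eq0.
have mx0 : - x != 0 by rewrite oppr_eq0.
pose r1 k := ((x - 1)^-1 * (x - 1) ^+ k) *: rcoef q k.
pose r2 k := (x^-1 * x ^+ k) *: rcoef q k.
pose r3 k := (1^-1 * 1 ^+ k) *: rcoef q k.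
have A12_13 := asymp_bil (fun i j => rcoef_scale i j bq y0) (fun i j => rcoef_scale i j bq x0)
  (fun i j => i) (fun i j => b) (fun i j => j) (fun i j => c) (fun i j => struct_const g i j a).
have A12_23 := asymp_bil (fun i j => rcoef_scale i j bq y0) (fun i j => rcoef_scale i j bq (oner_neq0 _))
  (fun i j => a) (fun i j => i) (fun i j => j) (fun i j => c) (fun i j => struct_const g i j b).
have A13_23 := asymp_bil (fun i j => rcoef_scale i j bq x0) (fun i j => rcoef_scale i j bq (oner_neq0 _))
  (fun i j => a) (fun i j => i) (fun i j => b) (fun i j => j) (fun i j => struct_const g i j c).
have D (l : C) (l0 : l != 0) (a' b' c' : 'I_n) := asymp_sum (index_enum 'I_m)
   (fun i => asympZ (h i a') (drcoef_scale i b' c' bq l0)).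
have H := asympD (asympD (asympD (asympD (asympD (D 1 (oner_neq0 _) a b c) (D _ mx0 b c a))
   (D _ y0 c a b)) A12_13) A12_23) A13_23.
have H0 : asymp (fun=> 0) _ := asymp_eq _ H.
rewrite -[RHS](asymp_uniq0 (H0 _) N.+1) /=.
  congr (_ + _ + _ + _ + _ + _).
  - by apply: eq_bigr => i _; rewrite invr1 expr1n !mul1r.
  - apply: eq_bigr => k _; apply: eq_bigr => i _; apply: eq_bigr => j _.
    by rewrite invr1 expr1n mul1r scale1r.
  - apply: eq_bigr => k _; apply: eq_bigr => i _; apply: eq_bigr => j _.
    by rewrite invr1 expr1n mul1r scale1r.
have rn := regular_near bq.
have rn1 := near0_scale x0 rn; have rn2 := near0_scale mx0 rn; have rn3 := near0_scale y0 rn.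
apply: filterS2 (filterI rn rn1) (filterI rn2 rn3) => s [k1 k2] [k3 k4].
have e12 : x * s - s = (x - 1) * s by rewrite mulrBl mul1r.
have e31 : 0 - x * s = - x * s by rewrite sub0r mulNr.
have := drm_cdybe drm (q := q) (z1 := x * s) (z2 := s) (z3 := 0).
rewrite /Alt_dh e12 !subr0 e31 => /(_ k4 k2 k1 k3 a b c).
rewrite !mul1r => E.
rewrite -[RHS](mulr0 (s ^+ 2)) -[X in _ = _ * X]E !mulrDr.
congr (_ + _ + _ + _ + _ + _); rewrite mulr_sumr; apply: eq_bigr => i _; rewrite mulrCA ?mul1r //.
Qed.
End Coefficients.

(** * Extracting a power of x *)

Section CoefficientOfX.
Variable R : realType.
Local Notation C := (Cplx R).

Lemma coef_XsubC_exp (k i : nat) : (('X - 1) ^+ k : {poly C})`_i = (-1) ^+ (k + i) *+ 'C(k, i).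
Proof.
rewrite addrC exprDn coef_sum.
have E (j : 'I_k.+1) : ((((-1) ^+ (k - j) : {poly C}) * 'X^j) *+ 'C(k, j))`_i =
    if (j == i :> nat) then (-1) ^+ (k + i) *+ 'C(k, i) else 0.
  rewrite coefMn -[(-1) ^+ (k - j)](rmorph_sign (@polyC C)) coefCM coefXn eq_sym.
  case: eqP => [->|_]; last by rewrite mulr0 mul0rn.
  have [ik|ki] := leqP i k; last by rewrite bin_small // !mulr0n.
  by rewrite mulr1 -signr_odd -[in RHS]signr_odd oddB // oddD.
rewrite (eq_bigr _ (fun j _ => E j)).
have [ik|ki] := leqP i k.
  rewrite (bigD1 (Ordinal (ik : i < k.+1)%N)) //= eqxx big1 ?addr0 // => j.
  by rewrite -val_eqE /= => /negbTE ->.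
rewrite bin_small // mulr0n big1 // => j _; case: eqP => // ji.
Qed.

Lemma poly_zero_cofinite (p : {poly C}) :
  (forall x, x != 0 -> x != 1 -> p.[x] = 0) -> p = 0.
Proof.
move=> hp; pose s := [seq (k.+2)%:R : C | k <- iota 0 (size p)].
apply: (@roots_geq_poly_eq0 _ p s).
- apply/allP => _ /mapP[k _ ->]; apply/eqP; apply: hp; first by rewrite pnatr_eq0.
  by rewrite -[1]/(1%:R) eqr_nat.
- by rewrite map_inj_uniq ?iota_uniq // => i j /eqP; rewrite eqr_nat => /eqP[].
- by rewrite size_map size_iota.
Qed.

(** After multiplication by x, only the terms in P 0 and Q 0 = - P 0 are not
    polynomials in x. With d = a + b, together they are
    P 0 (x^(d+2) - x) / (x - 1) = P 0 (x + x^2 + ... + x^(d+1)), so there is no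
    pole at x = 1. The conclusion is the vanishing of the coefficient of x^(a+1)
    in the resulting polynomial. *)
Lemma laurent_coef_x (P Q S : nat -> C) (d1 d2 d3 : C) (a b : nat) :
  P 0%N + Q 0%N = 0 ->
  (forall x, x != 0 -> x != 1 ->
     d1 + (- x)^-1 * (- x) ^+ (a + b).+1 * d2 + (x - 1)^-1 * (x - 1) ^+ (a + b).+1 * d3
     + \sum_(k < (a + b).+3) ((x - 1)^-1 * (x - 1) ^+ k) * (x^-1 * x ^+ ((a + b).+2 - k)) * P k
     + \sum_(k < (a + b).+3) ((x - 1)^-1 * (x - 1) ^+ k) * Q k
     + \sum_(k < (a + b).+3) (x^-1 * x ^+ k) * S k = 0) ->
  (if a == 0%N then d1 else 0) + (if b == 0%N then (-1) ^+ a * d2 else 0)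
  + (-1) ^+ b * d3 *+ 'C(a + b, b) + P 0%N
  + \sum_(k < (a + b).+2) (-1) ^+ b * P k.+1 *+ 'C(k, b)
  + \sum_(k < (a + b).+2) (-1) ^+ (k + a) * Q k.+1 *+ 'C(k, a)
  + S a.+1 = 0.
Proof.
set d := (a + b)%N => PQ hx.
(* x times the hypothesis, with the two terms that have a pole at x = 1 combined. *)
pose p : {poly C} := d1 *: 'X + ((-1) ^+ d * d2) *: 'X^(d.+1) + d3 *: (('X - 1) ^+ d * 'X^1)
  + P 0%N *: \sum_(i < d.+1) 'X^(i.+1)
  + \sum_(k < d.+2) P k.+1 *: (('X - 1) ^+ k * 'X^(d.+1 - k))
  + \sum_(k < d.+2) Q k.+1 *: (('X - 1) ^+ k * 'X^1)
  + \sum_(k < d.+3) S k *: 'X^k.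
have p0 : p = 0.
  apply: poly_zero_cofinite => x x0 x1; have y0 : x - 1 != 0 by rewrite subr_eq0.
  have -> : p.[x] = d1 * x + (-1) ^+ d * d2 * x ^+ d.+1 + d3 * ((x - 1) ^+ d * x)
      + P 0%N * \sum_(i < d.+1) x ^+ i.+1
      + \sum_(k < d.+2) P k.+1 * ((x - 1) ^+ k * x ^+ (d.+1 - k))
      + \sum_(k < d.+2) Q k.+1 * ((x - 1) ^+ k * x)
      + \sum_(k < d.+3) S k * x ^+ k.
    rewrite /p !hornerD !hornerZ !horner_sum hornerX !hornerM !hornerXn horner_exp hornerXsubC expr1.
    congr (_ + _ * _ + _ + _ + _).
    - by apply: eq_bigr => k _; rewrite hornerXn.
    - by apply: eq_bigr => k _; rewrite hornerZ hornerM horner_exp hornerXsubC hornerXn.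
    - by apply: eq_bigr => k _; rewrite hornerZ hornerM horner_exp hornerXsubC hornerXn expr1.
    - by apply: eq_bigr => k _; rewrite hornerZ hornerXn.
  rewrite -[RHS](mulr0 x) -[X in _ = x * X](hx x x0 x1) !(mulrDr x).
  have -> : x * ((- x)^-1 * (- x) ^+ d.+1 * d2) = (-1) ^+ d * d2 * x ^+ d.+1.
    rewrite [(- x) ^+ _]exprS mulKf ?oppr_eq0 // [(- x) ^+ d]exprNn [x ^+ d.+1]exprS; move: ((-1) ^+ d) (x ^+ d) => u w; ring.
  have -> : x * ((x - 1)^-1 * (x - 1) ^+ d.+1 * d3) = d3 * ((x - 1) ^+ d * x).
    rewrite exprS mulKf //; move: ((x - 1) ^+ d) => u; ring.
  have -> : x * (\sum_(k < d.+3) (x - 1)^-1 * (x - 1) ^+ k * (x^-1 * x ^+ (d.+2 - k)) * P k) =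
      (x - 1)^-1 * x ^+ d.+2 * P 0%N + \sum_(k < d.+2) P k.+1 * ((x - 1) ^+ k * x ^+ (d.+1 - k)).
    rewrite big_ord_recl mulrDr; congr (_ + _).
      by rewrite expr0 mulr1 subn0; move: (x ^+ d.+2) ((x - 1)^-1) (P _) => u w z; field.
    rewrite mulr_sumr; apply: eq_bigr => k _; rewrite lift0 exprS mulKf // subSS.
    by move: (x ^+ _) ((x - 1) ^+ _) (P _) => u w z; field.
  have -> : x * (\sum_(k < d.+3) (x - 1)^-1 * (x - 1) ^+ k * Q k) =
      - ((x - 1)^-1 * x * P 0%N) + \sum_(k < d.+2) Q k.+1 * ((x - 1) ^+ k * x).
    rewrite big_ord_recl mulrDr; congr (_ + _).
      by rewrite (_ : Q _ = - P 0%N) ?expr0 ?mulr1; [ring|apply/eqP; rewrite -addr_eq0 addrC PQ].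
    rewrite mulr_sumr; apply: eq_bigr => k _; rewrite lift0 exprS mulKf //; ring.
  have -> : x * (\sum_(k < d.+3) x^-1 * x ^+ k * S k) = \sum_(k < d.+3) S k * x ^+ k.
    rewrite mulr_sumr; apply: eq_bigr => k _; by move: (x ^+ _) (S _) => u w; field.
  have -> : \sum_(i < d.+1) x ^+ i.+1 = (x - 1)^-1 * x ^+ d.+2 - (x - 1)^-1 * x.
    rewrite -mulrBr; have -> : x ^+ d.+2 - x = (x - 1) * (x * \sum_(i < d.+1) x ^+ i).
      rewrite mulrCA -subrX1 mulrBr mulr1 -exprS //.
    by rewrite mulKf // mulr_sumr; apply: eq_bigr => k _; rewrite exprS.
  ring.
have sgn2 i j : (-1) ^+ (i + j + i) = (-1) ^+ j :> C.
  by rewrite addnAC addnn exprD -mul2n exprM sqrrN !expr1n mul1r.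
have := congr1 (fun q : {poly C} => q`_a.+1) p0.
rewrite /p coef0 !coefD !coefZ !coef_sum coefX coefXn coefMXn => E.
rewrite -[RHS]E /= subn1 /= coef_XsubC_exp; congr (_ + _ + _ + _ + _ + _ + _).
- by rewrite eqSS; case: eqP; rewrite ?mulr1 ?mulr0.
- have -> : (a.+1 == d.+1)%N = (b == 0)%N by clear; rewrite /d; apply/eqP/eqP; lia.
  rewrite /d; case: eqP => [->|_]; last by rewrite mulr0.
  by rewrite addn0 mulr1.
- by rewrite /d sgn2 mulrC mulrnAr -[in RHS]bin_sub ?leq_addr // addKn.
- have ad : (a < d.+1)%N by rewrite ltnS leq_addr.
  rewrite (bigD1 (Ordinal ad)) //= coefXn eqxx big1 ?addr0 ?mulr1 // => i.
  by rewrite -val_eqE /= coefXn eqSS eq_sym => /negbTE ->.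
- apply: eq_bigr => k _; rewrite coefZ coefMXn coef_XsubC_exp.
  have := ltn_ord k; rewrite ltnS; move: (nat_of_ord k) => j jd.
  have [jb|bj] := ltnP j b.
    rewrite bin_small // mulr0n ifT ?mulr0 //.
    by clear -jb; rewrite /d; lia.
  have -> : (a.+1 - (d.+1 - j) = j - b)%N by clear -jd bj; rewrite /d in jd *; lia.
  rewrite ifF; last by apply/negbTE; rewrite -leqNgt; clear -bj; rewrite /d; lia.
  rewrite bin_sub // mulrnAr mulrC; congr (_ * _ *+ _).
  by rewrite -{1}(subnK bj) sgn2.
- apply: eq_bigr => k _; rewrite coefZ coefMXn /= subn1 /= coef_XsubC_exp.
  by rewrite mulrnAr mulrC.
- have ad : (a.+1 < d.+3)%N by clear; rewrite /d; lia.
  rewrite (bigD1 (Ordinal ad)) //= coefZ coefXn eqxx mulr1 big1 ?addr0 // => i.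
  by rewrite -val_eqE /= coefZ coefXn eq_sym => /negbTE ->; rewrite mulr0.
Qed.
End CoefficientOfX.

(** * Contractions with covectors *)

Section Contraction.
Variable R : realType.
Local Notation C := (Cplx R).

Lemma dotpE (n : nat) (u v : 'rV[C]_n) : dotp u v = \sum_i u 0 i * v 0 i.
Proof. by rewrite /dotp mxE; apply: eq_bigr => i _; rewrite mxE. Qed.

Lemma dotpC (n : nat) (u v : 'rV[C]_n) : dotp u v = dotp v u.
Proof. by rewrite !dotpE; apply: eq_bigr => i _; rewrite mulrC. Qed.

Lemma dotpDl (n : nat) (u w v : 'rV[C]_n) : dotp (u + w) v = dotp u v + dotp w v.
Proof. by rewrite /dotp mulmxDl mxE. Qed.

Lemma dotpZl (n : nat) k (u v : 'rV[C]_n) : dotp (k *: u) v = k * dotp u v.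
Proof. by rewrite /dotp -scalemxAl mxE. Qed.

Lemma dotpNl (n : nat) (u v : 'rV[C]_n) : dotp (- u) v = - dotp u v.
Proof. by rewrite -scaleN1r dotpZl mulN1r. Qed.

Lemma dotp0l (n : nat) (v : 'rV[C]_n) : dotp 0 v = 0.
Proof. by rewrite -(scale0r 0) dotpZl mul0r. Qed.

Lemma dotpDr (n : nat) (u v w : 'rV[C]_n) : dotp u (v + w) = dotp u v + dotp u w.
Proof. by rewrite !(dotpC u) dotpDl. Qed.

Lemma dotpZr (n : nat) k (u v : 'rV[C]_n) : dotp u (k *: v) = k * dotp u v.
Proof. by rewrite !(dotpC u) dotpZl. Qed.

Lemma dotpNr (n : nat) (u v : 'rV[C]_n) : dotp u (- v) = - dotp u v.
Proof. by rewrite !(dotpC u) dotpNl. Qed.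

Lemma dotp0r (n : nat) (u : 'rV[C]_n) : dotp u 0 = 0.
Proof. by rewrite dotpC dotp0l. Qed.

Lemma dotp_suml (n : nat) I (s : seq I) (P : pred I) (F : I -> 'rV[C]_n) v :
  dotp (\sum_(i <- s | P i) F i) v = \sum_(i <- s | P i) dotp (F i) v.
Proof. by apply: (big_morph (fun u => dotp u v)) => [x y|]; [exact: dotpDl|exact: dotp0l]. Qed.

Lemma dotp_sumr (n : nat) I (s : seq I) (P : pred I) (F : I -> 'rV[C]_n) u :
  dotp u (\sum_(i <- s | P i) F i) = \sum_(i <- s | P i) dotp u (F i).
Proof. by rewrite dotpC dotp_suml; apply: eq_bigr => i _; rewrite dotpC. Qed.

Lemma dotp_mulmx (p q : nat) (u : 'rV[C]_p) (M : 'M[C]_(p, q)) (v : 'rV[C]_q) :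
  dotp (u *m M) v = dotp u (v *m M^T).
Proof. by rewrite /dotp trmx_mul trmxK mulmxA. Qed.

Lemma dotp_mulmxE (p q : nat) (u : 'rV[C]_p) (M : 'M[C]_(p, q)) (v : 'rV[C]_q) :
  dotp (u *m M) v = \sum_i \sum_j u 0 i * v 0 j * M i j.
Proof.
rewrite dotp_mulmx dotpE; apply: eq_bigr => i _; rewrite mxE mulr_sumr.
by apply: eq_bigr => j _; rewrite mxE mulrA.
Qed.

Lemma dotp_delta (n : nat) (u : 'rV[C]_n) i : dotp u (delta_mx 0 i) = u 0 i.
Proof.
rewrite dotpE (bigD1 i) //= mxE !eqxx mulr1 big1 ?addr0 // => j /negbTE ji.
by rewrite mxE ji andbF mulr0.
Qed.

Section Bracket.
Variables (n : nat) (g : lie_algebra R n).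

HB.instance Definition _ (X : 'rV[C]_n) :=
  GRing.isLinear.Build C 'rV[C]_n 'rV[C]_n *:%R (lbr g X) (lbr_linr g X).

Lemma lbrC X Y : lbr g X Y = - lbr g Y X.
Proof.
have addl A B D : lbr g (A + B) D = lbr g A D + lbr g B D.
  by have := lbr_linl g D 1 A B; rewrite !scale1r.
have := lbr_alt g (X + Y); rewrite addl !linearD /= !lbr_alt add0r addr0 => /eqP.
by rewrite addr_eq0 => /eqP.
Qed.

Lemma ad_mxE X Y : Y *m ad_mx g X = lbr g X Y.
Proof. by rewrite /ad_mx mul_rV_lin1. Qed.

Lemma dotp_coad X xi Y : dotp (coad g X xi) Y = dotp xi (lbr g X Y).
Proof. by rewrite /coad dotp_mulmx trmxK ad_mxE. Qed.

Definition tri (eta X Y : 'rV[C]_n) : C := dotp eta (lbr g X Y).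

Lemma triC eta X Y : tri eta X Y = - tri eta Y X.
Proof. by rewrite /tri lbrC dotpNr. Qed.

Lemma triDr eta X Y Z : tri eta X (Y + Z) = tri eta X Y + tri eta X Z.
Proof. by rewrite /tri linearD dotpDr. Qed.
Lemma triZr eta X k Y : tri eta X (k *: Y) = k * tri eta X Y.
Proof. by rewrite /tri linearZ dotpZr. Qed.
Lemma triNr eta X Y : tri eta X (- Y) = - tri eta X Y.
Proof. by rewrite -scaleN1r triZr mulN1r. Qed.
Lemma tri0r eta X : tri eta X 0 = 0.
Proof. by rewrite -(scale0r 0) triZr mul0r. Qed.
Lemma triDl eta X Y Z : tri eta (X + Y) Z = tri eta X Z + tri eta Y Z.
Proof. by rewrite triC triDr opprD -!triC. Qed.
Lemma triZl eta X k Y : tri eta (k *: X) Y = k * tri eta X Y.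
Proof. by rewrite triC triZr -mulrN -triC. Qed.
Lemma triNl eta X Y : tri eta (- X) Y = - tri eta X Y.
Proof. by rewrite -scaleN1r triZl mulN1r. Qed.
Lemma tri0l eta Y : tri eta 0 Y = 0.
Proof. by rewrite -(scale0r 0) triZl mul0r. Qed.
Lemma tri0 X Y : tri 0 X Y = 0.
Proof. exact: dotp0l. Qed.
Lemma tri_suml I (s : seq I) (P : pred I) (F : I -> 'rV[C]_n) eta Y :
  tri eta (\sum_(i <- s | P i) F i) Y = \sum_(i <- s | P i) tri eta (F i) Y.
Proof. by apply: (big_morph (fun u => tri eta u Y)) => [x y|]; [exact: triDl|exact: tri0l]. Qed.
Lemma tri_sumr I (s : seq I) (P : pred I) (F : I -> 'rV[C]_n) eta X :
  tri eta X (\sum_(i <- s | P i) F i) = \sum_(i <- s | P i) tri eta X (F i).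
Proof. by apply: (big_morph (tri eta X)) => [x y|]; [exact: triDr|exact: tri0r]. Qed.

Lemma sum_exch4 (F : 'I_n -> 'I_n -> 'I_n -> 'I_n -> C) :
  \sum_b \sum_c \sum_i \sum_j F b c i j = \sum_i \sum_j \sum_b \sum_c F b c i j.
Proof.
under eq_bigr do rewrite exchange_big; rewrite exchange_big; apply: eq_bigr => i _.
by under eq_bigr do rewrite exchange_big; rewrite exchange_big.
Qed.
End Bracket.

Section Invariance.
Variables (n : nat) (g : quadratic_lie_algebra R n).

Lemma lbrE X Y k : lbr g X Y 0 k = \sum_i \sum_j X 0 i * Y 0 j * struct_const g i j k.
Proof.
have E eta A B : tri g eta A B = \sum_i \sum_j A 0 i * B 0 j * tri g eta (delta_mx 0 i) (delta_mx 0 j).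
  rewrite {1}(row_sum_delta A) tri_suml; apply: eq_bigr => i _.
  rewrite triZl {1}(row_sum_delta B) tri_sumr mulr_sumr; apply: eq_bigr => j _.
  by rewrite triZr mulrA.
rewrite -dotp_delta dotpC -/(tri g _ X Y) E; apply: eq_bigr => i _; apply: eq_bigr => j _.
by rewrite /tri dotpC dotp_delta.
Qed.

Lemma casimir_sym : (casimir g)^T = casimir g.
Proof. by rewrite /casimir trmx_inv form_sym. Qed.

(** Invariance of the Casimir element. *)
Lemma tri_inv eta zeta Y : tri g zeta (eta *m casimir g) Y = - tri g eta (zeta *m casimir g) Y.
Proof.
have fc : Defs.form g *m casimir g = 1%:M by rewrite /casimir mulmxV // form_nondeg.
have cf : casimir g *m Defs.form g = 1%:M by rewrite /casimir mulVmx // form_nondeg.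
have := form_inv g Y (zeta *m casimir g) (eta *m casimir g).
rewrite -[zeta *m casimir g *m _]mulmxA cf mulmx1 dotp_mulmx form_sym -mulmxA cf mulmx1.
rewrite dotpC -!/(tri g _ _ _) triC [in X in _ + X]triC => /eqP.
by rewrite -opprD oppr_eq0 addr_eq0 => /eqP E; rewrite E opprK.
Qed.

Section Contr.
Variables eta zeta xi : 'rV[C]_n.

(** The pairing of an element of the threefold tensor product of g with eta, zeta
    and xi. *)
Definition contr (A : 'I_n -> 'I_n -> 'I_n -> C) : C :=
  \sum_a \sum_b \sum_c eta 0 a * zeta 0 b * xi 0 c * A a b c.

Lemma eq_contr A B : (forall a b c, A a b c = B a b c) -> contr A = contr B.
Proof. by move=> AB; apply: eq_bigr => a _; apply: eq_bigr => b _; apply: eq_bigr => c _; rewrite AB. Qed.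

Lemma contrD A B : contr (fun a b c => A a b c + B a b c) = contr A + contr B.
Proof.
rewrite /contr -big_split; apply: eq_bigr => a _; rewrite -big_split; apply: eq_bigr => b _.
by rewrite -big_split; apply: eq_bigr => c _; rewrite mulrDr.
Qed.

Lemma contrZ k A : contr (fun a b c => k * A a b c) = k * contr A.
Proof.
rewrite /contr mulr_sumr; apply: eq_bigr => a _; rewrite mulr_sumr; apply: eq_bigr => b _.
by rewrite mulr_sumr; apply: eq_bigr => c _; rewrite mulrCA.
Qed.

Lemma contr_sum (I : Type) (s : seq I) (A : I -> 'I_n -> 'I_n -> 'I_n -> C) :
  contr (fun a b c => \sum_(k <- s) A k a b c) = \sum_(k <- s) contr (A k).
Proof.
elim: s => [|k s IH].
  rewrite big_nil /contr big1 // => a _; rewrite big1 // => b _; rewrite big1 // => c _.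
  by rewrite big_nil mulr0.
by rewrite big_cons -IH -contrD; apply: eq_contr => a b c; rewrite big_cons.
Qed.

Lemma contr_br12_13 s t : contr (br12_13 g s t) = tri g eta (zeta *m s^T) (xi *m t^T).
Proof.
rewrite /contr /tri dotpE; apply: eq_bigr => a _; rewrite lbrE.
transitivity (\sum_b \sum_c \sum_i \sum_j
   (eta 0 a * (zeta 0 b * s i b) * (xi 0 c * t j c) * struct_const g i j a)).
  apply: eq_bigr => b _; apply: eq_bigr => c _; rewrite /br12_13 mulr_sumr.
  by apply: eq_bigr => i _; rewrite mulr_sumr; apply: eq_bigr => j _; ring.
rewrite sum_exch4 mulr_sumr; apply: eq_bigr => i _; rewrite mulr_sumr; apply: eq_bigr => j _.
rewrite !mxE mulr_suml mulr_suml mulr_sumr; apply: eq_bigr => b _.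
rewrite mulr_sumr mulr_suml mulr_sumr; apply: eq_bigr => c _; rewrite !mxE; ring.
Qed.

Lemma contr_br12_23 s t : contr (br12_23 g s t) = tri g zeta (eta *m s) (xi *m t^T).
Proof.
rewrite /contr /tri dotpE exchange_big; apply: eq_bigr => b _; rewrite lbrE.
transitivity (\sum_a \sum_c \sum_i \sum_j
   (zeta 0 b * (eta 0 a * s a i) * (xi 0 c * t j c) * struct_const g i j b)).
  apply: eq_bigr => a _; apply: eq_bigr => c _; rewrite /br12_23 mulr_sumr.
  by apply: eq_bigr => i _; rewrite mulr_sumr; apply: eq_bigr => j _; ring.
rewrite sum_exch4 mulr_sumr; apply: eq_bigr => i _; rewrite mulr_sumr; apply: eq_bigr => j _.
rewrite !mxE mulr_suml mulr_suml mulr_sumr; apply: eq_bigr => a _.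
rewrite mulr_sumr mulr_suml mulr_sumr; apply: eq_bigr => c _; rewrite !mxE; ring.
Qed.

Lemma contr_br13_23 s t : contr (br13_23 g s t) = tri g xi (eta *m s) (zeta *m t).
Proof.
rewrite /contr /tri dotpE; under eq_bigr do rewrite exchange_big.
rewrite exchange_big; apply: eq_bigr => c _; rewrite lbrE.
transitivity (\sum_a \sum_b \sum_i \sum_j
   (xi 0 c * (eta 0 a * s a i) * (zeta 0 b * t b j) * struct_const g i j c)).
  apply: eq_bigr => a _; apply: eq_bigr => b _; rewrite /br13_23 mulr_sumr.
  by apply: eq_bigr => i _; rewrite mulr_sumr; apply: eq_bigr => j _; ring.
rewrite sum_exch4 mulr_sumr; apply: eq_bigr => i _; rewrite mulr_sumr; apply: eq_bigr => j _.
rewrite !mxE mulr_suml mulr_suml mulr_sumr; apply: eq_bigr => a _.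
by rewrite mulr_sumr mulr_suml mulr_sumr; apply: eq_bigr => b _; ring.
Qed.

(** This lemma and the next two treat the three terms of Alt(d_h r). *)
Lemma contr_1_23 (u : 'I_n -> C) (M : 'M[C]_n) :
  contr (fun a b c => u a * M b c) = (\sum_a eta 0 a * u a) * dotp (zeta *m M) xi.
Proof.
rewrite /contr dotp_mulmxE mulr_suml; apply: eq_bigr => a _.
rewrite mulr_sumr; apply: eq_bigr => b _; rewrite mulr_sumr; apply: eq_bigr => c _; ring.
Qed.

Lemma contr_2_31 (u : 'I_n -> C) (M : 'M[C]_n) :
  contr (fun a b c => u b * M c a) = (\sum_a zeta 0 a * u a) * dotp (xi *m M) eta.
Proof.
rewrite /contr dotp_mulmxE exchange_big mulr_suml; apply: eq_bigr => b _.
rewrite exchange_big mulr_sumr; apply: eq_bigr => c _; rewrite mulr_sumr; apply: eq_bigr => a _; ring.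
Qed.

Lemma contr_3_12 (u : 'I_n -> C) (M : 'M[C]_n) :
  contr (fun a b c => u c * M a b) = (\sum_a xi 0 a * u a) * dotp (eta *m M) zeta.
Proof.
rewrite /contr dotp_mulmxE; under eq_bigr do rewrite exchange_big.
rewrite exchange_big mulr_suml; apply: eq_bigr => c _.
rewrite mulr_sumr; apply: eq_bigr => a _; rewrite mulr_sumr; apply: eq_bigr => b _; ring.
Qed.
End Contr.
End Invariance.
End Contraction.

(** * The Yang-Baxter equation as identities between coefficients *)

Section MainIdentity.
Variable R : realType.
Local Notation C := (Cplx R).
Variables (m n : nat) (g : quadratic_lie_algebra R n) (h : abelian_subalgebra g m).
Variables (r : 'rV[C]_m -> C -> 'M[C]_n) (t : 'rV[C]_m -> nat -> 'M[C]_n).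
Hypothesis drm : dynamical_rmatrix h r t.
Local Notation rc := (rcoef g t).

Definition drmx (l : 'I_m) (q : 'rV[C]_m) (k : nat) : 'M[C]_n :=
  \matrix_(i, j) drcoef g t l q k i j.

(** The derivative at q, in the direction i^* eta of h^*, of the pairing of rc_N
    with zeta and xi. *)
Definition dh (q : 'rV[C]_m) (N : nat) (eta zeta xi : 'rV[C]_n) : C :=
  \sum_l dotp eta (row l h) * dotp (zeta *m drmx l q N) xi.

Lemma drmx_unitarity (q : 'rV[C]_m) l k : base r q ->
  (drmx l q k)^T = (-1) ^+ k *: drmx l q k.
Proof.
move=> bq; apply/matrixP => i j; rewrite !mxE.
have [hd _] := rcoef_derive drm bq.
have [e [B [f [b [[e0 _] _ _ hb _]]]]] := rcoef_local drm bq.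
have H : is_derive q (delta_mx 0 l) (fun q' => rc q' k j i) ((-1) ^+ k * drcoef g t l q k i j).
  apply: (@near_eq_is_derive _ _ _ (fun q' => (-1) ^+ k * rc q' k i j)).
  apply: (norm_near e0) => v /row_norm_lt /hb bv.
  by have /matrixP/(_ i j) := rcoef_unitarity drm k bv; rewrite !mxE.
by rewrite -(derive_val (is_derive := H)); have [_ ->] := hd l k j i.
Qed.

Lemma cdybe_vec (q : 'rV[C]_m) (eta zeta xi : 'rV[C]_n) (x : C) (N : nat) :
  base r q -> x != 0 -> x != 1 ->
  dh q N eta zeta xi + (- x)^-1 * (- x) ^+ N * dh q N zeta xi eta
  + (x - 1)^-1 * (x - 1) ^+ N * dh q N xi eta zeta
  + \sum_(k < N.+2) ((x - 1)^-1 * (x - 1) ^+ k) * (x^-1 * x ^+ (N.+1 - k)) *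
      tri g eta (zeta *m (rc q k)^T) (xi *m (rc q (N.+1 - k))^T)
  + \sum_(k < N.+2) ((x - 1)^-1 * (x - 1) ^+ k) *
      tri g zeta (eta *m rc q k) (xi *m (rc q (N.+1 - k))^T)
  + \sum_(k < N.+2) (x^-1 * x ^+ k) * tri g xi (eta *m rc q k) (zeta *m rc q (N.+1 - k)) = 0.
Proof.
move=> bq x0 x1.
have rowE u l : \sum_a (u : 'rV[C]_n) 0 a * h l a = dotp u (row l h).
  by rewrite dotpE; apply: eq_bigr => a _; rewrite mxE.
transitivity (contr eta zeta xi (fun _ _ _ => 0)); last first.
  rewrite /contr big1 // => a _; rewrite big1 // => b _; rewrite big1 // => c _; exact: mulr0.
rewrite -[RHS](eq_contr _ _ _ (fun a b c => cdybe_coef drm N a b c bq x0 x1)).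
do 5! rewrite contrD.
congr (_ + _ + _ + _ + _ + _); rewrite contr_sum.
- apply: eq_bigr => l _; rewrite -rowE -contr_1_23; apply: eq_contr => a b c; by rewrite mxE.
- rewrite mulr_sumr; apply: eq_bigr => l _; rewrite -rowE -contr_2_31 -contrZ.
  by apply: eq_contr => a b c; rewrite mxE [in RHS]mulrCA.
- rewrite mulr_sumr; apply: eq_bigr => l _; rewrite -rowE -contr_3_12 -contrZ.
  by apply: eq_contr => a b c; rewrite mxE [in RHS]mulrCA.
- by apply: eq_bigr => k _; rewrite contr_br12_13 !linearZ /= ?triZl ?triZr -[LHS]mulrA.
- by apply: eq_bigr => k _; rewrite contr_br12_23 -!scalemxAr triZl.
- by apply: eq_bigr => k _; rewrite contr_br13_23 -!scalemxAr triZl.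
Qed.

Lemma addr_congr (V : nmodType) (a b c d : V) : a = c -> b = d -> a + b = c + d.
Proof. by move=> -> ->. Qed.

(** The form of the Yang-Baxter equation that the Poisson property needs: there,
    eta and zeta will be the coefficients of degrees - a - 1 and - b - 1 of two
    elements of L g^*. Unitarity has been used to bring the transposes to this
    form, and the hypothesis of [laurent_coef_x] on P 0 + Q 0 is [tri_inv]. *)
Lemma main_identity (q : 'rV[C]_m) (eta zeta xi : 'rV[C]_n) (a b : nat) : base r q ->
  (if a == 0%N then dh q b.+1 eta zeta xi else 0)
  - (if b == 0%N then dh q a.+1 zeta eta xi else 0)
  + (-1) ^+ b * dh q (a + b).+1 xi eta zeta *+ 'C(a + b, b)
  + tri g eta (zeta *m casimir g) (xi *m (rc q (a + b).+2)^T)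
  + \sum_(k < (a + b).+2) (-1) ^+ (k + b).+1 *
      tri g eta (zeta *m rc q k.+1) (xi *m (rc q ((a + b).+1 - k))^T) *+ 'C(k, b)
  + \sum_(k < (a + b).+2) (-1) ^+ (k + a) *
      tri g zeta (eta *m rc q k.+1) (xi *m (rc q ((a + b).+1 - k))^T) *+ 'C(k, a)
  + tri g xi (eta *m rc q a.+1) (zeta *m rc q b.+1) = 0.
Proof.
move=> bq.
have := @laurent_coef_x R
  (fun k => tri g eta (zeta *m (rc q k)^T) (xi *m (rc q ((a + b).+2 - k))^T))
  (fun k => tri g zeta (eta *m rc q k) (xi *m (rc q ((a + b).+2 - k))^T))
  (fun k => tri g xi (eta *m rc q k) (zeta *m rc q ((a + b).+2 - k)))
  (dh q (a + b).+1 eta zeta xi) (dh q (a + b).+1 zeta xi eta) (dh q (a + b).+1 xi eta zeta) a b.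
rewrite /= casimir_sym tri_inv addNr => /(_ erefl) H.
rewrite -[RHS]H => [|x x0 x1]; last exact: cdybe_vec.
apply: addr_congr; last by have -> : ((a + b).+2 - a.+1 = b.+1)%N by lia.
apply: addr_congr; last by apply: eq_bigr => k _; rewrite subSS.
apply: addr_congr; last first.
  apply: eq_bigr => k _; rewrite (rcoef_unitarity drm k.+1 bq) -scalemxAr triZl subSS mulrA -exprD.
  by rewrite addnS [(b + k)%N]addnC.
apply: addr_congr; last by [].
apply: addr_congr; last by [].
apply: addr_congr.
  by case: (a =P 0%N) => [->|_].
case: (b =P 0%N) => [->|_]; last by rewrite oppr0.
rewrite addn0 /dh mulr_sumr -sumrN; apply: eq_bigr => l _.
rewrite [RHS]mulrCA [dotp (xi *m _) eta]dotp_mulmx drmx_unitarity // -scalemxAr dotpZr (dotpC xi).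
by rewrite [X in _ = _ * X]mulrA -exprD addnS exprS addnn -mul2n exprM sqrrN !expr1n mulr1 mulN1r mulrN.
Qed.
End MainIdentity.

(** * Loops, their pairing, and the operator R *)

Section Loops.
Variable R : realType.
Local Notation C := (Cplx R).

Lemma fsum_window (V : nmodType) (F : int -> V) (lo : int) (N : nat) :
  (forall k, k < lo -> F k = 0) -> (forall k, lo + N%:Z <= k -> F k = 0) ->
  \sum_(k \in [set: int]) F k = \sum_(u < N) F (lo + u%:Z).
Proof.
move=> Flo Fhi; pose A := [seq lo + u%:Z | u <- iota 0 N].
rewrite (@fsbigTE _ _ _ _ [fset k in A]%fset) => [|k].
  rewrite (perm_big A) /=; last first.
    apply: uniq_perm; rewrite ?fset_uniq //; last by move=> i; rewrite !inE.
    by rewrite map_inj_uniq ?iota_uniq // => i j /addrI [].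
  by rewrite big_map -(big_mkord xpredT (fun u => F (lo + u%:Z))) /index_iota subn0.
rewrite !inE => kA.
have [/Flo//|lok] := ltP k lo.
have [/Fhi//|kN] := leP (lo + N%:Z) k.
case/negP: kA; apply/mapP; exists `|k - lo|%N; first by rewrite mem_iota /=; lia.
by lia.
Qed.

Lemma fsum_nat (V : nmodType) (F : nat -> V) (N : nat) :
  (forall k, (N <= k)%N -> F k = 0) -> \sum_(k \in [set: nat]) F k = \sum_(u < N) F u.
Proof.
move=> FN; rewrite (@fsbigTE _ _ _ _ [fset u in iota 0 N]%fset) => [|k].
  rewrite (perm_big (iota 0 N)) /=; last first.
    by apply: uniq_perm; rewrite ?iota_uniq ?fset_uniq // => i; rewrite !inE.
  by rewrite -(big_mkord xpredT F) /index_iota subn0.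
by rewrite !inE mem_iota /= add0n -leqNgt => /FN.
Qed.

Variables (m n : nat) (g : quadratic_lie_algebra R n).
Variable t : 'rV[C]_m -> nat -> 'M[C]_n.
Implicit Types (al be x : loop R n).

(** Finiteness of the principal part with an explicit order, so that several loops
    can share the range of the finite sums to which the sums over int reduce. *)
Definition low (K : nat) al := forall k : int, k < - K%:Z -> al k = 0.

Lemma loop_pair_low K L al x : low K al -> low L x ->
  loop_pair al x = \sum_(u < K + L) dotp (al (L%:Z - 1 - u%:Z)) (x (u%:Z - L%:Z)).
Proof.
move=> hal hx; rewrite /loop_pair (@fsum_window _ _ (- L%:Z) (K + L)).
- apply: eq_bigr => u _; rewrite [- L%:Z + _]addrC; congr (dotp (al _) _); lia.
- by move=> k /hx ->; rewrite dotp0r.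
- move=> k kK; rewrite hal ?dotp0l //; lia.
Qed.

(** The scalar is the product (k + 1) ... (k + j). Divided by j!, it is a binomial
    coefficient if k >= 0, it is (- 1)^j if k + j = - 1, and it vanishes if
    k < 0 <= k + j. *)
Lemma iter_laurent_deriv (s : int -> 'M[C]_n) j k :
  iter j (@laurent_deriv R n) s k = (\prod_(i < j) (k + i.+1%:Z))%:~R *: s (k + j%:Z).
Proof.
elim: j k => [|j IH] k; first by rewrite big_ord0 /= scale1r addr0.
rewrite iterS /laurent_deriv IH scalerA -intrM big_ord_recl; congr (_%:~R *: s _); last by lia.
by congr (_ * _); apply: eq_bigr => i _; rewrite lift0; lia.
Qed.

Lemma prod_pos (k j : nat) : \prod_(i < j) (k%:Z + i.+1%:Z) = ('C(k + j, j) * j`!)%:Z.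
Proof.
elim: j => [|j IH]; first by rewrite big_ord0 bin0.
rewrite big_ord_recr /= IH -PoszD -PoszM; congr Posz.
have /= E := mul_bin_diag (k + j).+1 j.
by rewrite !addnS factS [LHS]mulnC mulnA E [RHS]mulnCA mulnA.
Qed.

Lemma prod_neg (b : nat) : \prod_(i < b) (- b.+1%:Z + i.+1%:Z) = ((-1) ^+ b * b`!%:Z).
Proof.
elim: b => [|b IH]; first by rewrite big_ord0 fact0 mulr1.
rewrite big_ord_recl /= (eq_bigr (fun i : 'I_b => - b.+1%:Z + i.+1%:Z)) => [|i _].
  by rewrite IH factS exprS PoszM; lia.
by rewrite /bump /=; lia.
Qed.

Lemma prod_neg0 (b j : nat) : (b < j)%N -> \prod_(i < j) (- b.+1%:Z + i.+1%:Z) = 0.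
Proof.
move=> bj; rewrite (bigD1 (Ordinal bj)) //= (_ : - b.+1%:Z + b.+1%:Z = 0) ?mul0r //; lia.
Qed.

Local Notation rc := (rcoef g t).

(** In negative degrees only the Casimir element contributes to the sum that defines
    R, and it turns 1/2 I into - 1/2 I. *)
Lemma Rop_neg q al (b : nat) :
  Rop g t q al (- b.+1%:Z) = - (2^-1 *: sharp g (al (- b.+1%:Z))).
Proof.
rewrite /Rop (@fsum_nat _ _ b.+1) => [|j bj]; last first.
  by rewrite /laurent_opp iter_laurent_deriv prod_neg0 // scale0r !(scaler0, mulmx0).
rewrite big_ord_recr big1 /= => [|j _]; last first.
  rewrite /laurent_opp iter_laurent_deriv (_ : - b.+1%:Z + j%:Z = Negz (b - j.+1).+1).
    by rewrite /= !(scaler0, mulmx0).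
  by rewrite NegzE; have := ltn_ord j; lia.
rewrite add0r /laurent_opp iter_laurent_deriv prod_neg (_ : - b.+1%:Z + b%:Z = Negz 0); last first.
  by rewrite NegzE; lia.
have E : (b`!%:R)^-1 * ((-1) ^ (- b.+1%:Z) * ((-1) ^+ b * b`!%:Z)%:~R) = -1 :> C.
  rewrite intrM rmorphXn /= rmorphN1 -NegzE /exprz invr_sign exprS -pmulrn.
  by rewrite mulN1r mulNr mulrA -expr2 sqrr_sign mul1r mulrN mulVf // pnatr_eq0 -lt0n fact_gt0.
rewrite /= -!scalemxAr !scalerA E /sharp /casimir.
rewrite -scalerDl -scaleNr; congr (_ *: _).
by field.
Qed.

Lemma Rop_pos q al K (k : nat) : low K al ->
  Rop g t q al k%:Z = 2^-1 *: sharp g (al k%:Z) +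
    \sum_(j < K) ((-1) ^+ k *+ 'C(k + j, j)) *: (al (- j.+1%:Z) *m rc q (k + j).+1).
Proof.
move=> hal; rewrite /Rop (@fsum_nat _ _ K) => [|j Kj]; last first.
  by rewrite hal ?mul0mx ?scaler0 //; lia.
congr (_ + _); apply: eq_bigr => j _.
rewrite /laurent_opp iter_laurent_deriv prod_pos -PoszD /= scalerA -scalemxAr scalerA; congr (_ *: _).
rewrite mulrCA -exprnP; rewrite -[RHS]mulr_natr; congr (_ * _).
by rewrite -pmulrn natrM mulrCA mulVf ?mulr1 // pnatr_eq0 -lt0n fact_gt0.
Qed.
End Loops.

(** * Coadjoint actions of loops paired with simple poles *)

Section LoopBrackets.
Variable R : realType.
Local Notation C := (Cplx R).
Variables (m n : nat) (g : quadratic_lie_algebra R n).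
Variable t : 'rV[C]_m -> nat -> 'M[C]_n.
Implicit Types (al be x : loop R n).
Local Notation rc := (rcoef g t).

Lemma loop_pair_low1 K al x : low K al -> low 1 x ->
  loop_pair al x = \sum_(b < K.+1) dotp (al (- b%:Z)) (x (b%:Z - 1)).
Proof.
move=> hal hx; rewrite (loop_pair_low hal hx) addn1; apply: eq_bigr => u _.
by congr (dotp (al _) _); lia.
Qed.

(** Both indices run over the window [-K, K], written u - K with a natural number u,
    so that exchanging the two loops amounts to exchanging u and v. *)
Lemma loop_pair_coad K X be x : low K X -> low K be -> low 1 x ->
  loop_pair (loop_coad g X be) x =
  \sum_(u < K.*2.+1) \sum_(v < K.*2.+1)
     tri g (be (- (v%:Z - K%:Z))) (X (- (u%:Z - K%:Z)))
           (x (v%:Z - K%:Z + (u%:Z - K%:Z) - 1)).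
Proof.
move=> hX hbe hx.
have hX' : low K.*2 (loop_coad g X be).
  move=> k kK; rewrite /loop_coad /loop_op fsbig1 // => i _.
  have [iK|Ki] := ltP i (- K%:Z); last by rewrite hbe ?/coad ?mul0mx //; lia.
  apply/rowP => j; rewrite -dotp_delta dotp_coad -/(tri g _ _ _) hX // tri0l mxE //.
rewrite (loop_pair_low1 hX' hx).
transitivity (\sum_(c < K.*2.+1) \sum_(u < K.*2.+1)
    tri g (be (- c%:Z - (- K%:Z + u%:Z))) (X (- K%:Z + u%:Z)) (x (c%:Z - 1))).
  apply: eq_bigr => c _; rewrite /loop_coad /loop_op (@fsum_window _ _ (- K%:Z) K.*2.+1).
  - by rewrite dotp_suml; apply: eq_bigr => u _; rewrite dotp_coad.
  - move=> i iK; apply/rowP => j; rewrite -dotp_delta dotp_coad -/(tri g _ _ _) hX // tri0l mxE //.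
  - move=> i iK; rewrite hbe ?/coad ?mul0mx //; lia.
rewrite exchange_big /= (reindex_inj rev_ord_inj) /=; apply: eq_bigr => u _.
pose G (b : int) := tri g (be (- b)) (X (- (u%:Z - K%:Z))) (x (b + (u%:Z - K%:Z) - 1)).
have uE : - K%:Z + (K.*2.+1 - u.+1)%N%:Z = - (u%:Z - K%:Z) by have := ltn_ord u; lia.
transitivity (\sum_(b \in [set: int]) G b); last first.
  rewrite (@fsum_window _ _ (- K%:Z) K.*2.+1).
  - by apply: eq_bigr => v _; rewrite /G [- K%:Z + v%:Z]addrC.
  - move=> b bK; rewrite /G hx ?tri0r //; have := ltn_ord u; lia.
  - move=> b bK; rewrite /G hbe ?tri0 //; lia.
rewrite (@fsum_window _ _ (- (u%:Z - K%:Z)) K.*2.+1).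
- apply: eq_bigr => c _; rewrite uE /G; congr (tri g (be _) _ (x _)); lia.
- move=> b bK; rewrite /G hx ?tri0r //; lia.
- move=> b bK; rewrite /G hbe ?tri0 //; have := ltn_ord u; lia.
Qed.

(** The part of R al in degree k >= 0 that does not come from 1/2 I. *)
Definition reg q al K (k : nat) : 'rV[C]_n :=
  \sum_(j < K) ((-1) ^+ k *+ 'C(k + j, j)) *: (al (- j.+1%:Z) *m rc q (k + j).+1).

Lemma Rop_low q al K : low K al -> low K (Rop g t q al).
Proof.
move=> hal k kK; have [j kE] : exists j : nat, k = - j.+1%:Z by exists (`|k| - 1)%N; lia.
by rewrite kE Rop_neg -kE hal // /sharp mul0mx scaler0 oppr0.
Qed.

Lemma sum_tail (V : nmodType) (F : nat -> V) (K L : nat) : (K <= L)%N ->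
  (forall u, (K <= u < L)%N -> F u = 0) -> \sum_(u < L) F u = \sum_(u < K) F u.
Proof.
move=> KL F0; rewrite -!(big_mkord xpredT F) (big_cat_nat (leq0n K) KL) /=.
by rewrite [X in _ + X]big1_seq ?addr0 // => u; rewrite mem_index_iota => /F0.
Qed.

(** The scalar in the first sum is that of 1/2 I in [Rop_pos] and [Rop_neg], in
    degree K - u. *)
Lemma Rop_pair_reg q K al be x : low K al -> low K be -> low 1 x ->
  loop_pair (loop_coad g (Rop g t q al) be) x =
  \sum_(u < K.*2.+1) \sum_(v < K.*2.+1)
     (if (u <= K)%N then 2^-1 else - 2^-1) *
     tri g (be (- (v%:Z - K%:Z))) (al (- (u%:Z - K%:Z)) *m casimir g)
           (x (v%:Z - K%:Z + (u%:Z - K%:Z) - 1))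
  + \sum_(b < K.+1) \sum_(i < b.+1) tri g (be (- b%:Z)) (reg q al K i) (x (b%:Z - i%:Z - 1)).
Proof.
move=> hal hbe hx; rewrite (@loop_pair_coad K) //; last exact: Rop_low.
pose E (u v : nat) : C := (if (u <= K)%N then 2^-1 else - 2^-1) *
     tri g (be (- (v%:Z - K%:Z))) (al (- (u%:Z - K%:Z)) *m casimir g)
           (x (v%:Z - K%:Z + (u%:Z - K%:Z) - 1)).
pose G (u v : nat) : C := if (u <= K)%N then
   tri g (be (- (v%:Z - K%:Z))) (reg q al K (K - u)) (x (v%:Z - K%:Z + (u%:Z - K%:Z) - 1)) else 0.
have EG u v : tri g (be (- (v%:Z - K%:Z))) (Rop g t q al (- (u%:Z - K%:Z)))
           (x (v%:Z - K%:Z + (u%:Z - K%:Z) - 1)) = E u v + G u v.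
  rewrite /E /G; case: leqP => uK.
    have -> : - (u%:Z - K%:Z) = (K - u)%N%:Z by lia.
    by rewrite (Rop_pos g t q _ hal) triDl triZl.
  have -> : - (u%:Z - K%:Z) = - (u - K.+1).+1%:Z by lia.
  by rewrite Rop_neg triNl triZl mulNr addr0.
under eq_bigr do (under eq_bigr do rewrite EG; rewrite big_split).
rewrite big_split; congr (_ + _).
rewrite exchange_big /=.
pose H (v i : nat) : C := tri g (be (- (v%:Z - K%:Z))) (reg q al K i) (x (v%:Z - K%:Z - i%:Z - 1)).
have H0 v i : (v < K + i)%N -> H v i = 0 by move=> vi; rewrite /H hx ?tri0r //; lia.
transitivity (\sum_(v < K.*2.+1) \sum_(i < K.+1) H v i).
  apply: eq_bigr => v _; rewrite (@sum_tail _ (fun u => G u v) K.+1); first last.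
  - by move=> u /andP[Ku _]; rewrite /G ifF //; apply/negbTE; rewrite -ltnNge.
  - by lia.
  rewrite (reindex_inj rev_ord_inj) /=; apply: eq_bigr => i _.
  have iK := ltn_ord i; have -> : (K.+1 - i.+1 = K - i)%N by lia.
  rewrite /G leq_subr subKn; last by rewrite -ltnS.
  congr (tri g _ _ (x _)); lia.
rewrite (reindex_inj rev_ord_inj) /= (@sum_tail _ (fun v => \sum_(i < K.+1) H (K.*2.+1 - v.+1)%N i) K.+1); first last.
- by move=> u /andP[Ku uK]; rewrite big1 // => i _; rewrite H0 //; lia.
- by lia.
rewrite (reindex_inj rev_ord_inj) /=; apply: eq_bigr => b _.
have bK := ltn_ord b.
have -> : (K.*2.+1 - (K.+1 - b.+1).+1 = K + b)%N by lia.
rewrite (@sum_tail _ (fun i => H (K + b)%N i) b.+1).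
- apply: eq_bigr => i _; rewrite /H; congr (tri g (be _) _ (x _)); lia.
- by [].
- by move=> i /andP[bi _]; rewrite H0 // ltn_add2l.
Qed.
End LoopBrackets.

(** * The skew-symmetrized pairing of R *)

Section RopSkew.
Variable R : realType.
Local Notation C := (Cplx R).
Variables (m n : nat) (g : quadratic_lie_algebra R n).
Variable t : 'rV[C]_m -> nat -> 'M[C]_n.
Implicit Types (al be x : loop R n).
Local Notation rc := (rcoef g t).

Lemma sum_shift (V : nmodType) (F : nat -> V) (K : nat) :
  (forall u, (u < K)%N -> F u = 0) -> \sum_(u < K.*2.+1) F u = \sum_(a < K.+1) F (K + a)%N.
Proof.
move=> F0; rewrite -(big_mkord xpredT F) -(big_mkord xpredT (fun a => F (K + a)%N)).
have KK : (K <= K.*2.+1)%N by lia.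
rewrite (big_cat_nat (leq0n K) KK) /= [X in X + _]big1_seq ?add0r => [|u].
  rewrite -{1}[K]add0n big_addn (_ : (K.*2.+1 - K = K.+1)%N); last by lia.
  by apply: eq_bigr => i _; rewrite addnC.
by rewrite mem_index_iota => /andP[_ /andP[_ /F0]].
Qed.

(** Minus the sum of the scalars of 1/2 I, as in [Rop_pos] and [Rop_neg], in the
    degrees - a and - b. *)
Definition hw (a b : nat) : C :=
  if (a == 0%N) && (b == 0%N) then -1 else if (0 < a)%N && (0 < b)%N then 1 else 0.

Lemma skew0 (V : zmodType) (x y : V) : y = x -> - x + y = 0.
Proof. by move=> ->; rewrite addNr. Qed.

Lemma skew_split (V : zmodType) (p1 p2 h1 h2 r1 r2 w : V) :
  p1 = h1 + r1 -> p2 = h2 + r2 -> - h1 + h2 = w -> - p1 + p2 = w - r1 + r2.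
Proof. by move=> -> -> <-; rewrite opprD addrACA addrA. Qed.

(** Invariance of the Casimir element brings the two contributions of 1/2 I to the
    same terms, where their scalars are added. Terms in which a coefficient of
    positive degree of al or be occurs drop out: either the scalars are opposite,
    or the coefficient of x has degree less than - 1. *)
Lemma Rop_skew_pair q K al be x : low K al -> low K be -> low 1 x ->
  - loop_pair (loop_coad g (Rop g t q al) be) x + loop_pair (loop_coad g (Rop g t q be) al) x =
  \sum_(a < K.+1) \sum_(b < K.+1)
    hw a b * tri g (be (- b%:Z)) (al (- a%:Z) *m casimir g) (x (a%:Z + b%:Z - 1))
  - \sum_(b < K.+1) \sum_(i < b.+1) tri g (be (- b%:Z)) (reg g t q al K i) (x (b%:Z - i%:Z - 1))
  + \sum_(a < K.+1) \sum_(i < a.+1) tri g (al (- a%:Z)) (reg g t q be K i) (x (a%:Z - i%:Z - 1)).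
Proof.
move=> hal hbe hx.
apply: (skew_split (Rop_pair_reg g t q hal hbe hx) (Rop_pair_reg g t q hbe hal hx)).
pose h (u : nat) : C := if (u <= K)%N then 2^-1 else - 2^-1.
pose G (u v : nat) := tri g (be (- (v%:Z - K%:Z))) (al (- (u%:Z - K%:Z)) *m casimir g)
           (x (v%:Z - K%:Z + (u%:Z - K%:Z) - 1)).
transitivity (- (\sum_(u < K.*2.+1) \sum_(v < K.*2.+1) h u * G u v) 
  + - (\sum_(u < K.*2.+1) \sum_(v < K.*2.+1) h v * G u v)).
  apply: addr_congr => //.
  rewrite exchange_big -sumrN; apply: eq_bigr => u _; rewrite -sumrN; apply: eq_bigr => v _.
  by rewrite /G tri_inv mulrN /h [_%:Z - _ + (_ - _)]addrC.
rewrite -opprD -big_split /=.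
transitivity (\sum_(u < K.*2.+1) \sum_(v < K.*2.+1) - (h u + h v) * G u v).
  rewrite -sumrN; apply: eq_bigr => u _; rewrite -big_split -sumrN; apply: eq_bigr => v _.
  by rewrite mulNr mulrDl.
have half1 : 2^-1 + 2^-1 = 1 :> C by rewrite -[2^-1]mul1r -splitr.
have F0 u v : (u < K)%N || (v < K)%N -> - (h u + h v) * G u v = 0.
  rewrite /h; case: (leqP u K) => uK; case: (leqP v K) => vK uv.
  - rewrite /G hx ?tri0r ?mulr0 //; lia.
  - by rewrite subrr oppr0 mul0r.
  - by rewrite addrC subrr oppr0 mul0r.
  - lia.
rewrite (@sum_shift _ (fun u => \sum_(v < K.*2.+1) - (h u + h v) * G u v)) => [|u uK]; last first.
  by rewrite big1 // => v _; rewrite F0 // uK.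
apply: eq_bigr => a _.
rewrite (@sum_shift _ (fun v => - (h (K + a)%N + h v) * G (K + a)%N v)) => [|v vK]; last first.
  by rewrite F0 // vK orbT.
apply: eq_bigr => b _.
have -> : G (K + a)%N (K + b)%N = tri g (be (- b%:Z)) (al (- a%:Z) *m casimir g) (x (a%:Z + b%:Z - 1)).
  rewrite /G; congr (tri g (be _) (al _ *m _) (x _)); lia.
congr (_ * _); rewrite /h /hw.
have gtK c : (K + c.+1 <= K)%N = false by lia.
case: (nat_of_ord a) => [|a'] /=; case: (nat_of_ord b) => [|b'] /=.
- by rewrite addn0 leqnn half1.
- by rewrite addn0 leqnn gtK subrr oppr0.
- by rewrite addn0 leqnn gtK addrC subrr oppr0.
- by rewrite !gtK -opprD half1 opprK.
Qed.

Lemma tri_reg q al K (k : nat) (eta Y : 'rV[C]_n) :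
  tri g eta (reg g t q al K k) Y =
  \sum_(j < K) (-1) ^+ k * tri g eta (al (- j.+1%:Z) *m rc q (k + j).+1) Y *+ 'C(k + j, j).
Proof.
by rewrite /reg tri_suml; apply: eq_bigr => j _; rewrite triZl mulrnAl.
Qed.
End RopSkew.

Section BracketIdentity.
Variable R : realType.
Local Notation C := (Cplx R).
Variables (m n : nat) (g : quadratic_lie_algebra R n) (h : abelian_subalgebra g m).
Variables (r : 'rV[C]_m -> C -> 'M[C]_n) (t : 'rV[C]_m -> nat -> 'M[C]_n).
Hypothesis drm : dynamical_rmatrix h r t.
Implicit Types (al be x : loop R n).
Local Notation rc := (rcoef g t).

Lemma r_minus_sharp_low q xi : low 1 (r_minus_sharp g t q xi).
Proof.
move=> k k1; rewrite /r_minus_sharp (_ : rlaurent g t q k = 0) ?trmx0 ?mulmx0 //.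
have -> : k = Negz (`|k| - 2).+1 by rewrite NegzE; lia.
by [].
Qed.

Lemma r_minus_sharpE q xi (b : nat) : r_minus_sharp g t q xi (b%:Z - 1) = xi *m (rc q b)^T.
Proof.
rewrite /r_minus_sharp; case: b => [|b] //.
by rewrite (_ : b.+1%:Z - 1 = b%:Z); last by lia.
Qed.

Lemma zero_weight_tri q u k eta Y : base r q ->
  tri g eta (u *m h) (Y *m (rc q k)^T) = - tri g Y (u *m h) (eta *m rc q k).
Proof.
move=> bq; have := rcoef_zero_weight drm u k bq.
rewrite /tri -!ad_mxE; move: (ad_mx g (u *m h)) => A /eqP; rewrite addr_eq0 => /eqP E.
rewrite -[X in dotp eta (_ *m X)]trmxK -dotp_mulmx -dotp_mulmx -mulmxA E.
by rewrite mulmxN mulmxA dotpNl dotpC.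
Qed.

Lemma const_loop_low (X : 'rV[C]_n) : low 1 (const_loop X).
Proof. by move=> k k1; rewrite /const_loop ifF //; apply/eqP; lia. Qed.

Lemma const_loop0 (X : 'rV[C]_n) (k : int) : k = 0 -> const_loop X k = X.
Proof. by move=> ->; rewrite /const_loop eqxx. Qed.

Lemma const_loopN0 (X : 'rV[C]_n) (k : int) : k <> 0 -> const_loop X k = 0.
Proof. by move=> /eqP/negbTE k0; rewrite /const_loop k0. Qed.

(** The terms of the bracket that contain the momentum p: the two sums are exchanged
    by zero weight followed by unitarity. *)
Lemma Rop_skew_pair_const q p K al be : base r q -> low K al -> low K be ->
  - loop_pair (loop_coad g (Rop g t q al) be) (const_loop (p *m h))
  + loop_pair (loop_coad g (Rop g t q be) al) (const_loop (p *m h)) = 0.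
Proof.
move=> bq hal hbe; rewrite (Rop_skew_pair g t q hal hbe (const_loop_low _)).
rewrite big1 ?add0r => [|a _]; last first.
  rewrite big1 // => b _; rewrite /hw.
  case: (nat_of_ord a) => [|a']; case: (nat_of_ord b) => [|b'] /=; rewrite ?mul0r //;
    by rewrite const_loopN0 ?tri0r ?mulr0 //; lia.
have E (al' be' : loop R n) : \sum_(b < K.+1) \sum_(i < b.+1)
     tri g (be' (- b%:Z)) (reg g t q al' K i) (const_loop (p *m h) (b%:Z - i%:Z - 1)) =
   \sum_(i < K) \sum_(j < K) (-1) ^+ i *
       tri g (be' (- i.+1%:Z)) (al' (- j.+1%:Z) *m rc q (i + j).+1) (p *m h) *+ 'C(i + j, j).
  rewrite big_ord_recl big1 ?add0r => [|i _]; last first.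
    by rewrite const_loopN0 ?tri0r //=; lia.
  apply: eq_bigr => i _; rewrite lift0 big_ord_recr big_ord_recr /=.
  rewrite [const_loop _ (i.+1%:Z - i.+1%:Z - 1)]const_loopN0; last by lia.
  rewrite [X in X + _ + _]big1 => [|i' _]; last first.
    by rewrite const_loopN0 ?tri0r //; have := ltn_ord i'; lia.
  rewrite tri0r const_loop0; last by lia.
  by rewrite tri_reg; move: (\sum_(j < K) _) => z; rewrite add0r addr0.
rewrite (E al be) (E be al); apply: skew0.
rewrite exchange_big; apply: eq_bigr => i _; apply: eq_bigr => j _.
have -> : (j + i = i + j)%N by rewrite addnC.
have -> : 'C(i + j, i) = 'C(i + j, j) by rewrite -(bin_sub (leq_addl i j)) addnK.
apply: (congr1 (fun z => z *+ _)).
move: (be _) (al _) => zeta eta.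
have := zero_weight_tri p (i + j).+1 zeta eta bq.
rewrite (rcoef_unitarity drm _ bq) -scalemxAr triZr triC [in RHS]triC opprK => <-.
have s2 : (-1) ^+ j * (-1) ^+ j = 1 :> C by rewrite -expr2 sqrr_sign.
by move: (tri _ _ _ _) => T; rewrite exprS exprD mulN1r mulrNN mulrA mulrCA s2 mulr1.
Qed.
End BracketIdentity.

(** * The bracket identity for two loops *)

Section BracketCore.
Variable R : realType.
Local Notation C := (Cplx R).
Variables (m n : nat) (g : quadratic_lie_algebra R n) (h : abelian_subalgebra g m).
Variables (r : 'rV[C]_m -> C -> 'M[C]_n) (t : 'rV[C]_m -> nat -> 'M[C]_n).
Hypothesis drm : dynamical_rmatrix h r t.
Implicit Types (al be x : loop R n).
Local Notation rc := (rcoef g t).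

Lemma sum_shiftn (V : nmodType) (F : nat -> V) (K L : nat) :
  (forall u, (u < K)%N -> F u = 0) -> \sum_(u < K + L) F u = \sum_(a < L) F (K + a)%N.
Proof.
by move=> F0; rewrite big_split_ord /= big1 ?add0r // => i _; rewrite F0.
Qed.

(** The contribution of [reg] to the pairing of [R al, r_-^# xi] with be, as far as
    it involves the coefficients of degree - a - 1 of al and - b - 1 of be. *)
Definition regterm q al be xi (a b : nat) : C :=
  \sum_(i < b.+2) (-1) ^+ i * tri g (be (- b.+1%:Z)) (al (- a.+1%:Z) *m rc q (i + a).+1)
      (xi *m (rc q (b.+1 - i))^T) *+ 'C(i + a, a).

Lemma reg_sum q al be K xi :
  \sum_(b < K.+1) \sum_(i < b.+1)
     tri g (be (- b%:Z)) (reg g t q al K i) (r_minus_sharp g t q xi (b%:Z - i%:Z - 1)) =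
  \sum_(a < K) tri g (be 0) (al (- a.+1%:Z) *m rc q a.+1) (xi *m casimir g)
  + \sum_(a < K) \sum_(b < K) regterm q al be xi a b.
Proof.
rewrite big_ord_recl; apply: addr_congr.
  rewrite big_ord_recl big_ord0 addr0 /= tri_reg; apply: eq_bigr => a _.
  rewrite (_ : 0%:Z - 0%:Z - 1 = 0%:Z - 1) // r_minus_sharpE /= casimir_sym.
  by rewrite mul1r add0n binn oppr0.
rewrite [RHS]exchange_big; apply: eq_bigr => b _; rewrite lift0 /regterm [RHS]exchange_big.
apply: eq_bigr => i _; have ib : (i <= b.+1)%N by rewrite -ltnS.
have -> : b.+1%:Z - i%:Z - 1 = (b.+1 - i)%N%:Z - 1 by lia.
by rewrite r_minus_sharpE tri_reg.
Qed.

Lemma skew_r q al be K xi : low K al -> low K be ->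
  - loop_pair (loop_coad g (Rop g t q al) be) (r_minus_sharp g t q xi)
  + loop_pair (loop_coad g (Rop g t q be) al) (r_minus_sharp g t q xi) =
  (- tri g (be 0) (al 0 *m casimir g) (xi *m casimir g)
   + \sum_(a < K) \sum_(b < K) tri g (be (- b.+1%:Z)) (al (- a.+1%:Z) *m casimir g) (xi *m (rc q (a + b).+2)^T))
  - (\sum_(a < K) tri g (be 0) (al (- a.+1%:Z) *m rc q a.+1) (xi *m casimir g)
     + \sum_(a < K) \sum_(b < K) regterm q al be xi a b)
  + (\sum_(b < K) tri g (al 0) (be (- b.+1%:Z) *m rc q b.+1) (xi *m casimir g)
     + \sum_(a < K) \sum_(b < K) regterm q be al xi b a).
Proof.
move=> hal hbe; rewrite (Rop_skew_pair g t q hal hbe (@r_minus_sharp_low _ _ _ g t q xi)).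
rewrite (reg_sum q al be) (reg_sum q be al) [X in _ = _ + (_ + X)]exchange_big.
apply: addr_congr => //; apply: addr_congr => //.
rewrite big_ord_recl; apply: addr_congr.
  rewrite big_ord_recl [X in _ + X]big1 => [|b _]; last by rewrite /hw /= mul0r.
  rewrite addr0 /hw /= mulN1r oppr0.
  by rewrite (_ : 0%:Z + 0%:Z - 1 = 0%:Z - 1) // r_minus_sharpE /= casimir_sym.
apply: eq_bigr => a _; rewrite big_ord_recl [X in X + _](_ : _ = 0); last by rewrite /hw /= mul0r.
rewrite add0r; apply: eq_bigr => b _; rewrite !lift0 /hw /= mul1r.
have -> : a.+1%:Z + b.+1%:Z - 1 = (a + b).+2%:Z - 1 by lia.
by rewrite r_minus_sharpE.
Qed.

Lemma drmx0 l q : drmx g t l q 0 = 0.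
Proof. by apply/matrixP => i j; rewrite !mxE /drcoef /= derive_cst. Qed.

Lemma dh0 q eta zeta xi : dh h t q 0 eta zeta xi = 0.
Proof. by rewrite /dh big1 // => l _; rewrite drmx0 mulmx0 dotp0l mulr0. Qed.

Lemma dh_0l q N zeta xi : dh h t q N 0 zeta xi = 0.
Proof. by rewrite /dh big1 // => l _; rewrite dotp0l mul0r. Qed.

Lemma pick_first (V : nmodType) (K : nat) (F : nat -> V) :
  (K = 0%N -> F 0%N = 0) -> \sum_(a < K) (if a == 0%N :> nat then F a else 0) = F 0%N.
Proof.
case: K => [->//|K _]; first by rewrite big_ord0.
by rewrite big_ord_recl big1 ?addr0.
Qed.

Lemma dsumD (K : nat) (F G : 'I_K -> 'I_K -> C) :
  \sum_a \sum_b (F a b + G a b) = \sum_a \sum_b F a b + \sum_a \sum_b G a b.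
Proof. by rewrite -big_split; apply: eq_bigr => a _; rewrite -big_split. Qed.

Lemma dsumN (K : nat) (F : 'I_K -> 'I_K -> C) :
  \sum_a \sum_b (- F a b) = - \sum_a \sum_b F a b.
Proof. by rewrite -sumrN; apply: eq_bigr => a _; rewrite -sumrN. Qed.

(** This lemma and the next are the arithmetic of [bracket_core], with the sums as
    atoms. *)
Lemma bracket_core_term (d1 d2 x1 x3 hf r1 r2 s : C) :
  d1 - d2 + x3 + x1 - r2 + r1 + s = 0 -> hf = - x1 ->
  d1 - d2 + s = - x3 + hf - r1 + r2.
Proof.
move=> H ->; have -> : s = - (d1 - d2 + x3 + x1 - r2 + r1) by apply/eqP; rewrite -addr_eq0 addrC H.
ring.
Qed.

Lemma bracket_core_sum (D1 D2 T3 T4 H R1 R2 s00 S1 S2 : C) :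
  D1 - D2 + T3 = - T4 + H - R1 + R2 ->
  D1 - D2 + (- s00 + S2 + (- S1 + T3)) = - T4 + ((- s00 + H) - (S1 + R1) + (S2 + R2)).
Proof.
move=> E; have -> : T3 = - T4 + H - R1 + R2 - D1 + D2 by rewrite -E; ring.
ring.
Qed.

(** The part of the Poisson property that is bilinear in the loops al and be. On
    the left is the bracket on the source; on the right are d<R al, be> and the
    pairing of the coadjoint terms with r_-^# xi. *)
Lemma bracket_core q al be K xi : base r q -> low K al -> low K be ->
  \sum_(b < K.+1) dh h t q b (al (- 1)) (be (- b%:Z)) xi
  - \sum_(a < K.+1) dh h t q a (be (- 1)) (al (- a%:Z)) xi
  + tri g xi (\sum_(a < K.+1) al (- a%:Z) *m rc q a) (\sum_(b < K.+1) be (- b%:Z) *m rc q b) =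
  - (\sum_(a < K) \sum_(b < K) (-1) ^+ b * dh h t q (a + b).+1 xi (al (- a.+1%:Z)) (be (- b.+1%:Z)) *+ 'C(a + b, b))
  + (- loop_pair (loop_coad g (Rop g t q al) be) (r_minus_sharp g t q xi)
     + loop_pair (loop_coad g (Rop g t q be) al) (r_minus_sharp g t q xi)).
Proof.
move=> bq hal hbe; rewrite (skew_r q xi hal hbe).
(* j^* al involves al_(-1) only, which is al_(-a-1) for a = 0; and the derivative
   of rc_0 vanishes. *)
have E1 (al' be' : loop R n) : low K al' ->
    \sum_(b < K.+1) dh h t q b (al' (- 1)) (be' (- b%:Z)) xi =
    \sum_(a < K) \sum_(b < K) (if a == 0%N :> nat then dh h t q b.+1 (al' (- a.+1%:Z)) (be' (- b.+1%:Z)) xi else 0).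
  move=> hal'; rewrite big_ord_recl dh0 add0r [RHS]exchange_big; apply: eq_bigr => b _; rewrite lift0.
  rewrite (@pick_first _ K (fun a => dh h t q b.+1 (al' (- a.+1%:Z)) (be' (- b.+1%:Z)) xi)) // => K0.
  by rewrite hal' ?dh_0l // K0.
have E2 := E1 be al hbe; rewrite [RHS]exchange_big in E2; rewrite (E1 al be hal) E2.
have E3 : tri g xi (\sum_(a < K.+1) al (- a%:Z) *m rc q a) (\sum_(b < K.+1) be (- b%:Z) *m rc q b) =
   tri g xi (al 0 *m casimir g) (be 0 *m casimir g)
   + \sum_(b < K) tri g xi (al 0 *m casimir g) (be (- b.+1%:Z) *m rc q b.+1)
   + (\sum_(a < K) tri g xi (al (- a.+1%:Z) *m rc q a.+1) (be 0 *m casimir g)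
   + \sum_(a < K) \sum_(b < K) tri g xi (al (- a.+1%:Z) *m rc q a.+1) (be (- b.+1%:Z) *m rc q b.+1)).
  rewrite !big_ord_recl /= oppr0 triDl !triDr tri_sumr tri_suml tri_suml -big_split.
  apply: addr_congr => //; rewrite -big_split; apply: eq_bigr => a _.
  by rewrite tri_sumr.
rewrite E3.
have c00 : tri g xi (al 0 *m casimir g) (be 0 *m casimir g) =
    - tri g (be 0) (al 0 *m casimir g) (xi *m casimir g).
  by rewrite triC tri_inv opprK triC.
have c0b (b : 'I_K) : tri g xi (al 0 *m casimir g) (be (- b.+1%:Z) *m rc q b.+1) =
    tri g (al 0) (be (- b.+1%:Z) *m rc q b.+1) (xi *m casimir g).
  by rewrite tri_inv triC opprK.
have ca0 (a : 'I_K) : tri g xi (al (- a.+1%:Z) *m rc q a.+1) (be 0 *m casimir g) =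
    - tri g (be 0) (al (- a.+1%:Z) *m rc q a.+1) (xi *m casimir g).
  by rewrite triC tri_inv opprK triC.
rewrite c00 (eq_bigr _ (fun b _ => c0b b)) (eq_bigr _ (fun a _ => ca0 a)) sumrN.
have main (a b : 'I_K) : 
  (if a == 0%N :> nat then dh h t q b.+1 (al (- a.+1%:Z)) (be (- b.+1%:Z)) xi else 0)
  - (if b == 0%N :> nat then dh h t q a.+1 (be (- b.+1%:Z)) (al (- a.+1%:Z)) xi else 0)
  + tri g xi (al (- a.+1%:Z) *m rc q a.+1) (be (- b.+1%:Z) *m rc q b.+1) =
  - ((-1) ^+ b * dh h t q (a + b).+1 xi (al (- a.+1%:Z)) (be (- b.+1%:Z)) *+ 'C(a + b, b))
  + tri g (be (- b.+1%:Z)) (al (- a.+1%:Z) *m casimir g) (xi *m (rc q (a + b).+2)^T)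
  - regterm q al be xi a b + regterm q be al xi b a.
  (* The sums in [main_identity] start at k = a, resp. k = b, because of the
     binomial coefficients. *)
  have R1 : regterm q al be xi a b = \sum_(k < (a + b).+2) (-1) ^+ (k + a) *
      tri g (be (- b.+1%:Z)) (al (- a.+1%:Z) *m rc q k.+1) (xi *m (rc q ((a + b).+1 - k))^T) *+ 'C(k, a).
    rewrite -[(a + b).+2]/((a + b).+2)%N -!addnS (@sum_shiftn _ (fun k => (-1) ^+ (k + a) *
      tri g (be (- b.+1%:Z)) (al (- a.+1%:Z) *m rc q k.+1) (xi *m (rc q (a + b.+1 - k))^T) *+ 'C(k, a))).
      apply: eq_bigr => i _; rewrite subnDl [(i + a)%N]addnC; congr (_ * _ *+ _).
      by rewrite addnC addnA addnn exprD -mul2n exprM sqrrN !expr1n mul1r.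
    by move=> u ua; rewrite bin_small // mulr0n.
  have R2 : regterm q be al xi b a = - \sum_(k < (a + b).+2) (-1) ^+ (k + b).+1 *
      tri g (al (- a.+1%:Z)) (be (- b.+1%:Z) *m rc q k.+1) (xi *m (rc q ((a + b).+1 - k))^T) *+ 'C(k, b).
    rewrite -sumrN [(a + b)%N]addnC -!addnS (@sum_shiftn _ (fun k => - ((-1) ^+ (k + b).+1 *
      tri g (al (- a.+1%:Z)) (be (- b.+1%:Z) *m rc q k.+1) (xi *m (rc q (b + a.+1 - k))^T) *+ 'C(k, b)))).
      apply: eq_bigr => i _; rewrite subnDl [(i + b)%N]addnC exprS mulN1r mulNr mulNrn opprK.
      congr (_ * _ *+ _); by rewrite addnC addnA addnn exprD -mul2n exprM sqrrN !expr1n mul1r.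
    by move=> u ub; rewrite bin_small // mulr0n oppr0.
  have H := main_identity drm (al (- a.+1%:Z)) (be (- b.+1%:Z)) xi a b bq.
  rewrite -R1 (canRL (@opprK _) (esym R2)) in H.
  exact: bracket_core_term H (tri_inv _ _ _ _).
apply: bracket_core_sum.
rewrite -!dsumN -!dsumD; apply: eq_bigr => a _; apply: eq_bigr => b _; exact: main.
Qed.
End BracketCore.

(** * The two Poisson brackets *)

Section FullBracket.
Variable R : realType.
Local Notation C := (Cplx R).
Variables (m n : nat) (g : quadratic_lie_algebra R n) (h : abelian_subalgebra g m).
Variables (r : 'rV[C]_m -> C -> 'M[C]_n) (t : 'rV[C]_m -> nat -> 'M[C]_n).
Hypothesis drm : dynamical_rmatrix h r t.
Implicit Types (al be : loop R n).
Local Notation rc := (rcoef g t).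

Lemma is_derive_fsum (V : normedModType C) (I : Type) (s : seq I) (F : I -> V -> C) (dF : I -> C) (x v : V) :
  (forall i, is_derive x v (F i) (dF i)) ->
  is_derive x v (fun y => \sum_(i <- s) F i y) (\sum_(i <- s) dF i).
Proof.
move=> hF; elim: s => [|i s IH].
  have -> : (fun y => \sum_(i <- [::]) F i y) = cst (0 : C) by apply/funext => y; rewrite big_nil.
  rewrite big_nil; exact: is_derive_cst.
have -> : (fun y => \sum_(j <- i :: s) F j y) = F i + (fun y => \sum_(j <- s) F j y).
  by apply/funext => y; rewrite big_cons.
rewrite big_cons; exact: is_deriveD.
Qed.

Lemma is_deriveZl (V : normedModType C) (F : V -> C) (dF k : C) (x v : V) :
  is_derive x v F dF -> is_derive x v (fun y => k * F y) (k * dF).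
Proof. by move=> hF; exact: (@is_deriveZ _ _ _ F k x v dF hF). Qed.

Lemma dotp_rc_derive (q : 'rV[C]_m) l k eta zeta : base r q ->
  is_derive q (delta_mx 0 l) (fun q' => dotp (eta *m rc q' k) zeta) (dotp (eta *m drmx g t l q k) zeta).
Proof.
move=> bq; have [hd _] := rcoef_derive drm bq.
have -> : (fun q' => dotp (eta *m rc q' k) zeta) =
    (fun q' => \sum_i \sum_j eta 0 i * zeta 0 j * rc q' k i j).
  by apply/funext => q'; rewrite dotp_mulmxE.
rewrite dotp_mulmxE; apply: is_derive_fsum => i; apply: is_derive_fsum => j.
by apply: is_deriveZl; rewrite mxE; exact: hd.
Qed.

(** The dependence of <R al, be> on q is only through [reg]. *)
Lemma loop_pair_Rop al be K : low K al -> low K be -> exists c0 : C, forall q,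
  loop_pair be (Rop g t q al) = c0 +
    \sum_(a < K) \sum_(b < K) (-1) ^+ b *+ 'C(a + b, b) *
       dotp (al (- a.+1%:Z) *m rc q (a + b).+1) (be (- b.+1%:Z)).
Proof.
move=> hal hbe.
pose F q (u : nat) := dotp (be (K%:Z - 1 - u%:Z)) (Rop g t q al (u%:Z - K%:Z)).
exists (\sum_(u < K) F 0 u + \sum_(b < K) dotp (be (- b.+1%:Z)) (2^-1 *: sharp g (al b%:Z))) => q.
rewrite (loop_pair_low hbe (Rop_low g t q hal)) big_split_ord /= -addrA.
apply: addr_congr.
  apply: eq_bigr => u _; rewrite /F /=.
  have -> : u%:Z - K%:Z = - (K - u.+1).+1%:Z by have := ltn_ord u; lia.
  by rewrite !Rop_neg.
rewrite [X in _ = _ + X]exchange_big -big_split; apply: eq_bigr => b _ /=.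
have -> : (K + b)%N%:Z - K%:Z = b%:Z by lia.
have -> : K%:Z - 1 - (K + b)%N%:Z = - b.+1%:Z by lia.
rewrite (Rop_pos g t q b hal) dotpDr; apply: addr_congr => //.
rewrite dotp_sumr; apply: eq_bigr => a _; rewrite dotpZr dotpC.
have -> : 'C(b + a, a) = 'C(a + b, b) by rewrite addnC -(bin_sub (leq_addr b a)) addKn.
by rewrite [(b + a)%N]addnC.
Qed.

Lemma loop_pair_Rop_derive q l al be K : base r q -> low K al -> low K be ->
  dq (fun q' => loop_pair be (Rop g t q' al)) l q =
    \sum_(a < K) \sum_(b < K) (-1) ^+ b *+ 'C(a + b, b) *
       dotp (al (- a.+1%:Z) *m drmx g t l q (a + b).+1) (be (- b.+1%:Z)).
Proof.
move=> bq hal hbe; have [c0 hc] := loop_pair_Rop hal hbe.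
have -> : (fun q' => loop_pair be (Rop g t q' al)) = cst c0 +
    (fun q => \sum_(a < K) \sum_(b < K) (-1) ^+ b *+ 'C(a + b, b) *
       dotp (al (- a.+1%:Z) *m rc q (a + b).+1) (be (- b.+1%:Z))).
  by apply/funext => q'; exact: hc.
rewrite /dq; set S := (X in _ = X).
have H : is_derive q (delta_mx 0 l) (fun q => \sum_(a < K) \sum_(b < K) (-1) ^+ b *+ 'C(a + b, b) *
       dotp (al (- a.+1%:Z) *m rc q (a + b).+1) (be (- b.+1%:Z))) S.
  apply: is_derive_fsum => a; apply: is_derive_fsum => b; apply: is_deriveZl.
  exact: dotp_rc_derive.
have H2 := is_deriveD (is_derive_cst c0 q (delta_mx 0 l)) H.
by rewrite (derive_val (is_derive := H2)) add0r.
Qed.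

Lemma loop_coad_low K X be : low K X -> low K be -> low K.*2 (loop_coad g X be).
Proof.
move=> hX hbe k kK; rewrite /loop_coad /loop_op fsbig1 // => i _.
have [iK|Ki] := ltP i (- K%:Z); last by rewrite hbe ?/coad ?mul0mx //; lia.
apply/rowP => j; rewrite -dotp_delta dotp_coad -/(tri g _ _ _) hX // tri0l mxE //.
Qed.

Lemma const_loop_low0 K (X : 'rV[C]_n) : low K (const_loop X).
Proof. by move=> k k1; rewrite const_loopN0 //; lia. Qed.

Lemma loop_coad_const X be k : loop_coad g (const_loop X) be k = coad g X (be k).
Proof.
rewrite /loop_coad /loop_op (@fsum_window _ _ 0 1) => [|i i0|i i1].
- by rewrite big_ord1 /= const_loop0 // subr0.
- rewrite const_loopN0; last by lia.
  by apply/rowP => j; rewrite -dotp_delta dotp_coad -/(tri g _ _ _) tri0l mxE.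
- rewrite const_loopN0; last by lia.
  by apply/rowP => j; rewrite -dotp_delta dotp_coad -/(tri g _ _ _) tri0l mxE.
Qed.

Lemma loop_pair_const K X be (x : loop R n) : low K be -> low 1 x ->
  loop_pair (loop_coad g (const_loop X) be) x = \sum_(b < K.+1) tri g (be (- b%:Z)) X (x (b%:Z - 1)).
Proof.
move=> hbe hx; rewrite (@loop_pair_low1 _ _ K) //; last first.
  by move=> k kK; rewrite loop_coad_const hbe // /coad mul0mx.
by apply: eq_bigr => b _; rewrite loop_coad_const dotp_coad.
Qed.

Lemma loop_pairDr K al (x y : loop R n) : low K al -> low 1 x -> low 1 y ->
  loop_pair al (fun k => x k + y k) = loop_pair al x + loop_pair al y.
Proof.
move=> hal hx hy; rewrite !(@loop_pair_low1 _ _ K) //; last first.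
  by move=> k k1; rewrite hx // hy // addr0.
by rewrite -big_split; apply: eq_bigr => b _; rewrite dotpDr.
Qed.

Lemma loop_pair4 K (a1 a2 a3 a4 x : loop R n) : low K a1 -> low K a2 -> low K a3 -> low K a4 -> low 1 x ->
  loop_pair (fun k => a1 k - a2 k - a3 k + a4 k) x =
  loop_pair a1 x - loop_pair a2 x - loop_pair a3 x + loop_pair a4 x.
Proof.
move=> h1 h2 h3 h4 hx; rewrite !(@loop_pair_low1 _ _ K) //; last first.
  by move=> k k1; rewrite h1 // h2 // h3 // h4 // !subr0 addr0.
by rewrite -!sumrB -big_split; apply: eq_bigr => b _; rewrite !dotpDl !dotpNl.
Qed.

(** The adjoint of r_-^#: the pairing of al with r_-^# xi is the pairing of this
    element of g with xi. *)
Definition rsharp_adj q K al : 'rV[C]_n := \sum_(a < K.+1) al (- a%:Z) *m rc q a.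
(** The differential of <rsharp_adj, xi> with respect to q. *)
Definition drsharp q K al xi : 'rV[C]_m :=
  \row_l \sum_(a < K.+1) dotp (al (- a%:Z) *m drmx g t l q a) xi.

Lemma dotp_jstar al (w : 'rV[C]_m) : dotp (jstar h al) w = \sum_l dotp (al (- 1)) (row l h) * w 0 l.
Proof.
rewrite dotpE; apply: eq_bigr => l _; congr (_ * _).
by rewrite /jstar mxE dotpE; apply: eq_bigr => i _; rewrite !mxE.
Qed.

Lemma dotp_jstar_drsharp q K al be xi :
  dotp (jstar h al) (drsharp q K be xi) = \sum_(b < K.+1) dh h t q b (al (- 1)) (be (- b%:Z)) xi.
Proof.
rewrite dotp_jstar /dh exchange_big; apply: eq_bigr => l _.
by rewrite mxE mulr_sumr.
Qed.

Lemma const_pair_rsharp q K U al xi : base r q -> low K al ->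
  loop_pair (loop_coad g (const_loop (U *m h)) al) (r_minus_sharp g t q xi) =
  - tri g xi (U *m h) (rsharp_adj q K al).
Proof.
move=> bq hal; rewrite (loop_pair_const _ hal (@r_minus_sharp_low _ _ _ g t q xi)).
rewrite /rsharp_adj tri_sumr -sumrN; apply: eq_bigr => b _.
by rewrite r_minus_sharpE (zero_weight_tri drm).
Qed.

Lemma const_pair_const K U p al : low K al ->
  loop_pair (loop_coad g (const_loop (U *m h)) al) (const_loop (p *m h)) = 0.
Proof.
move=> hal; rewrite (loop_pair_const _ hal (const_loop_low _)) big1 // => b _.
rewrite /const_loop; case: ifP => _; last exact: tri0r.
by rewrite /tri incl_abelian dotp0r.
Qed.

(** The arithmetic of [bracket_full]: [uv], [uB], [vA], [AB] are the terms of
    [tri_expand], [D] is d<R al, be> and [s] the pairing of the coadjoint terms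
    with r_-^# xi. *)
Lemma bracket_alg (j1 j2 j3 j4 uv uB vA AB D s T : C) :
  uv = 0 -> j2 - j4 + AB = - D + s -> T = - D + (- uB + vA + s) ->
  (j1 + j2) - (j3 + j4) + (uv - uB + vA + AB) = j1 - j3 + T.
Proof.
move=> -> E ->; have -> : s = j2 - j4 + AB + D by rewrite E; ring.
ring.
Qed.

Lemma bracket_alg2 (uB vA P1 P2 P3 P4 p1 p2 p3 p4 q1 q2 q3 q4 : C) :
  P1 = p1 + q1 -> P2 = p2 + q2 -> P3 = p3 + q3 -> P4 = p4 + q4 ->
  p1 = 0 -> p2 = 0 -> q1 = - uB -> q2 = - vA -> - p3 + p4 = 0 ->
  P1 - P2 - P3 + P4 = - uB + vA + (- q3 + q4).
Proof.
move=> -> -> -> -> -> -> -> -> E; have -> : p4 = p3 by apply/eqP; rewrite -subr_eq0 addrC E.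
ring.
Qed.

Lemma tri_expand xi U V A B :
  tri g xi (- U + A) (- V + B) = tri g xi U V - tri g xi U B + tri g xi V A + tri g xi A B.
Proof.
by rewrite triDl !triDr !triNl !triNr opprK (triC g xi V A) addrA.
Qed.

(** The bracket on the left is that of the differentials of F o rho and G o rho as
    given by [rho_source_diff], when F and G have the differentials
    (a, (u, al)) and (b, (v, be)). *)
Lemma bracket_full q p xi a b u v K al be : base r q -> low K al -> low K be ->
  dotp (jstar h al) (b + drsharp q K be xi) - dotp (jstar h be) (a + drsharp q K al xi)
  + dotp xi (lbr g (- (u *m h) + rsharp_adj q K al) (- (v *m h) + rsharp_adj q K be)) =
  target_bracket h t (rho h t (q, (p, xi))) (a, (u, al)) (b, (v, be)).
Proof.
move=> bq hal hbe; rewrite !dotpDr !dotp_jstar_drsharp -/(tri g _ _ _) tri_expand.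
rewrite /target_bracket /lie_poisson /rho /=.
apply: bracket_alg; first by rewrite /tri incl_abelian dotp0r.
  exact: (bracket_core drm xi bq hal hbe).
rewrite /target_pair /=; apply: addr_congr.
  rewrite dotpNl; apply: (congr1 -%R).
  transitivity (\sum_l dotp xi (row l h) * \sum_(a' < K) \sum_(b' < K) (-1) ^+ b' *+ 'C(a' + b', b') *
       dotp (al (- a'.+1%:Z) *m drmx g t l q (a' + b').+1) (be (- b'.+1%:Z))).
    rewrite dotpE; apply: eq_bigr => l _; rewrite [X in _ * X]mxE (loop_pair_Rop_derive _ bq hal hbe).
    by congr (_ * _); rewrite mxE dotpE; apply: eq_bigr => i _; rewrite !mxE.
  transitivity (\sum_(a' < K) \sum_l \sum_(b' < K) dotp xi (row l h) * ((-1) ^+ b' *+ 'C(a' + b', b') *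
       dotp (al (- a'.+1%:Z) *m drmx g t l q (a' + b').+1) (be (- b'.+1%:Z)))).
    rewrite [RHS]exchange_big; apply: eq_bigr => l _; rewrite [LHS]mulr_sumr.
    by apply: eq_bigr => a' _; rewrite [LHS]mulr_sumr.
  apply: eq_bigr => a' _; rewrite [LHS]exchange_big; apply: eq_bigr => b' _.
  by rewrite -mulrnAl /dh [RHS]mulr_sumr; apply: eq_bigr => l _; rewrite [LHS]mulrCA.
have hx1 := @const_loop_low _ _ (p *m h); have hx2 := @r_minus_sharp_low _ _ _ g t q xi.
have hx : low 1 (fun k => const_loop (p *m h) k + r_minus_sharp g t q xi k).
  by move=> k k1; rewrite hx1 // hx2 // addr0.
have l1 := loop_coad_low (@const_loop_low0 K (u *m h)) hbe.
have l2 := loop_coad_low (@const_loop_low0 K (v *m h)) hal.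
have l3 := loop_coad_low (Rop_low g t q hal) hbe.
have l4 := loop_coad_low (Rop_low g t q hbe) hal.
apply: etrans (loop_pair4 l1 l2 l3 l4 hx) _.
exact: (bracket_alg2 (loop_pairDr l1 hx1 hx2) (loop_pairDr l2 hx1 hx2) (loop_pairDr l3 hx1 hx2)
  (loop_pairDr l4 hx1 hx2) (const_pair_const u p hbe) (const_pair_const v p hal)
  (const_pair_rsharp u xi bq hbe) (const_pair_rsharp v xi bq hal)
  (Rop_skew_pair_const drm p bq hal hbe)).
Qed.
End FullBracket.

(** * Differentiation in linear coordinates of the source *)

Section Poisson.
Variable R : realType.
Local Notation C := (Cplx R).
Variables (m n : nat) (g : quadratic_lie_algebra R n) (h : abelian_subalgebra g m).
Variables (r : 'rV[C]_m -> C -> 'M[C]_n) (t : 'rV[C]_m -> nat -> 'M[C]_n).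
Hypothesis drm : dynamical_rmatrix h r t.
Local Notation rc := (rcoef g t).

Lemma holo_shift (N : nat) (F : 'rV[C]_N -> C) p : holo_at F p -> holo_at (fun y => F (p + y)) 0.
Proof.
move=> [a [e [M [e0 aM hF]]]]; exists a, e, M; split; [exact: e0|exact: aM|] => v ve.
by rewrite add0r; exact: hF.
Qed.

Lemma holo_affine (N : nat) (c : C) (i : 'I_N) (p : 'rV[C]_N) : holo_at (fun s => c + s 0 i) p.
Proof. by apply: holoD; [exact: holo_cst|exact: holo_coord]. Qed.

(** Holomorphic families are parametrized by row vectors. *)
Definition vec (s : 'rV[C]_(m + (m + n))) : source R m n :=
  (lsubmx s, (lsubmx (rsubmx s), rsubmx (rsubmx s))).
Definition unvec (y : source R m n) : 'rV[C]_(m + (m + n)) := row_mx y.1 (row_mx y.2.1 y.2.2).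

Lemma unvecK : cancel unvec vec.
Proof. by move=> [q [p xi]]; rewrite /vec /unvec /= !row_mxKr !row_mxKl. Qed.

Lemma unvec_linear : linear unvec.
Proof.
move=> k [q [p xi]] [q' [p' xi']]; rewrite /unvec /=.
by rewrite !scale_row_mx !add_row_mx.
Qed.

HB.instance Definition _ :=
  GRing.isLinear.Build C (source R m n) 'rV[C]_(m + (m + n)) *:%R unvec unvec_linear.

Lemma unvecZ k y : unvec (k *: y) = k *: unvec y.
Proof. by rewrite /unvec !scale_row_mx. Qed.

Lemma prod_norm_ge (V W : normedModType C) (y : V * W) : `|y.1| <= `|y| /\ `|y.2| <= `|y|.
Proof.
rewrite prod_normE /Order.max; case: ifP => [/ltW //|h12]; split=> //.
by rewrite real_leNgt ?normr_real // h12.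
Qed.

Lemma unvec_norm y : `|unvec y| <= `|y|.
Proof.
have [h1 h2] := prod_norm_ge y; have [h3 h4] := prod_norm_ge y.2.
apply: mx_norm_le => // i j; rewrite /unvec ord1 mxE.
case: splitP => k _; first by apply: le_trans h1; exact: entry_le_norm.
rewrite mxE; case: splitP => l _; apply: le_trans h2.
  by apply: le_trans h3; exact: entry_le_norm.
by apply: le_trans h4; exact: entry_le_norm.
Qed.

Lemma unvec_continuous : continuous unvec.
Proof.
apply: bounded_linear_continuous; apply/linear_boundedP; exists 1; split=> // k k1 y.
by apply: le_trans (unvec_norm y) _; rewrite ler_peMl // ltW.
Qed.

Section Factor.
Variables (x : source R m n) (Phi : 'rV[C]_(m + (m + n)) -> C) (H : source R m n -> C).
Hypothesis PhiH : forall s, Phi s = H (x + vec s).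

Lemma factor_vec y : H y = Phi (unvec (y - x)).
Proof. by rewrite PhiH unvecK addrC subrK. Qed.

Lemma factor_differentiable : differentiable Phi 0 -> differentiable H x.
Proof.
move=> dP; have -> : H = Phi \o (fun y => unvec (y - x)) by apply/funext => y; exact: factor_vec.
have E : (fun y => unvec (y - x)) = unvec + cst (- unvec x).
  by apply/funext => y; rewrite /= linearB.
have dU : differentiable (fun y => unvec (y - x)) x.
  rewrite E; apply: differentiableD; last exact: differentiable_cst.
  exact: linear_differentiable unvec_continuous.
have dP' : differentiable Phi (unvec (x - x)) by rewrite subrr linear0; exact: dP.
exact: differentiable_comp dU dP'.
Qed.

Lemma factor_derive w : 'D_w H x = 'D_(unvec w) Phi 0.
Proof.
suff E : (fun k : C => k^-1 *: ((H \o shift x) (k *: w) - H x)) =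
    (fun k => k^-1 *: ((Phi \o shift 0) (k *: unvec w) - Phi 0)) by rewrite /derive E.
have E0 : H x = Phi 0.
  rewrite factor_vec; congr Phi; apply/rowP => i; rewrite subrr.
  by rewrite -(scale0r 0) unvecZ scale0r.
have Ek (k : C) : H (k *: w + x) = Phi (k *: unvec w + 0).
  by rewrite factor_vec; congr Phi; rewrite addrK addr0 unvecZ.
by apply/funext => k /=; rewrite E0 Ek.
Qed.
End Factor.

Lemma derive_line (V W : normedModType C) (f : V -> C) (f' : W -> C) a v a' v' :
  (forall k : C, f (k *: v + a) = f' (k *: v' + a')) -> 'D_v f a = 'D_v' f' a'.
Proof.
move=> E; suff EE : (fun k : C => k^-1 *: ((f \o shift a) (k *: v) - f a)) =
    (fun k => k^-1 *: ((f' \o shift a') (k *: v') - f' a')) by rewrite /derive EE.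
apply/funext => k /=; by have := E 0; rewrite !scale0r !add0r => ->; rewrite E.
Qed.

Lemma is_derive_affine (V : normedModType C) (f : V -> C) a v d :
  (forall k : C, f (k *: v + a) = f a + k * d) -> is_derive a v f d.
Proof.
move=> E; apply: derive_cvg; apply: cvg_near_cst; apply/near0P; exists 1; split=> // k _ k0.
by rewrite /= E addrC addKr /GRing.scale /= mulrA mulVf // mul1r.
Qed.
End Poisson.

(** * The realization as a holomorphic family *)

Section Plot.
Variable R : realType.
Local Notation C := (Cplx R).
Variables (m n : nat) (g : quadratic_lie_algebra R n) (h : abelian_subalgebra g m).
Variables (r : 'rV[C]_m -> C -> 'M[C]_n) (t : 'rV[C]_m -> nat -> 'M[C]_n).
Hypothesis drm : dynamical_rmatrix h r t.
Local Notation rc := (rcoef g t).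

(** The value of z (p + r_-^# xi)(z), when f(q, z) = z r(q, z). *)
Definition plot_sum (f : 'rV[C]_(m + 1) -> 'M[C]_n) (q p : 'rV[C]_m) (xi : 'rV[C]_n) (z : C) : 'rV[C]_n :=
  z *: (p *m h) + xi *m (f (point_z q z))^T.

Lemma rho_loop_low q p xi : low 1 (rho h t (q, (p, xi))).2.2.
Proof. by move=> k k1 /=; rewrite const_loop_low // r_minus_sharp_low // addr0. Qed.

Lemma rho_loop_sum (f : 'rV[C]_(m + 1) -> 'M[C]_n) (q p : 'rV[C]_m) (xi : 'rV[C]_n) (z : C) :
  (forall i j, has_sum (fun k => rc q k i j * z ^+ k) (f (point_z q z) i j)) ->
  series (fun k : nat => z ^+ k *: (rho h t (q, (p, xi))).2.2 (-1 + k%:Z)) @ \oo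
    --> plot_sum f q p xi z.
Proof.
move=> hf; have EX (k : nat) : (rho h t (q, (p, xi))).2.2 (-1 + k%:Z) =
    const_loop (p *m h) (k%:Z - 1) + xi *m (rc q k)^T.
  by rewrite addrC -r_minus_sharpE.
move: (rho _ _ _).2.2 EX => X EX; apply: cvg_mx_entry => i j.
have H : has_sum (fun k => (if k == 1%N then z * (p *m h) i j else 0) +
     \sum_l xi i l * (rc q k j l * z ^+ k)) (plot_sum f q p xi z i j).
  rewrite [X in has_sum _ X](_ : _ = z * (p *m h) i j + \sum_l xi i l * f (point_z q z) j l).
    apply: has_sumD; first exact: has_sum_delta.
    by apply: has_sum_big => l; apply: has_sumZ; exact: hf.
  by rewrite /plot_sum mxE [X in X + _]mxE [X in _ + X]mxE; congr (_ + _); apply: eq_bigr => l _; rewrite mxE.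
have E : series (fun k => (if k == 1%N then z * (p *m h) i j else 0) +
     \sum_l xi i l * (rc q k j l * z ^+ k)) =
   (fun N => series (fun k : nat => z ^+ k *: X (-1 + k%:Z)) N i j).
  apply/funext => N; rewrite /series /= summxE; apply: eq_bigr => k _.
  rewrite EX.
  rewrite [RHS]mxE [X in _ = _ * X]mxE mulrDr.
  apply: addr_congr.
    case: (k =P 1%N) => [->|k1]; first by rewrite expr1 const_loop0.
    by rewrite const_loopN0 ?mxE ?mulr0 //; lia.
  rewrite [X in _ = _ * X]mxE mulr_sumr; apply: eq_bigr => l _.
  by rewrite mxE mulrA [RHS]mulrC.
by rewrite -E; exact: has_sum_series H.
Qed.

(** [is_loop] asks for the convergence of the part of non-negative degree, whereas
    joint power series give that of z X(z). *)
Lemma loop_unshift (X : loop R n) (z : C) (L : 'rV[C]_n) : z != 0 ->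
  series (fun k : nat => z ^+ k *: X (-1 + k%:Z)) @ \oo --> L ->
  cvgn (series (fun k : nat => z ^+ k *: X k%:Z)).
Proof.
move=> z0 H; apply/cvg_ex; exists (z^-1 *: (L - X (-1))).
have E : series (fun k : nat => z ^+ k *: X k%:Z) =
    (fun N => z^-1 *: (series (fun k : nat => z ^+ k *: X (-1 + k%:Z)) N.+1 - X (-1))).
  apply/funext => N; rewrite /series /= big_nat_recl // expr0 scale1r addr0 addrC addKr.
  rewrite scaler_sumr; apply: eq_bigr => k _.
  have -> : -1 + k.+1%:Z = k%:Z by lia.
  by rewrite scalerA exprS mulKf.
rewrite E; apply: cvgZr; apply: cvgB; last exact: cvg_cst.
by move: H; rewrite -cvg_shiftS.
Qed.

Lemma rho_is_loop q p xi : base r q -> is_loop (rho h t (q, (p, xi))).2.2.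
Proof.
move=> bq; have [e [B [f [b [[e0 _] _ _ _ hc]]]]] := rcoef_local drm bq.
split; first by exists (-1) => k; exact: rho_loop_low.
set X := (rho h t (q, (p, xi))).2.2.
exists e => // z ze; have [->|z0] := eqVneq z 0.
  apply/cvg_ex; exists (X 0); apply: cvg_near_cst; exists 1%N => // N /= N0.
  case: N N0 => // N _; rewrite /series /= big_nat_recl // expr0 scale1r big1 ?addr0 // => k _.
  by rewrite exprS mul0r scale0r.
have ze' := ltW ze.
have v0 i : `|(0 : 'rV[C]_m) 0 i| <= e by rewrite mxE normr0 ltW.
have H := @rho_loop_sum f q p xi z.
have {}H : series (fun k : nat => z ^+ k *: X (-1 + k%:Z)) @ \oo --> plot_sum f q p xi z.
  apply: H => i j; have [_ /(_ z ze')] := hc 0 v0 i j; by rewrite addr0.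
exact: loop_unshift z0 H.
Qed.

Lemma point_sel (N : nat) (sg : 'I_m -> 'I_N) (F : 'rV[C]_(m + 1) -> C) (q : 'rV[C]_m) :
  holo_at F (point_z q 0) ->
  holo_at (fun w : 'rV[C]_(N + 1) =>
     F (point_z (q + \row_i w 0 (lshift 1 (sg i))) (w 0 (rshift N ord0)))) 0.
Proof.
move=> /holo_shift hF.
pose s (i : 'I_(m + 1)) : 'I_(N + 1) :=
  match fintype.split i with inl i => lshift 1 (sg i) | inr _ => rshift N ord0 end.
have h0 : holo_at (fun y => F (point_z q 0 + y)) (\row_i (0 : 'rV[C]_(N + 1)) 0 (s i)).
  by have -> : \row_i (0 : 'rV[C]_(N + 1)) 0 (s i) = 0 by apply/rowP => i; rewrite !mxE.
have := holo_sel h0; congr holo_at; apply/funext => w; congr F; rewrite point_zD; congr (_ + _).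
apply/rowP => i; rewrite !mxE /s; case: splitP => k _; first by rewrite mxE.
by rewrite (ord1 k) [RHS]mxE eqxx mulr1n.
Qed.

(** The simple pole is common to all the loops, and z (p + r_-^# xi)(z) is jointly
    holomorphic because z r(q, z) is. *)
Lemma rho_plot (x : source R m n) : base r x.1 ->
  target_plot (fun s => rho h t (x + vec s)).
Proof.
case: x => q [p xi] /= bq; have [e [B [f [b [[e0 hf] _ _ _ hc]]]]] := rcoef_local drm bq.
split.
- move=> i j; apply: (eq_ind (fun s : 'rV[C]_(m + (m + n)) => q i j + s 0 (lshift (m + n) j))
    (fun F => holo_at F 0) (holo_affine _ _ _)).
  by apply/funext => s; rewrite /= !mxE ord1.
- move=> i j; apply: (eq_ind (fun s : 'rV[C]_(m + (m + n)) =>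
     \sum_l (- h j l) * (xi i l + s 0 (rshift m (rshift m l)))) (fun F => holo_at F 0)).
    apply: holo_sum => l; apply: holoM; first exact: holo_cst.
    exact: holo_affine.
  apply/funext => s; rewrite /= mxE mxE -sumrN; apply: eq_bigr => l _.
  by rewrite !mxE ord1 mulNr mulrC.
exists (-1), e, (fun w : 'rV[C]_(m + (m + n) + 1) =>
  plot_sum f (q + lsubmx (lsubmx w)) (p + lsubmx (rsubmx (lsubmx w))) (xi + rsubmx (rsubmx (lsubmx w)))
    (rsubmx w 0 0)).
split; [exact: e0| |].
- move=> i j; apply: (eq_ind (fun w : 'rV[C]_(m + (m + n) + 1) =>
     w 0 (rshift _ ord0) * (\sum_l (p 0 l + w 0 (lshift 1 (rshift m (lshift n l)))) * h l j)
     + \sum_l (xi 0 l + w 0 (lshift 1 (rshift m (rshift m l)))) *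
        f (point_z (q + \row_i w 0 (lshift 1 (lshift (m + n) i))) (w 0 (rshift _ ord0))) j l)
     (fun F => holo_at F 0)).
    apply: holoD.
      apply: holoM; first exact: holo_coord.
      apply: holo_sum => l; apply: holoM; first exact: holo_affine.
      exact: holo_cst.
    apply: holo_sum => l; apply: holoM; first exact: holo_affine.
    exact: (@point_sel _ (lshift (m + n)) (fun y => f y j l) q (hf j l)).
  apply/funext => w; rewrite /plot_sum (ord1 i) [RHS]mxE; apply: addr_congr.
    rewrite [RHS]mxE [X in _ = X * _]mxE [X in _ = _ * X]mxE; congr (_ * _).
    by apply: eq_bigr => l _; rewrite !mxE.
  rewrite [RHS]mxE; apply: eq_bigr => l _; rewrite !mxE; congr (_ * f (point_z (q + _) _) j l).
  by apply/rowP => i'; rewrite !mxE.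
move=> s z se ze; split.
  by move=> k k1; exact: (@rho_loop_low (q + lsubmx s) (p + lsubmx (rsubmx s)) (xi + rsubmx (rsubmx s)) k k1).
rewrite row_mxKl row_mxKr mxE eqxx mulr1n.
apply: rho_loop_sum => i j.
have ve i' : `|lsubmx s 0 i'| <= e by rewrite mxE; apply: row_norm_lt.
by have [_ /(_ z (ltW ze))] := hc _ ve i j.
Qed.
End Plot.

(** * The Poisson property *)

Section PoissonMap.
Variable R : realType.
Local Notation C := (Cplx R).
Variables (m n : nat) (g : quadratic_lie_algebra R n) (h : abelian_subalgebra g m).
Variables (r : 'rV[C]_m -> C -> 'M[C]_n) (t : 'rV[C]_m -> nat -> 'M[C]_n).
Hypothesis drm : dynamical_rmatrix h r t.
Local Notation rc := (rcoef g t).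

Lemma is_loop_low (al : loop R n) : is_loop al -> exists K0, forall K, (K0 <= K)%N -> low K al.
Proof. by move=> [[T hT] _]; exists `|T|%N => K TK k kK; apply: hT; lia. Qed.

(** The linear function with differential (a, (u, al)), pulled back by rho. It is
    affine in p and in xi, and involves finitely many of the rc_k(q). *)
Lemma pair_rhoE K al (a u : 'rV[C]_m) q p xi : low K al ->
  dotp (rho h t (q, (p, xi))).1 a + target_pair (rho h t (q, (p, xi))).2 (u, al) =
  dotp q a - dotp xi (u *m h) + dotp (jstar h al) p + dotp (rsharp_adj g t q K al) xi.
Proof.
move=> hal; rewrite /target_pair /rho /=.
have hx1 := @const_loop_low _ _ (p *m h); have hx2 := @r_minus_sharp_low _ _ _ g t q xi.
rewrite (loop_pairDr hal hx1 hx2) dotpNl [dotp (xi *m _) u]dotp_mulmx trmxK -!addrA.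
congr (_ + (_ + (_ + _))).
  rewrite (loop_pair_low1 hal hx1) /jstar dotp_mulmx trmxK.
  case: K hal => [|K] hal.
    rewrite big_ord_recl big_ord0 addr0 const_loopN0 ?dotp0r // hal ?dotp0l //.
  rewrite big_ord_recl const_loopN0 // dotp0r add0r big_ord_recl const_loop0 // big1 ?addr0 //.
  by move=> i _; rewrite const_loopN0 ?dotp0r // !lift0; lia.
rewrite (loop_pair_low1 hal hx2) /rsharp_adj dotp_suml; apply: eq_bigr => b _.
by rewrite r_minus_sharpE dotp_mulmx.
Qed.

Lemma dotpDZ (N : nat) (u v w : 'rV[C]_N) k : dotp u (k *: v + w) = dotp u w + k * dotp u v.
Proof. by rewrite dotpDr dotpZr addrC. Qed.

Section Diff.
Variables (x : source R m n) (F : target R m n -> C) (d : 'rV[C]_m * ('rV[C]_m * loop R n)).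
Hypothesis bx : base r x.1.
Hypothesis hF : target_diff F (rho h t x) d.

(** By [rho_plot], rho in coordinates is one of the families along which
    [target_diff] controls F. *)
Lemma rho_diff_derive : differentiable (F \o rho h t) x /\
  forall w, 'D_w (F \o rho h t) x = 'D_w (fun y => dotp (rho h t y).1 d.1 + target_pair (rho h t y).2 d.2) x.
Proof.
have [_ /(_ _ _ (rho_plot drm bx))] := hF.
have v0 : rho h t (x + vec (0 : 'rV[C]_(m + (m + n)))) = rho h t x.
  congr rho; case: x => q [p xi]; congr pair; last congr pair.
  - by apply/rowP => i; rewrite !mxE addr0.
  - by apply/rowP => i; rewrite !mxE addr0.
  - by apply/rowP => i; rewrite !mxE addr0.
move=> /(_ v0)[dP DP].
split; first exact: (@factor_differentiable R m n x _ (F \o rho h t) (fun s => erefl) dP).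
move=> w; rewrite (@factor_derive R m n x _ (F \o rho h t) (fun s => erefl)).
rewrite [RHS](@factor_derive R m n x (fun s => dotp (rho h t (x + vec s)).1 d.1 + target_pair (rho h t (x + vec s)).2 d.2)) //.
Qed.

Lemma rho_source_diff K : low K d.2.2 ->
  source_diff (F \o rho h t) x =
  (d.1 + drsharp g t x.1 K d.2.2 x.2.2,
   (jstar h d.2.2, - (d.2.1 *m h) + rsharp_adj g t x.1 K d.2.2)).
Proof.
move=> hK; have [_ hD] := rho_diff_derive; case: d hF hK hD => a [u al] /= _ hK hD.
case: x bx hD => q [p xi] /= bq hD.
pose L (y : source R m n) : C := dotp y.1 a - dotp y.2.2 (u *m h) + dotp (jstar h al) y.2.1
   + dotp (rsharp_adj g t y.1 K al) y.2.2.
have LE : (fun y => dotp (rho h t y).1 a + target_pair (rho h t y).2 (u, al)) = L.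
  by apply/funext => -[q' [p' xi']]; exact: pair_rhoE.
have {}hD w : 'D_w (F \o rho h t) ((q, (p, xi)) : source R m n) = 'D_w L ((q, (p, xi)) : source R m n).
  by rewrite hD LE.
rewrite /source_diff; congr pair; last congr pair.
- apply/rowP => i; rewrite mxE hD.
  rewrite (@derive_line R _ _ L (fun q' => L (q', (p, xi))) _ _ q (delta_mx 0 i)); last first.
    by move=> k; congr L; congr (_, (_, _)); rewrite /= scaler0 add0r.
  have H : is_derive q (delta_mx 0 i) (fun q' => L (q', (p, xi)))
      (a 0 i + (drsharp g t q K al xi) 0 i).
    have -> : (fun q' => L (q', (p, xi))) = (fun q' => dotp q' a) +
        (cst (- dotp xi (u *m h) + dotp (jstar h al) p) +
         (fun q' => \sum_(b < K.+1) dotp (al (- b%:Z) *m rc q' b) xi)).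
      by apply/funext => q'; rewrite /L /rsharp_adj /= dotp_suml [RHS]addrA [in RHS]addrA.
    have -> : a 0 i + (drsharp g t q K al xi) 0 i = a 0 i + (0 + (drsharp g t q K al xi) 0 i).
      by rewrite add0r.
    have H1 : is_derive q (delta_mx 0 i) (fun q' => dotp q' a) (a 0 i).
      by apply: is_derive_affine => k; rewrite !(dotpC _ a) dotpDZ dotp_delta.
    have H2 : is_derive q (delta_mx 0 i)
        (fun q' => \sum_(b < K.+1) dotp (al (- b%:Z) *m rc q' b) xi) ((drsharp g t q K al xi) 0 i).
      by rewrite mxE; apply: is_derive_fsum => b; exact: (dotp_rc_derive drm).
    exact: (is_deriveD H1 (is_deriveD (is_derive_cst _ _ _) H2)).
  by rewrite (derive_val (is_derive := H)) [RHS]mxE.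
- apply/rowP => i; rewrite mxE hD.
  apply: (derive_val (is_derive := is_derive_affine _)) => k.
  rewrite /L /= !scaler0 !add0r dotpDZ dotp_delta; ring.
- apply/rowP => i; rewrite mxE hD.
  apply: (derive_val (is_derive := is_derive_affine _)) => k.
  rewrite /L /= !scaler0 !add0r dotpDZ dotp_delta [dotp (_ + _) _]dotpC dotpDZ dotp_delta [dotp (u *m h) xi]dotpC.
  by rewrite !mxE; ring.
Qed.
End Diff.

Lemma rho_poisson : poisson_map h (base r) t (rho h t).
Proof.
move=> x bx; split.
  by split=> //; case: x bx => q [p xi] bx; exact: (rho_is_loop drm p xi bx).
move=> F G dF dG hF hG.
have [dFx _] := rho_diff_derive bx hF; have [dGx _] := rho_diff_derive bx hG.
split; [exact: dFx|exact: dGx|].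
have [K1 hK1] := is_loop_low hF.1; have [K2 hK2] := is_loop_low hG.1.
have lF := hK1 _ (leq_maxl K1 K2); have lG := hK2 _ (leq_maxr K1 K2).
rewrite /source_bracket (rho_source_diff bx hF lF) (rho_source_diff bx hG lG).
case: dF dG lF lG {hF hG dFx dGx hK1 hK2} => a [u al] [b [v be]] /= lF lG.
case: x bx => q [p xi] /= bq.
rewrite -(bracket_full drm p xi a b u v bq lF lG) /lie_poisson /= /source_pair /= dotp0r add0r.
by [].
Qed.
End PoissonMap.

(** * One-parameter groups of linear maps *)

Section Flow.
Variable R : realType.
Local Notation C := (Cplx R).

Lemma nat_gt_norm (x : C) : 0 <= x -> exists n : nat, x < n.+1%:R.
Proof.
move=> x0; have xE : (complex.Re (x : R[i]))%:C%C = x :> R[i] by apply: RRe_real; exact: ger0_real.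
have r0 : 0 <= complex.Re (x : R[i]) by rewrite -lecR xE.
exists (Num.bound (complex.Re (x : R[i]))).
have := archi_boundP r0; rewrite -ltcR xE => xb; apply: lt_le_trans xb _.
by rewrite rmorph_nat ler_nat.
Qed.

(** Phi (n u) t - t is the sum of the Phi (j u) (Phi u t - t) over j < n, so its
    norm is at most n K |Phi u t - t|. For u = s / n this is n K o(s / n), which
    tends to 0 as n grows. This settles small s, hence all s. *)
Lemma flow_fixed (V : normedModType C) (Phi : C -> V -> V) (t : V) (K d : C) :
  0 <= K -> 0 < d -> (forall s x y, Phi s (x + y) = Phi s x + Phi s y) ->
  (forall s u x, Phi (s + u) x = Phi s (Phi u x)) -> Phi 0 t = t ->
  (forall s x, `|s| < d -> `|Phi s x| <= K * `|x|) ->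
  is_derive (0 : C) 1 (fun s => Phi s t) 0 -> forall s, Phi s t = t.
Proof.
move=> K0 d0 PhiD Phi_comp Phi0 bound [dPhi DPhi].
have small s : `|s| < d -> Phi s t = t.
  move=> sd; suff main (e : C) : 0 < e -> `|Phi s t - t| <= e.
    apply/eqP; rewrite -subr_eq0 -normr_le0; apply/ler_addgt0Pl => e e0.
    by rewrite addr0; exact: main.
  move=> e0.
  pose e' : C := e / (K * `|s| + 1).
  have D0 : 0 < K * `|s| + 1 by rewrite ltr_wpDl // mulr_ge0.
  have e'0 : 0 < e' by rewrite divr_gt0.
  have [c [c0 hc]] : exists c : C, 0 < c /\ forall u, `|u| < c -> `|Phi u t - t| <= e' * `|u|.
    move/cvgrPdist_le : (dPhi) => /(_ _ e'0); rewrite -/(derive _ _ _) DPhi.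
    move=> /near0P[c [c0 hc]]; exists c; split=> // u uc.
    have [->|u0] := eqVneq u 0; first by rewrite Phi0 subrr !normr0 mulr0.
    have := hc u uc u0; rewrite /= addr0 sub0r normrN normrZ normfV Phi0 [u *: 1]mulr1.
    by rewrite ler_pdivrMl ?normr_gt0 // mulrC.
  have tele u n : (forall j, (j < n)%N -> `|j%:R * u| < d) ->
      `|Phi (n%:R * u) t - t| <= n%:R * (K * `|Phi u t - t|).
    elim: n => [|n IH] hn; first by rewrite !mul0r Phi0 subrr normr0.
    have -> : Phi (n.+1%:R * u) t - t = Phi (n%:R * u) (Phi u t - t) + (Phi (n%:R * u) t - t).
      rewrite -[n.+1]addn1 natrD mulrDl mul1r Phi_comp addrA; congr (_ - _).
      by rewrite -PhiD subrK.
    apply: le_trans (ler_normD _ _) _.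
    rewrite -[n.+1]addn1 natrD mulrDl mul1r addrC; apply: lerD.
      by apply: IH => j jn; apply: hn; rewrite ltnS ltnW.
    by apply: bound; apply: hn.
  have [n hn] := nat_gt_norm (divr_ge0 (normr_ge0 s) (ltW c0)).
  have n0 : (n.+1%:R : C) != 0 by rewrite pnatr_eq0.
  have ngt0 : 0 < n.+1%:R :> C by rewrite ltr0n.
  pose u := s / n.+1%:R.
  have sE : n.+1%:R * u = s by rewrite mulrC divfK.
  have uE : `|u| = `|s| / n.+1%:R by rewrite normrM normfV normr_nat.
  have uc : `|u| < c by rewrite uE ltr_pdivrMr // mulrC -ltr_pdivrMr.
  have hj j : (j < n.+1)%N -> `|j%:R * u| < d.
    move=> jn; apply: le_lt_trans sd; rewrite normrM normr_nat uE mulrCA ler_piMr //.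
    by rewrite ler_pdivrMr // mul1r ler_nat ltnW.
  have := tele u n.+1 hj; rewrite sE => H; apply: le_trans H _.
  apply: (@le_trans _ _ (n.+1%:R * (K * (e' * `|u|)))).
    by rewrite ler_pM2l // ler_wpM2l // hc.
  have -> : n.+1%:R * (K * (e' * `|u|)) = e * (K * `|s| / (K * `|s| + 1)).
    by rewrite uE /e' [n.+1%:R * _]mulrC -!mulrA mulVf // mulr1 [RHS]mulrCA; congr (_ * _); rewrite mulrCA mulrC mulrA.
  by rewrite ler_piMr ?(ltW e0) // ler_pdivrMr // mul1r lerDl.
move=> s; have [n hn] := nat_gt_norm (divr_ge0 (normr_ge0 s) (ltW d0)).
have ngt0 : 0 < n.+1%:R :> C by rewrite ltr0n.
pose u := s / n.+1%:R; have <- : n.+1%:R * u = s by rewrite mulrC divfK // gt_eqF.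
have ud : `|u| < d by rewrite normrM normfV normr_nat ltr_pdivrMr // mulrC -ltr_pdivrMr.
elim: n.+1 => [|j IH]; first by rewrite mul0r Phi0.
by rewrite -addn1 natrD mulrDl mul1r Phi_comp small.
Qed.

Lemma mulmx_norm_le (p q r : nat) (M : 'M[C]_(p, q)) (N : 'M[C]_(q, r)) :
  `|M *m N| <= q%:R * `|M| * `|N|.
Proof.
apply: mx_norm_le => [|i j]; first by rewrite !mulr_ge0.
rewrite mxE; apply: le_trans (ler_norm_sum _ _ _) _.
rewrite -mulrA mulr_natl -[X in _ *+ X]card_ord -sumr_const.
by apply: ler_sum => k _; rewrite normrM ler_pM // entry_le_norm.
Qed.

Lemma is_derive_mx_bound (p : nat) (B : C -> 'M[C]_p) (dB : 'M[C]_p) :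
  (forall i j, is_derive (0 : C) 1 (fun s => B s i j) (dB i j)) ->
  \forall s \near (0 : C), `|B s| <= `|B 0| + 1.
Proof.
move=> hB; have cB : B @ (0 : C) --> B 0.
  apply: (@cvg_mx_entry R p p C (nbhs (0 : C)) _ B (B 0)) => i j; have [h _] := hB i j.
  exact/differentiable_continuous/derivable1_diffP.
move/cvgrPdist_le : cB => /(_ 1 ltr01); apply: filterS => s hs.
rewrite -[X in `|X| <= _](subKr (B 0)); apply: le_trans (ler_normB _ _) _.
by rewrite lerD2l.
Qed.

(** The hypothesis on t says that the infinitesimal action of the two groups
    annihilates it. *)
Lemma mx_flow_fixed (p q : nat) (A : C -> 'M[C]_p) (B : C -> 'M[C]_q)
    (dA : 'M[C]_p) (dB : 'M[C]_q) (t : 'M[C]_(p, q)) :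
  A 0 = 1%:M -> B 0 = 1%:M ->
  (forall s u, A (s + u) = A s *m A u) -> (forall s u, B (s + u) = B u *m B s) ->
  (forall i j, is_derive (0 : C) 1 (fun s => A s i j) (dA i j)) ->
  (forall i j, is_derive (0 : C) 1 (fun s => B s i j) (dB i j)) ->
  dA *m t + t *m dB = 0 -> forall s, A s *m t *m B s = t.
Proof.
move=> A0 B0 AD BD hA hB dAB.
have : \forall s \near (0 : C), `|A s| <= `|A 0| + 1 /\ `|B s| <= `|B 0| + 1.
  by apply: filterS2 (is_derive_mx_bound hA) (is_derive_mx_bound hB).
move=> /near_norm[d [d0 hd]].
apply: (@flow_fixed 'M[C]_(p, q) (fun s M => A s *m M *m B s) t
  (q%:R * (p%:R * (`|A 0| + 1)) * (`|B 0| + 1)) d) => //.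
- by move=> s x y; rewrite mulmxDr mulmxDl.
- by move=> s u x; rewrite AD BD !mulmxA.
- by rewrite A0 B0 mul1mx mulmx1.
- move=> s x sd; have := hd s sd; rewrite add0r => -[hs1 hs2].
  apply: le_trans (mulmx_norm_le _ _) _; rewrite [leRHS]mulrAC; apply: ler_pM => //.
  rewrite -mulrA ler_wpM2l //; apply: le_trans (mulmx_norm_le _ _) _.
  by rewrite ler_wpM2r // ler_wpM2l.
apply: is_derive_mx => i j.
have hD k : is_derive (0 : C) 1 (fun s => (A s *m t) i k) ((dA *m t) i k).
  have -> : (fun s => (A s *m t) i k) = (fun s => \sum_l t l k * A s i l).
    by apply/funext => s; rewrite mxE; apply: eq_bigr => l _; rewrite mulrC.
  have -> : (dA *m t) i k = \sum_l t l k * dA i l.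
    by rewrite mxE; apply: eq_bigr => l _; rewrite mulrC.
  by apply: is_derive_fsum => l; apply: is_deriveZl.
have -> : (fun s => (A s *m t *m B s) i j) = (fun s => \sum_k ((fun s => (A s *m t) i k) * (fun s => B s k j)) s).
  by apply/funext => s; rewrite mxE.
have -> : (0 : 'M[C]_(p, q)) i j = \sum_k ((A 0 *m t) i k *: dB k j + B 0 k j *: (dA *m t) i k).
  rewrite -dAB big_split /= [LHS]mxE addrC; congr (_ + _).
    by rewrite A0 mul1mx mxE.
  by rewrite -[in LHS](mulmx1 (dA *m t)) -B0 mxE; apply: eq_bigr => k _; rewrite [RHS]mulrC.
by apply: is_derive_fsum => k; apply: is_deriveM.
Qed.
End Flow.

(** * The adjoint representation *)

Section Adjoint.
Variable R : realType.
Local Notation C := (Cplx R).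

Lemma differentiable_mx (V : normedModType C) (k l : nat) (f : V -> 'M[C]_(k, l)) (p : V) :
  (forall i j, differentiable (fun x => f x i j : C) p) -> differentiable f p.
Proof.
move=> hf.
have -> : f = \sum_(i < k) \sum_(j < l) (fun x => f x i j *: delta_mx i j).
  apply/funext => x; rewrite fct_sumE {1}(matrix_sum_delta (f x)).
  by apply: eq_bigr => i _; rewrite fct_sumE.
by apply: differentiable_sum => i; apply: differentiable_sum => j; exact: differentiableZl.
Qed.

Variables (n : nat) (g : lie_algebra R n) (G : lie_group g).
Local Notation par := (@lg_par R n g G).
Local Notation coord := (@lg_coord R n g G).

Definition conj_chart (x : G) (v : 'rV[C]_n) : 'rV[C]_n := coord (x * par v * x^-1)%g.

Lemma conj_chart_diff x : differentiable (conj_chart x) 0.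
Proof.
apply: differentiable_mx => i j; apply: holo_differentiable; exact: (lg_conj_holo x i j).
Qed.

Lemma coord1 : coord 1%g = 0.
Proof. by rewrite -(lg_par0 G) lg_parK // normr0 lg_rad_gt0. Qed.

Lemma conj_chart0 x : conj_chart x 0 = 0.
Proof. by rewrite /conj_chart lg_par0 mulg1 mulgV coord1. Qed.

Lemma AdE x : @Ad R n g G x = 'd (conj_chart x) 0 :> ('rV[C]_n -> 'rV[C]_n).
Proof. by apply/funext => Y; rewrite -deriveE //; exact: conj_chart_diff. Qed.

Lemma Ad1 Y : @Ad R n g G 1%g Y = Y.
Proof.
rewrite /Ad /Ad_chart -[RHS](derive_id (0 : 'rV[C]_n)); apply: near_eq_derive.
apply: (norm_near (lg_rad_gt0 G)) => v vr.
by rewrite add0r mul1g invg1 mulg1 lg_parK.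
Qed.

(** The chain rule, for conjugations in the chart. *)
Lemma AdM x y Y : @Ad R n g G (x * y)%g Y = Ad x (Ad y Y).
Proof.
have dx := conj_chart_diff x; have dy := conj_chart_diff y.
have dx' : differentiable (conj_chart x) (conj_chart y 0) by rewrite conj_chart0.
have dxy : differentiable (conj_chart x \o conj_chart y) 0 := differentiable_comp dy dx'.
have := diff_comp dy dx'; rewrite conj_chart0 => E.
transitivity ('d (conj_chart x \o conj_chart y) 0 Y); last by rewrite E /= (AdE x) (AdE y).
rewrite -(deriveE _ dxy); apply: near_eq_derive; apply: filterS (lg_conj_chart y) => v [_ hv].
by rewrite /conj_chart /= hv invgM !mulgA.
Qed.

Definition Ad_mx (x : G) : 'M[C]_n := lin1_mx (Ad x).

Lemma Ad_mxE x Y : Y *m Ad_mx x = Ad x Y.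
Proof. by rewrite /Ad_mx AdE mul_rV_lin1. Qed.

Lemma Ad_mx1 : Ad_mx 1%g = 1%:M.
Proof. by apply/row_matrixP => i; rewrite !rowE Ad_mxE Ad1 mulmx1. Qed.

Lemma Ad_mxM x y : Ad_mx (x * y)%g = Ad_mx y *m Ad_mx x.
Proof.
apply/row_matrixP => i; rewrite [LHS]rowE [RHS]rowE mulmxA.
set Y : 'rV[C]_n := delta_mx 0 i.
rewrite [LHS]Ad_mxE AdM; have := Ad_mxE y Y.
by move: (Ad y Y) => Z ->; rewrite [RHS]Ad_mxE.
Qed.

Lemma Ad_mxV x : Ad_mx x *m Ad_mx x^-1%g = 1%:M.
Proof. by rewrite -Ad_mxM mulVg Ad_mx1. Qed.

(** The chain rule along s |-> c s, given the differential of Ad at the identity of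
    the group. *)
Lemma Ad_mx_derive X c : @one_parameter_subgroup R n g G X c ->
  [/\ c 0 = 1%g, forall s u, Ad_mx (c (s + u)) = Ad_mx (c u) *m Ad_mx (c s) &
      forall i j, is_derive (0 : C) 1 (fun s => Ad_mx (c s) i j) (ad_mx g X i j)].
Proof.
move=> [cD cchart dc]; have c0 : c 0 = 1%g.
  by apply: (mulgI (c 0)); rewrite -cD addr0 mulg1.
split=> // [s u|i j]; first by rewrite cD Ad_mxM.
pose Y : 'rV[C]_n := delta_mx 0 i; pose ga s := coord (c s).
pose F v := Ad_chart par coord (par v) Y.
have ga0 : ga 0 = 0 by rewrite /ga c0 coord1.
have dga : differentiable ga 0 by apply/derivable1_diffP; case: dc.
have [dF DF] := lg_ad G Y.
have dF' : differentiable F (ga 0) by rewrite ga0.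
have dFg : differentiable (F \o ga) 0 by exact: differentiable_comp.
have H : is_derive (0 : C) 1 (F \o ga) (lbr g X Y).
  split; first exact: diff_derivable.
  rewrite deriveE // diff_comp //= ga0 DF -(deriveE _ dga); congr (lbr g _ _).
  by case: dc.
have {}H : is_derive (0 : C) 1 (fun s => Ad (c s) Y) (lbr g X Y).
  by apply: near_eq_is_derive H; apply: filterS cchart => s [_ hs]; rewrite /= /F /ga hs.
have -> : (fun s => Ad_mx (c s) i j) = (fun s => (Ad (c s) Y) 0 j).
  by apply/funext => s; rewrite -(Ad_mxE (c s) Y) -rowE [RHS]mxE.
rewrite -[ad_mx g X i j](_ : (lbr g X Y) 0 j = _); last by rewrite /ad_mx /lin1_mx mxE.
have [dH DH] := H; apply: derive_cvg.
have H3 : (fun s : C => s^-1 *: (((fun u => Ad (c u) Y) \o shift 0) (s *: 1) - Ad (c 0) Y)) @ 0^' -->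
    lbr g X Y by rewrite -DH; exact: dH.
have H4 := @entry_cvg R 1 n C ((0 : C)^') (@Proper_dnbhs_numFieldType C 0) _ _ 0 j H3.
by apply: (cvg_trans _ H4); apply: near_eq_cvg; apply: nearW => s; rewrite !mxE.
Qed.
End Adjoint.

(** * Equivariance *)

Section Equivariance.
Variable R : realType.
Local Notation C := (Cplx R).
Variables (m n : nat) (g : quadratic_lie_algebra R n) (h : abelian_subalgebra g m).
Variables (r : 'rV[C]_m -> C -> 'M[C]_n) (t : 'rV[C]_m -> nat -> 'M[C]_n).
Variable G : lie_group g.
Hypothesis drm : dynamical_rmatrix h r t.

Lemma connected_subgroup_fix (V : Type) (act : G -> V -> V) (v : V) :
  (forall x y w, act (x * y)%g w = act x (act y w)) -> act 1%g v = v ->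
  (forall u c s, @one_parameter_subgroup R n g G (u *m h) c -> act (c s) v = v) ->
  forall x, @connected_subgroup R n g m h G x -> act x v = v.
Proof.
move=> actM act1 act_exp x; elim=> {x} [u c s|//|x _ IH|x y _ IHx _ IHy]; first exact: act_exp.
  by rewrite -[X in act _ X]IH -actM mulVg.
by rewrite actM IHy.
Qed.

Lemma incl_ad u : h *m ad_mx g (u *m h) = 0.
Proof.
apply/row_matrixP => i; rewrite row_mul ad_mxE rowE row0; exact: incl_abelian.
Qed.

(** As h is abelian, exp(h) acts trivially on h. *)
Lemma incl_Ad x : @connected_subgroup R n g m h G x -> h *m Ad_mx x = h.
Proof.
apply: (connected_subgroup_fix (act := fun x M => M *m Ad_mx x)).
- by move=> y z M; rewrite /= (Ad_mxM y z) mulmxA.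
- by rewrite Ad_mx1 mulmx1.
move=> u c s /Ad_mx_derive[c0 cM cd].
have dA (i j : 'I_m) : is_derive (0 : C) 1 (fun=> (1%:M : 'M[C]_m) i j) ((0 : 'M[C]_m) i j).
  by rewrite [X in is_derive _ _ _ X]mxE; exact: is_derive_cst.
have AD (a b : C) : (1%:M : 'M[C]_m) = 1%:M *m 1%:M by rewrite mul1mx.
have B0 : Ad_mx (c 0) = 1%:M by rewrite c0 Ad_mx1.
have dAB : 0 *m (h : 'M[C]_(m, n)) + h *m ad_mx g (u *m h) = 0 by rewrite mul0mx add0r incl_ad.
by have := mx_flow_fixed (erefl _) B0 AD cM dA cd dAB s; rewrite mul1mx.
Qed.

(** Zero weight is the infinitesimal form of this invariance. *)
Lemma rcoef_Ad q k x : base r q -> @connected_subgroup R n g m h G x ->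
  (Ad_mx x)^T *m rcoef g t q k *m Ad_mx x = rcoef g t q k.
Proof.
move=> bq; apply: (connected_subgroup_fix (act := fun x M => (Ad_mx x)^T *m M *m Ad_mx x)).
- by move=> y z M; rewrite /= (Ad_mxM y z) trmx_mul !mulmxA.
- by rewrite Ad_mx1 trmx1 mul1mx mulmx1.
move=> u c s /Ad_mx_derive[c0 cM cd].
apply: (@mx_flow_fixed R n n (fun s => (Ad_mx (c s))^T) (fun s => Ad_mx (c s))
  (ad_mx g (u *m h))^T (ad_mx g (u *m h))) => //.
- by rewrite c0 Ad_mx1 trmx1.
- by rewrite c0 Ad_mx1.
- by move=> a b; rewrite cM trmx_mul.
- move=> i j; rewrite mxE; under eq_fun do rewrite mxE; exact: cd.
- exact: (rcoef_zero_weight drm u k bq).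
Qed.

Lemma rlaurent_Ad q k x : base r q -> @connected_subgroup R n g m h G x ->
  (Ad_mx x)^T *m rlaurent g t q k *m Ad_mx x = rlaurent g t q k.
Proof.
move=> bq hx; case: k => [k|[|k]] /=; last by rewrite mulmx0 mul0mx.
  exact: (rcoef_Ad k.+1 bq hx).
exact: (rcoef_Ad 0 bq hx).
Qed.

Lemma rho_equivariant : equivariant h G (base r) (rho h t).
Proof.
move=> x hx [q [p xi]] /= bq.
have hV : @connected_subgroup R n g m h G x^-1%g := connected_subgroupV hx.
rewrite /rho /source_act /target_act /= /coAd -/(Ad_mx _).
congr (_, (_, _)).
  by rewrite -mulmxA -trmx_mul (incl_Ad hV).
apply/funext => k; rewrite -(Ad_mxE x) mulmxDl; congr (_ + _).
  rewrite /const_loop; case: eqP => _; last by rewrite mul0mx.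
  by rewrite -mulmxA (incl_Ad hx).
rewrite /r_minus_sharp -[in LHS](rlaurent_Ad k bq hx).
(* Ad_x^-1 cancels one of the two factors Ad_x by which rc is transformed. *)
have := Ad_mxV x; move: (Ad_mx x) (Ad_mx x^-1) (rlaurent g t q k) => B Bi M BBi.
by rewrite trmx_mul trmx_mul trmxK !mulmxA -(mulmxA xi Bi^T B^T) -trmx_mul BBi trmx1 mulmx1.
Qed.
End Equivariance.

Theorem theorem4p6 (R : realType) (m n : nat) (g : quadratic_lie_algebra R n)
    (h : abelian_subalgebra g m) (G : lie_group g)
    (r : 'rV[Cplx R]_m -> Cplx R -> 'M[Cplx R]_n)
    (t : 'rV[Cplx R]_m -> nat -> 'M[Cplx R]_n) :
  dynamical_rmatrix h r t ->
  poisson_map h (base r) t (rho h t) /\ equivariant h G (base r) (rho h t).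
Proof. by move=> drm; split; [exact: rho_poisson drm|exact: rho_equivariant drm]. Qed.
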